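(* Assume the standing setup and that $f$ is $N$-regular with respect to $g_1,\dots,g_m$. For $1\le i\le m$ and $1\le j\le\ell_i$, let $q_{i,j}\in\mathbb Z[x]$ be the quotient of the division of $f$ by $g_i^j$, and let $y_{i,j}$ be the ordinate of the point of $N_{g_i}^-(f)$ with abscissa $j$. Put $$\alpha_{i,j,k}=q_{i,j}(\theta)\,\theta^k,\qquad 1\le i\le m,\ 1\le j\le\ell_i,\ 0\le k<\deg g_i.$$ Then the family of all $\alpha_{i,j,k}/N^{\lfloor y_{i,j}\rfloor}$ is an $N$-integral basis of $\mathbb Z_K$ if and only if at least one of the following holds: (a) $N$ is squarefree; (b) all slopes of all the polygons $N_{g_i}^-(f)$, $1\le i\le m$, are integers.
   Context: Standing setup: $f\in\mathbb Z[x]$ monic irreducible of degree $n>1$, $\theta$ a root, $K=\mathbb Q(\theta)$, $\mathbb Z_K$ its ring of integers; $N>1$ an integer all of whose prime divisors are $>n$; $g_1,\dots,g_m\in\mathbb Z[x]$ monic of positive degree and $\ell_i$ positive integers with $f\equiv\prod g_i^{\ell_i}\pmod N$, $\operatorname{red}_p(g_i)$ squarefree and pairwise coprime in $\mathbb F_p[x]$ for every prime $p\mid N$. For $a\in\mathbb Z\setminus\{0\}$, $v_N(a)$ is defined if $a=N^kb$ with $\gcd(b,N)=1$, then $v_N(a)=k$; $v_N(0)=\infty$. For each $i$: $f=\sum_s a_{i,s}g_i^s$ with $\deg a_{i,s}<\deg g_i$, $u_{i,s}=v_N(a_{i,s})$, $N_{g_i}^-(f)$ the part of negative slope of the lower convex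 hull of the points $(s,u_{i,s})$, $u_{i,s}<\infty$ (its length is $\ell_i$). $A_1^{(i)}=\mathbb Z[x]/(N,g_i)$; for a side of slope $-\lambda=-h/e$ ($h,e$ coprime positive) with left abscissa $s$ and horizontal length $de$, $R_{g_i,\lambda}(f)=\sum_{t=0}^d c_{s+te}y^t\in A_1^{(i)}[y]$ where $c_r$ is the image of $a_{i,r}/N^{u_{i,r}}$ if $(r,u_{i,r})$ lies on the polygon and $0$ otherwise; such a polynomial is squarefree if its reduction modulo every maximal ideal of $A_1^{(i)}$ is squarefree. $N$-regular: (1) $v_N(a_{i,s})$ is defined for all $i,s$; (2) for all $i$, every vertex abscissa $s$ of $N_{g_i}^-(f)$ and every prime $p\mid N$, $\operatorname{red}_p(a_{i,s}/N^{u_{i,s}})$ and $\operatorname{red}_p(g_i)$ are coprime in $\mathbb F_p[x]$; (3) for all $i$ and every slope $-\lambda$ of $N_{g_i}^-(f)$, $R_{g_i,\lambda}(f)$ is squarefree. A family $\alpha_1,\dots,\alpha_n\in\mathbb Z_K$ is a $p$-integral basis if $\alpha_1\otimes1,\dots,\alpha_n\otimes1$ is a $\mathbb Z_{(p)}$-basis of $\mathbb Z_K\otimes_{\mathbb Z}\mathbb Z_{(p)}$; it is an $N$-integral basis if it is a $p$-integral basis for every prime $p\mid N$. *)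

(* Defs.v *)
From HB Require Import structures.
From mathcomp Require Import all_boot all_order all_algebra all_field.
Set Implicit Arguments. Unset Strict Implicit. Unset Printing Implicit Defensive.
Import Order.TTheory GRing.Theory Num.Theory.
Local Open Scope ring_scope.

Definition redp (p : nat) (a : {poly int}) : {poly 'F_p} :=
  map_poly (fun z : int => z%:~R) a.

Definition sqfree (F : fieldType) (r : {poly F}) : Prop :=
  forall h : {poly F}, h * h %| r -> (size h <= 1)%N.

Definition sqfree_nat (N : nat) : Prop :=
  forall p : nat, prime p -> ~~ (p * p %| N)%N.

Fixpoint nvalrec (N c fuel : nat) : nat :=
  match fuel with
  | 0 => 0
  | fuel'.+1 => if (0 < c)%N && (N %| c)%N then (nvalrec N (c %/ N) fuel').+1 else 0
  end.
(* largest k with N^k | c (for c > 0, N > 1) *)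
Definition nval (N c : nat) : nat := nvalrec N c c.

Definition vN_defined (N : nat) (a : {poly int}) : Prop :=
  a = 0 \/ exists (k : nat) (b : {poly int}),
            a = (N%:Z ^+ k) *: b /\ coprime `|zcontents b|%N N.

(* the exponent k of v_N(a) (meaningful when a <> 0 and vN_defined) *)
Definition vNexp (N : nat) (a : {poly int}) : nat := nval N `|zcontents a|%N.

Definition unitpart (N : nat) (a : {poly int}) : {poly int} :=
  map_poly (fun c : int => (c %/ (N%:Z ^+ vNexp N a))%Z) a.

(* a_s : f = sum_s a_s g^s, deg a_s < deg g *)
Definition dig (f g : {poly int}) (s : nat) : {poly int} := (f %/ g ^+ s) %% g.

Definition pts (N : nat) (f g : {poly int}) : seq (nat * nat) :=
  [seq (s, vNexp N (dig f g s)) | s <- iota 0 (size f) & dig f g s != 0].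

Definition interp (P Q : nat * nat) (j : nat) : rat :=
  if P.1 == Q.1 then (P.2)%:R
  else (P.2)%:R + ((Q.2)%:R - (P.2)%:R) * (j%:R - (P.1)%:R) / ((Q.1)%:R - (P.1)%:R).

Definition cands (N : nat) (f g : {poly int}) (j : nat) : seq rat :=
  [seq interp P Q j | P <- pts N f g,
                      Q <- [seq Q <- pts N f g | (P.1 <= j <= Q.1)%N]].

(* abscissa j lies in the range of the lower convex hull *)
Definition hdef N f g j : bool := cands N f g j != [::].

(* ordinate of the lower convex hull at abscissa j *)
Definition hull N f g (j : nat) : rat :=
  let c := cands N f g j in foldr Order.min (head 0 c) c.

Definition slope N f g (j : nat) : rat := hull N f g j.+1 - hull N f g j.

Definition is_side N f g (s len : nat) (sigma : rat) : Prop :=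
  [/\ (0 < len)%N, sigma < 0,
      forall k, (s <= k < s + len)%N ->
        [&& hdef N f g k, hdef N f g k.+1 & slope N f g k == sigma],
      s = 0%N \/ ~~ hdef N f g s.-1 \/ slope N f g s.-1 != sigma
    & ~~ hdef N f g (s + len).+1 \/ slope N f g (s + len) != sigma].

Definition rescoef N f g (r : nat) : {poly int} :=
  if (dig f g r != 0) && (hull N f g r == (vNexp N (dig f g r))%:R)
  then unitpart N (dig f g r) else 0.

Definition respoly N f g (s len : nat) (sigma : rat) : {poly {poly int}} :=
  let e := `|denq sigma|%N in
  \poly_(t < (len %/ e).+1) rescoef N f g (s + t * e).

Definition N_regular (N : nat) (f : {poly int}) (m : nat) (g : 'I_m -> {poly int}) : Prop :=
  [/\ forall i s, vN_defined N (dig f (g i) s),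
      forall i s len sigma, is_side N f (g i) s len sigma ->
        forall r, (r = s \/ r = s + len)%N ->
        forall p, prime p -> (p %| N)%N ->
          coprimep (redp p (unitpart N (dig f (g i) r))) (redp p (g i))
    & forall i s len sigma, is_side N f (g i) s len sigma ->
        (* reduction modulo every maximal ideal of A_1 = Z[x]/(N, g_i),
           i.e. along every surjective ring morphism onto a field killing N and g_i *)
        forall (F : fieldType) (psi : {rmorphism {poly int} -> F}),
          (forall y, exists x, psi x = y) -> psi (N%:R) = 0 -> psi (g i) = 0 ->
          sqfree (map_poly psi (respoly N f (g i) s len sigma))].

Definition inK (theta x : algC) : Prop :=
  exists q : {poly rat}, x = (map_poly ratr q).[theta].

Definition ZK (theta x : algC) : Prop := inK theta x /\ x \in Aint.

Definition Zloc (p : nat) (c : rat) : bool := ~~ (p %| `|denq c|)%N.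

Definition lincomb (c : seq rat) (s : seq algC) : algC :=
  \sum_(i < size s) ratr c`_i * s`_i.

(* s is a p-integral basis: elements of Z_K whose images form a Z_(p)-basis of
   Z_K (x) Z_(p) (identified with the localisation of Z_K inside K). *)
Definition p_integral_basis (theta : algC) (p : nat) (s : seq algC) : Prop :=
  [/\ forall x, x \in s -> ZK theta x,
      forall z, ZK theta z -> exists c : seq rat,
        [/\ size c = size s, all (Zloc p) c & z = lincomb c s]
    & forall c : seq rat, size c = size s -> all (Zloc p) c ->
        lincomb c s = 0 -> all (fun a => a == 0) c].

Definition N_integral_basis (theta : algC) (N : nat) (s : seq algC) : Prop :=
  forall p, prime p -> (p %| N)%N -> p_integral_basis theta p s.

Definition alpha (theta : algC) (f g : {poly int}) (j k : nat) : algC :=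
  (map_poly (fun z : int => z%:~R) (f %/ g ^+ j)).[theta] * theta ^+ k.

Definition alpha_family (theta : algC) (N : nat) (f : {poly int}) (m : nat)
    (g : 'I_m -> {poly int}) (ell : 'I_m -> nat) : seq algC :=
  flatten [seq flatten
    [seq [seq alpha theta f (g i) j k / ((N%:R : algC) ^ Num.floor (hull N f (g i) j))
         | k <- iota 0 (size (g i)).-1]
    | j <- iota 1 (ell i)]
  | i <- enum 'I_m].

(* Main.v *)
Require Import Defs.
From HB Require Import structures.
From mathcomp Require Import all_boot all_order all_algebra all_field.
From mathcomp Require Import boolp.
From mathcomp Require classical_sets.
From mathcomp Require Import ring lra zify.
Import Order.TTheory GRing.Theory Num.Theory.
Local Open Scope ring_scope.
Set Implicit Arguments.
Unset Strict Implicit.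
Unset Printing Implicit Defensive.

(** Write [y_ij] for the ordinate of the [i]-th polygon at [j]. Fix a prime [p] dividing [N]
and extend the [p]-adic valuation to a valuation ring [V] of the field of algebraic numbers,
with maximal ideal [M]. The elements [q_ij(theta) / N^y_ij] are algebraic integers, because
multiplication by such an element preserves a lattice spanned by powers of [g_i(theta)].

Conversely let [C_ij] be polynomials over [V] of degree less than [deg g_i] such that
[z = sum C_ij q_ij / N^y_ij] takes values in [M] at every root of [f]; then every [C_ij] has
coefficients in [M]. Pair [z] with [w = N^y_ij g_i^(j-1) B prod_(k <> i) g_k^l_k] by Euler's
form [S(h) = sum_r h(r) / f'(r)], which is the coefficient of degree [n - 1] of [h] modulo [f].
Modulo [M] only the pair [(i, j)] contributes to [S(z w)], and it determines [C_ij].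
Regularity enters in the integrality of [w(r) / f'(r)] for every root [r]: since the residual
polynomials are separable modulo every maximal ideal (their degree is less than [p]), the
valuation of [f'(r)] is exactly the one predicted by the side of the polygon to which [r]
belongs.

Hence a combination of the [q_ij(theta) theta^k] is integral at [p] only if the coefficients
times [N^y_ij] are. This gives a basis when the [y_ij] are integers or [N] is squarefree.
If [p^2] divides [N] and some slope is not an integer, then some [y_ij] has fractional part at
least 1/2, and [q_ij(theta) / (p N^floor(y_ij))] is integral, its square being so. *)

(** * Valuation rings of the algebraic numbers *)

(** All of [algC] is used, rather than [K], for two reasons. The positive real powers [N^r] with [r]
    rational become available, so that a side of any slope can be scaled to slope zero; and a single
    [V] suffices for [p], since the primes of [K] above [p] are seen by evaluating polynomials at
    the different roots of [f]. For composite [N] the partial function [v_N] is not a valuation, so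
    the polygons are read in [V], one prime at a time. At a root where [g_i] takes a value in [M],
    regularity turns the unit parts at the vertices into units of [V], and dominant terms can be
    compared through powers of [N] alone. Besides making squarefree residual polynomials separable,
    the bound [p > n] serves twice: a squarefree reduction of [g_i] is prime to its derivative, and
    the denominator of a slope is a unit of [V]. *)

Definition adjoin (A : {pred algC}) (x : algC) : {pred algC} :=
  [pred y | `[< exists2 h : {poly algC}, h \is a polyOver A & y = h.[x] >]].

Lemma adjoin_subring (A : subringClosed algC) x : subring_closed (adjoin A x).
Proof.
split.
- by apply/asboolP; exists 1; rewrite ?hornerC // rpred1.
- move=> _ _ /asboolP[h Ah ->] /asboolP[k Ak ->]; apply/asboolP.
  by exists (h - k); rewrite ?hornerE ?rpredB.
- move=> _ _ /asboolP[h Ah ->] /asboolP[k Ak ->]; apply/asboolP.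
  by exists (h * k); rewrite ?hornerE ?rpredM.
Qed.

Lemma mem_adjoin (A : subringClosed algC) x : x \in adjoin A x.
Proof. by apply/asboolP; exists 'X; rewrite ?hornerX ?polyOverX. Qed.

Lemma sub_adjoin (A : subringClosed algC) x : {subset A <= adjoin A x}.
Proof. by move=> y Ay; apply/asboolP; exists y%:P; rewrite ?hornerC ?polyOverC. Qed.

(** Applied with [c = 1/p]: a ring maximal among those that omit [1/p] is a valuation ring. Zorn's
    lemma runs over all sets satisfying [P], ordered by inclusion. *)
Lemma max_subring (c : algC) : c \notin Num.int ->
  exists2 A : subringClosed algC, c \notin A &
    forall B : {pred algC}, subring_closed B -> {subset A <= B} -> c \notin B ->
      {subset B <= A}.
Proof.
move=> cZ.
pose pr (S : algC -> Prop) : {pred algC} := fun x => `[< S x >].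
(* A chain may be empty, hence [P] must hold of the empty set. *)
pose P (S : algC -> Prop) :=
  (forall x, ~ S x) \/ (subring_closed (pr S) /\ c \notin pr S).
have prE S x : (x \in pr S) <-> S x by split=> [/asboolP|/asboolP].
have [F FP Ftot|A [PA Amax]] := @classical_sets.Zorn_bigcup algC P.
  have [[S FS [x0 Sx0]]|F0] := EM (exists2 S, F S & exists x, S x); last first.
    left=> x [S FS Sx]; apply: F0; exists S => //; by exists x.
  right; split; last first.
    apply/negP=> /prE[T FT Tc]; have [T0|[_ /negP]] := FP _ FT; first exact: (T0 c).
    by apply; apply/prE.
  have nonempty T x : F T -> T x -> subring_closed (pr T).
    by move=> FT Tx; have [T0|[]] := FP _ FT => //; case: (T0 x).
  have chain x y : classical_sets.bigcup F id x -> classical_sets.bigcup F id y ->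
      exists T, [/\ F T, T x & T y].
    move=> [T FT Tx] [U FU Uy]; have [TU|UT] := Ftot _ _ FT FU.
      by exists U; split=> //; apply: TU.
    by exists T; split=> //; apply: UT.
  split.
  - apply/prE; exists S => //; apply/prE.
    by have [] := nonempty _ _ FS Sx0.
  - move=> x y /prE Ux /prE Uy; have [T [FT Tx Ty]] := chain _ _ Ux Uy.
    apply/prE; exists T => //; apply/prE; have [_ + _] := nonempty _ _ FT Tx.
    by apply; apply/prE.
  - move=> x y /prE Ux /prE Uy; have [T [FT Tx Ty]] := chain _ _ Ux Uy.
    apply/prE; exists T => //; apply/prE; have [_ _] := nonempty _ _ FT Tx.
    by apply; apply/prE.
have Zring : subring_closed (Num.int : {pred algC}).
  by split=> [|x y|x y]; [exact: rpred1|exact: rpredB|exact: rpredM].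
(* An empty maximal element is impossible, because the integers form a larger member. *)
case: PA => [A0|[Aring cA]].
  case: (Amax (fun x => x \in Num.int)); last first.
    right; split; last by apply/negP=> /asboolP; apply/negP.
    have e x : (x \in pr (fun x => x \in Num.int)) = (x \in Num.int) by apply: asboolb.
    have [Z1 ZB ZM] := Zring.
    by split=> [|x y|x y]; rewrite !e; [apply: Z1|apply: ZB|apply: ZM].
  by split=> [x /A0//|e]; apply: (A0 1); apply: e; exact: rpred1.
pose A' : subringClosed algC :=
  HB.pack (pr A) (GRing.isSubringClosed.Build _ (pr A) Aring).
exists A' => // B Bring AB cB x Bx; apply: contrapT => xA.
apply: (Amax (fun x => x \in B)); last first.
  right; split; last by apply/negP=> /asboolP; apply/negP.
  have e y : (y \in pr (fun x => x \in B)) = (y \in B) by apply: asboolb.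
  have [Z1 ZB ZM] := Bring.
  by split=> [|y z|y z]; rewrite !e; [apply: Z1|apply: ZB|apply: ZM].
split=> [y Ay|e]; first by apply: AB; apply/prE.
by apply: xA; apply/prE; apply: e.
Qed.

(** [val_total] puts the inverse of every element outside [V] into [M]; together with [val_ideal]
    and [val_proper] this makes [M] the set of nonunits of [V]. By [val_prime] the residue field has
    characteristic [p]. *)
Record valuation_ring (p : nat) (V : subringClosed algC) (M : zmodClosed algC) : Prop :=
  ValuationRing {
    val_total : forall x, x \in V \/ x^-1 \in M;
    val_ideal : forall x y, x \in V -> y \in M -> x * y \in M;
    val_sub : {subset M <= V};
    val_proper : 1 \notin M;
    val_prime : p%:R \in M
  }.

Section Exists.
Variables (p : nat) (A : subringClosed algC).
Hypothesis p_gt1 : (1 < p)%N.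
Hypothesis pA : p%:R^-1 \notin A.
Hypothesis Amax : forall B : {pred algC}, subring_closed B -> {subset A <= B} ->
  p%:R^-1 \notin B -> {subset B <= A}.

Let p0 : p%:R != 0 :> algC. Proof. by rewrite pnatr_eq0 -lt0n ltnW. Qed.

(** By maximality of [A], the larger ring [A[x]] contains [1/p]. *)
Lemma max_adjoin x : x \notin A ->
  exists2 h : {poly algC}, h \is a polyOver A & 1 = p%:R * h.[x].
Proof.
move=> xA; case: (boolP (p%:R^-1 \in adjoin A x)) => [/asboolP[h Ah e]|npx].
  by exists h => //; rewrite -e mulfV.
case/negP: xA; apply: (Amax (adjoin_subring A x) _ npx); last exact: mem_adjoin.
exact: sub_adjoin.
Qed.

(** [p] lies in the Jacobson radical of [A]. If the inverse of [u = 1 - p a] were missing, [1/p]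
    would be a polynomial in it; clearing denominators makes a power of [u] divisible by [p],
    whereas every power of [u] is 1 modulo [p], so [1/p] would lie in [A]. *)
Lemma max_unit a : a \in A -> (1 - p%:R * a)^-1 \in A.
Proof.
move=> Aa; set u := 1 - _; apply: contraT => uA.
have Au : u \in A by rewrite rpredB ?rpred1 ?rpredM ?rpred_nat.
have u0 : u != 0 by apply: contra uA => /eqP->; rewrite invr0 rpred0.
have [h Ah e] := max_adjoin uA.
have [b Ab eb] : exists2 b, b \in A & u ^+ (size h) = p%:R * b.
  exists (\sum_(i < size h) h`_i * u ^+ (size h - i)).
    by apply: rpred_sum => i _; rewrite rpredM ?rpredX //; apply: (polyOverP Ah).
  have -> : u ^+ size h = p%:R * h.[u^-1] * u ^+ size h by rewrite -e mul1r.
  rewrite horner_coef -mulrA mulr_suml; congr (_ * _).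
  apply: eq_bigr => i _; rewrite exprVn -mulrA; congr (_ * _).
  move: (size h) (nat_of_ord i) (ltnW (ltn_ord i)) => t k le_k.
  by rewrite -[in LHS](subnK le_k) exprD mulrCA mulVf ?mulr1 ?expf_neq0.
have [c Ac ec] : exists2 c, c \in A & u ^+ (size h) = 1 - p%:R * c.
  elim: (size h) => [|k [c Ac ec]]; first by exists 0; rewrite ?rpred0 // mulr0 subr0.
  exists (c + a - p%:R * a * c).
    by rewrite rpredB ?rpredD ?rpredM ?rpred_nat.
  by rewrite exprS ec /u; ring.
case/negP: pA; rewrite (_ : _^-1 = b + c) ?rpredD //.
by apply: (mulfI p0); rewrite mulfV // mulrDr -eb ec subrK.
Qed.

(* The constant term is moved to the left, where [1 - p * h`_0] is a unit of [A]. *)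
Lemma max_normalise x (h : {poly algC}) : h \is a polyOver A -> 1 = p%:R * h.[x] ->
  exists k : {poly algC}, [/\ k \is a polyOver A, (size k <= (size h).-1)%N &
    1 = p%:R * (x * k.[x])].
Proof.
move=> Ah e; have h0 : h`_0 \in A by apply: (polyOverP Ah).
pose v := (1 - p%:R * h`_0)^-1.
exists (\poly_(i < (size h).-1) (v * h`_i.+1)).
split; [|exact: size_poly|].
  apply/polyOverP=> i; rewrite coef_poly; case: ifP => _; last exact: rpred0.
  by rewrite rpredM ?max_unit //; apply: (polyOverP Ah).
have nz : 1 - p%:R * h`_0 != 0.
  rewrite subr_eq0; apply: contra pA => /eqP e1.
  by rewrite (_ : _^-1 = h`_0) //; apply: (mulfI p0); rewrite -e1 mulfV.
have hn : (size h = (size h).-1.+1)%N.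
  rewrite prednK // size_poly_gt0; apply/eqP=> h00; move/eqP: e.
  by rewrite h00 horner0 mulr0 oner_eq0.
pose T := \sum_(i < (size h).-1) h`_i.+1 * x ^+ i.
have ehT : h.[x] = h`_0 + x * T.
  rewrite horner_coef hn big_ord_recl expr0 mulr1; congr (_ + _).
  by rewrite mulr_sumr; apply: eq_bigr => i _; rewrite lift0 exprS mulrCA.
have -> : (\poly_(i < (size h).-1) (v * h`_i.+1)).[x] = v * T.
  by rewrite horner_poly mulr_sumr; apply: eq_bigr => i _; rewrite mulrA.
have vE : (1 - p%:R * h`_0) * v = 1 by rewrite mulfV.
apply: (mulfI nz); rewrite mulr1.
have -> : (1 - p%:R * h`_0) * (p%:R * (x * (v * T))) =
    p%:R * (x * T) * ((1 - p%:R * h`_0) * v) by ring.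
by rewrite vE mulr1 -(addrK h`_0 (x * T)) (addrC (x * T)) -ehT mulrBr -e.
Qed.

(** The classical descent: of a relation for [x] and one for [x^-1], the shorter lowers the degree
    of the longer, until one of them is empty. The induction is on a bound [s] for the sum of the
    lengths. *)
Lemma max_relation s n k (x : algC) (h l : {poly algC}) :
  x != 0 -> (n + k <= s)%N -> (size h <= n)%N -> (size l <= k)%N ->
  h \is a polyOver A -> l \is a polyOver A ->
  1 = p%:R * (x * h.[x]) -> 1 = p%:R * (x^-1 * l.[x^-1]) -> False.
Proof.
elim: s n k x h l => [|s IHs] n k x h l x0 nks hn lk Ah Al eh el.
  have h0 : h = 0.
    by apply/eqP; rewrite -size_poly_leq0; move: hn nks; lia.
  by move/eqP: eh; rewrite h0 horner0 !mulr0 oner_eq0.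
wlog kn : n k x h l x0 nks hn lk Ah Al eh el / (k <= n)%N.
  move=> W; have [kn|nk] := leqP k n; first exact: (W n k x h l).
  apply: (W k n x^-1 l h) => //; rewrite ?invr_eq0 ?invrK // ?(ltnW nk) //.
  by rewrite addnC.
case: n => [|n] in nks hn kn *.
  have h0 : h = 0 by apply/eqP; rewrite -size_poly_leq0.
  by move/eqP: eh; rewrite h0 horner0 !mulr0 oner_eq0.
(* The relation for [x^-1], multiplied by [x^(n+1)], expresses this power through lower ones;
   [k <= n+1] keeps the exponents [n - i] from being truncated. *)
have xnE : x ^+ n.+1 = p%:R * \sum_(i < k) l`_i * x ^+ (n - i).
  have -> : x ^+ n.+1 = p%:R * (x^-1 * l.[x^-1]) * x ^+ n.+1 by rewrite -el mul1r.
  rewrite (horner_coef_wide _ lk) -!mulrA; congr (_ * _).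
  rewrite mulrCA exprS mulKf // mulr_suml; apply: eq_bigr => i _.
  rewrite -mulrA; congr (_ * _); rewrite exprVn.
  have le_in : (i <= n)%N by rewrite -ltnS (leq_trans (ltn_ord i)).
  by rewrite -{1}(subnK le_in) exprD mulrC mulfK // expf_neq0.
(* The top term of [x h(x)] is rewritten. [H] may have a constant term; removing it with
   [max_normalise] shortens the relation by one. *)
pose H := 'X * \poly_(i < n) h`_i + (p%:R * h`_n) *: \sum_(i < k) l`_i *: 'X^(n - i).
have AH : H \is a polyOver A.
  rewrite rpredD //.
    rewrite rpredM ?polyOverX //; apply/polyOverP=> i; rewrite coef_poly.
    by case: ifP => _; rewrite ?rpred0 //; apply: (polyOverP Ah).
  apply: polyOverZ; first by rewrite rpredM ?rpred_nat //; apply: (polyOverP Ah).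
  apply: rpred_sum => i _; apply: polyOverZ; first exact: (polyOverP Al).
  by rewrite rpredX ?polyOverX.
have sH : (size H <= n.+1)%N.
  rewrite (leq_trans (size_polyD _ _)) // geq_max; apply/andP; split.
    by rewrite mulrC (leq_trans (size_polyMleq _ _)) // size_polyX addn2 /= ltnS size_poly.
  rewrite (leq_trans (size_scale_leq _ _)) // (leq_trans (size_sum _ _ _)) //.
  apply/bigmax_leqP=> i _; rewrite (leq_trans (size_scale_leq _ _)) //.
  by rewrite size_polyXn ltnS leq_subr.
have eH : 1 = p%:R * H.[x].
  rewrite [LHS]eh; congr (_ * _); rewrite (horner_coef_wide _ hn) big_ord_recr /=.
  rewrite /H hornerD hornerM hornerX horner_poly mulrDr; congr (_ + _).
  rewrite hornerZ horner_sum mulrCA -exprS xnE mulrCA mulrA; congr (_ * _).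
  by apply: eq_bigr => i _; rewrite hornerZ hornerXn.
have [h' [Ah' sh' eh']] := max_normalise AH eH.
apply: (IHs n k x h' l) => //.
  by move: sh' sH; lia.
Qed.

Lemma max_total x : x \notin A -> x^-1 \in A.
Proof.
move=> xA; apply: contraT => xVA.
have x0 : x != 0 by apply: contra xA => /eqP->; apply: rpred0.
have [h Ah eh] := max_adjoin xA; have [h' [Ah' _ eh']] := max_normalise Ah eh.
have [k Ak ek] := max_adjoin xVA; have [k' [Ak' _ ek']] := max_normalise Ak ek.
by case: (max_relation x0 (leqnn _) (leqnn _) (leqnn _) Ah' Ak' eh' ek').
Qed.

Definition nonunits : {pred algC} := [pred x | (x \in A) && ((x == 0) || (x^-1 \notin A))].

Lemma nonunitsM x y : x \in A -> y \in nonunits -> x * y \in nonunits.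
Proof.
move=> Ax /andP[Ay yV]; rewrite inE /= rpredM //= mulf_eq0.
case/orP: yV => [->|yV]; rewrite ?orbT //.
have [//|x0] /= := eqVneq x 0; have [//|y0] /= := eqVneq y 0.
apply: contra yV => Axy; rewrite -(mulKf x0 y^-1) mulrC -mulrA -invfM (mulrC y).
by rewrite rpredM.
Qed.

Lemma nonunits_zmod : zmod_closed nonunits.
Proof.
split=> [|x y mx my]; first by rewrite inE /= rpred0 eqxx.
have [/eqP->|x0] := boolP (x == 0).
  by rewrite sub0r -mulN1r nonunitsM // rpredN1.
have [/eqP->|y0] := boolP (y == 0); first by rewrite subr0.
have xyE : x - y = (1 - y / x) * x by rewrite mulrBl mul1r divfK.
have yxE : x - y = (x / y - 1) * y by rewrite mulrBl mul1r divfK.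
have [Ayx|/max_total Axy] := boolP (y / x \in A).
  by rewrite xyE nonunitsM // rpredB ?rpred1.
by rewrite yxE nonunitsM // rpredB ?rpred1 //; rewrite invfM invrK mulrC in Axy.
Qed.
End Exists.

Lemma valuation_exists p : prime p ->
  exists (V : subringClosed algC) (M : zmodClosed algC), valuation_ring p V M.
Proof.
move=> p_pr; have p_gt1 := prime_gt1 p_pr.
have p0 : p%:R != 0 :> algC by rewrite pnatr_eq0 -lt0n ltnW.
have pZ : (p%:R : algC)^-1 \notin Num.int.
  apply/negP=> /intrP[z ez].
  have /intr_inj : (z * p%:Z)%:~R = 1%:~R :> algC by rewrite intrM -ez mulVf.
  move=> e1; have : (`|z| * `|p%:Z| == 1)%N by rewrite -abszM e1.
  by rewrite muln_eq1 /= (gtn_eqF p_gt1) andbF.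
have [A pA Amax] := max_subring pZ; exists A.
have zM := nonunits_zmod p_gt1 pA Amax.
pose M : zmodClosed algC :=
  HB.pack (nonunits A) (GRing.isZmodClosed.Build _ (nonunits A) zM).
exists M.
split.
- move=> x; have [|xA] := boolP (x \in A); first by left.
  have AxV := max_total p_gt1 pA Amax xA.
  by right; rewrite [_ \in _]inE /= AxV invrK xA orbT.
- by move=> x y; apply: nonunitsM.
- by move=> x /andP[].
- by rewrite [_ \in _]inE /= rpred1 oner_eq0 invr1 rpred1.
- by rewrite [_ \in _]inE /= rpred_nat pA orbT.
Qed.

Lemma Aint_integral (x : algC) : x \in Aint <-> integralOver (intr : int -> algC) x.
Proof.
split=> [Ax|[q q_mon qx]].
  have /floorpP[q eq] : minCpoly x \is a polyOver Num.int by [].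
  exists q; last by rewrite -eq root_minCpoly.
  have := minCpoly_monic x; rewrite eq !monicE lead_coef_map_inj //; last exact: intr_inj.
  by rewrite -(inj_eq (@intr_inj algC)).
by apply: (root_monic_Aint qx); [apply: monic_map|apply/polyOverP=> i; rewrite coef_map rpred_int].
Qed.

Lemma Aint_root_monic (q : {poly algC}) x :
  q \is monic -> root q x -> q \is a polyOver Aint -> x \in Aint.
Proof.
move=> q_mon qx /polyOverP Aq; apply/Aint_integral; apply: (integral_root_monic q_mon qx).
by move=> _ /(nthP 0)[i _ <-]; apply/Aint_integral.
Qed.

Section ValuationTheory.
Variables (p : nat) (V : subringClosed algC) (M : zmodClosed algC).
Hypothesis VM : valuation_ring p V M.

Lemma val_unit x : x \in V -> x \notin M -> x^-1 \in V.
Proof.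
by move=> Vx /negP Mx; have [//|] := val_total VM x^-1; rewrite invrK => /Mx.
Qed.

Lemma valM x y : x * y \in M -> x \in V -> y \in V -> (x \in M) || (y \in M).
Proof.
move=> Mxy Vx Vy; have [//|Mx] := boolP (x \in M).
have x0 : x != 0 by apply: contra Mx => /eqP->; apply: rpred0.
by rewrite -(mulKf x0 y) (val_ideal VM) // val_unit.
Qed.

Lemma val_idealr x y : x \in M -> y \in V -> x * y \in M.
Proof. by move=> Mx Vy; rewrite mulrC (val_ideal VM). Qed.

Lemma valX x k : x ^+ k \in M -> x \in M.
Proof.
move=> Mxk; apply: contraT => Mx.
have Vx : x^-1 \in V.
  by have [Vx|/(val_sub VM)] := val_total VM x; [apply: val_unit|].
have [x0|x0] := eqVneq x 0; first by rewrite x0 rpred0 in Mx.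
case/negP: (val_proper VM); rewrite -(mulVf (expf_neq0 k x0)) -exprVn.
by rewrite (val_ideal VM) ?rpredX.
Qed.

Lemma val_unit_out x : x != 0 -> x \in M -> x^-1 \in V -> False.
Proof.
by move=> x0 Mx Vx; case/negP: (val_proper VM); rewrite -(mulVf x0) (val_ideal VM).
Qed.

(** Valuation rings are integrally closed: a monic equation divided by the top power of an [x]
    outside [V] writes 1 as an element of [M]. *)
Lemma val_Aint : {subset Aint <= V}.
Proof.
move=> x /Aint_integral[q q_mon qx]; apply: contraT => Vx.
have Mx : x^-1 \in M by case: (val_total VM x) => [|//]; rewrite (negPf Vx).
have [x0|x0] := eqVneq x 0; first by rewrite x0 rpred0 in Vx.
case/negP: (val_proper VM); move: qx; rewrite /root horner_coef.
rewrite (size_map_inj_poly (@intr_inj algC)) //.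
have q1 : q`_(size q).-1 = 1 by move/monicP: q_mon; rewrite lead_coefE.
case sq: (size q) q1 => [|d] /= q1; first by move/eqP: q1; rewrite nth_default ?sq.
rewrite big_ord_recr /= coef_map /= q1.
rewrite mul1r addr_eq0 => /eqP e.
have -> : 1 = - (x ^- d * \sum_(i < d) (map_poly intr q)`_i * x ^+ i).
  by rewrite e mulrN opprK mulVf ?expf_neq0.
rewrite rpredN mulr_sumr; apply: rpred_sum => i _; rewrite coef_map mulrCA.
rewrite (val_ideal VM) ?rpred_int //.
have -> : x ^- d * x ^+ i = x^-1 ^+ (d - i).
  move: (nat_of_ord i) (ltnW (ltn_ord i)) => k kd.
  by rewrite -{1}(subnK kd) exprD invfM mulfVK ?expf_neq0 // exprVn.
rewrite -(subnK (_ : 0 < d - i)%N) ?subn_gt0 // addn1 exprS.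
by rewrite val_idealr // rpredX // (val_sub VM).
Qed.

Lemma polyOver_idealM (a b : {poly algC}) :
  a \is a polyOver V -> b \is a polyOver M -> a * b \is a polyOver M.
Proof.
move=> Va Mb; apply/polyOverP=> k; rewrite coefM; apply: rpred_sum => i _.
by rewrite (val_ideal VM) //; [apply: (polyOverP Va)|apply: (polyOverP Mb)].
Qed.

Lemma horner_ideal (a : {poly algC}) x :
  a \is a polyOver M -> x \in V -> a.[x] \in M.
Proof.
move=> Ma Vx; rewrite horner_coef; apply: rpred_sum => i _.
by rewrite val_idealr ?rpredX //; apply: (polyOverP Ma).
Qed.
End ValuationTheory.

(** * Rational powers of [N] *)

(** The positive real number [N^r]. Positivity makes it determined by any of its positive powers,
    which is how the exponent laws are proved. *)
Definition Npow (N : nat) (r : rat) : algC := (`|denq r|%N.-root N%:R) ^ numq r.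

Section Npow.
Variable N : nat.
Hypothesis N0 : (0 < N)%N.

Lemma Npow_gt0 r : 0 < Npow N r.
Proof. by rewrite exprz_gt0 // rootC_gt0 ?ltr0n // absz_gt0 denq_neq0. Qed.

Lemma Npow_neq0 r : Npow N r != 0. Proof. by rewrite gt_eqF ?Npow_gt0. Qed.

Lemma NpowX r k (h : int) : r * k%:R = h%:~R -> Npow N r ^+ k = N%:R ^ h.
Proof.
move=> e; have d0 : (0 < `|denq r|)%N by rewrite absz_gt0 denq_neq0.
have e' : numq r * k%:Z = `|denq r|%N%:Z * h.
  apply: (@intr_inj rat); rewrite !intrM -e numqE.
  have -> : (`|denq r|%N : int) = denq r by rewrite gez0_abs ?denq_ge0.
  by rewrite mulrAC mulrC.
by rewrite /Npow exprnP exprz_exp e' -exprz_exp -exprnP rootCK.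
Qed.

Lemma Npow_uniq r k x : (0 < k)%N -> 0 <= x -> x ^+ k = Npow N r ^+ k -> x = Npow N r.
Proof. by move=> k0 x0; apply: pexpIrn => //; rewrite nnegrE ltW ?Npow_gt0. Qed.

Lemma Npow_nat k : Npow N k%:R = N%:R ^+ k.
Proof.
have /= := @NpowX k%:R 1 k; rewrite mulr1 expr1 => -> //.
Qed.

Lemma Npow0 : Npow N 0 = 1. Proof. exact: (Npow_nat 0). Qed.

Lemma NpowD r s : Npow N (r + s) = Npow N r * Npow N s.
Proof.
have d0 : (0 < `|denq r|)%N by rewrite absz_gt0 denq_neq0.
have d0' : (0 < `|denq s|)%N by rewrite absz_gt0 denq_neq0.
have dE t : t * `|denq t|%:R = (numq t)%:~R.
  by rewrite -[`|_|%:R]/((`|denq t|%N : int)%:~R) gez0_abs ?denq_ge0 // -numqE.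
symmetry; apply: (@Npow_uniq _ (`|denq r| * `|denq s|)); rewrite ?muln_gt0 ?d0 //.
  by rewrite mulr_ge0 ?ltW ?Npow_gt0.
rewrite exprMn (@NpowX r _ (numq r * `|denq s|%N)); last first.
  by rewrite natrM mulrA dE intrM.
rewrite (@NpowX s _ (numq s * `|denq r|%N)); last first.
  by rewrite mulnC natrM mulrA dE intrM.
rewrite (@NpowX _ _ (numq r * `|denq s|%N + numq s * `|denq r|%N)) ?expfzDr //.
  by rewrite pnatr_eq0 -lt0n.
by rewrite intrD !intrM -!dE natrM -!pmulrn; ring.
Qed.

Lemma NpowN r : Npow N (- r) = (Npow N r)^-1.
Proof.
apply: (mulIf (Npow_neq0 r)); rewrite -NpowD addNr Npow0 mulVf //; exact: Npow_neq0.
Qed.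

Lemma NpowB r s : Npow N (r - s) = Npow N r / Npow N s.
Proof. by rewrite NpowD NpowN. Qed.

Lemma NpowMn r k : Npow N (r * k%:R) = Npow N r ^+ k.
Proof.
elim: k => [|k IH]; first by rewrite mulr0 Npow0.
by rewrite -addn1 natrD mulrDr mulr1 NpowD IH exprD expr1.
Qed.

Lemma Npow_int (h : int) : Npow N h%:~R = N%:R ^ h.
Proof. by have := @NpowX h%:~R 1 h; rewrite mulr1 expr1; apply. Qed.

Lemma Npow_expr (r : rat) : 0 <= r ->
  exists k h : nat, [/\ (0 < k)%N, r * k%:R = h%:R & Npow N r ^+ k = N%:R ^+ h].
Proof.
move=> r0; exists `|denq r|%N, `|numq r|%N.
have e : r * `|denq r|%:R = `|numq r|%:R.
  rewrite -[`|denq r|%:R]/((`|denq r|%N : int)%:~R) gez0_abs ?denq_ge0 // -numqE.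
  by rewrite -[`|numq r|%:R]/((`|numq r|%N : int)%:~R) gez0_abs // numq_ge0.
by split; rewrite ?absz_gt0 ?denq_neq0 // -[RHS]/(N%:R ^ `|numq r|%N); apply: NpowX.
Qed.

Lemma Npow_Aint r : 0 <= r -> Npow N r \in Aint.
Proof.
move=> /Npow_expr[k [h [k0 _ e]]].
apply: (@Aint_root_monic ('X^k - (N%:R ^+ h)%:P)).
- by apply: monicXnsubC.
- by rewrite rootE !hornerE e subrr.
- by apply: rpredB; [rewrite rpredX ?polyOverX|rewrite polyOverC rpredX ?rpred_nat].
Qed.

Section Val.
Variables (p : nat) (V : subringClosed algC) (M : zmodClosed algC).
Hypothesis VM : valuation_ring p V M.
Hypothesis pN : (p %| N)%N.

Lemma Npow_val r : 0 <= r -> Npow N r \in V.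
Proof. by move/Npow_Aint; apply: (val_Aint VM). Qed.

Lemma Npow_ideal r : 0 < r -> Npow N r \in M.
Proof.
move=> r0; have [k [h [k0 rkh e]]] := Npow_expr (ltW r0).
apply: (@valX _ _ _ VM _ k); rewrite e; case: h rkh {e} => [|h] rkh.
  by move/eqP: rkh; rewrite mulf_eq0 gt_eqF //= pnatr_eq0 gtn_eqF.
rewrite exprS (val_idealr VM) ?rpredX ?rpred_nat //.
by have /dvdnP[c ->] := pN; rewrite natrM (val_ideal VM) ?rpred_nat ?(val_prime VM).
Qed.
End Val.
End Npow.

(** * Expansions in powers of [g] *)

Lemma monic_unit (R : idomainType) (d : {poly R}) :
  d \is monic -> lead_coef d \is a GRing.unit.
Proof. by move/monicP->; rewrite unitr1. Qed.

Section Digits.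
Variables (f g : {poly int}).
Hypothesis g_monic : g \is monic.
Hypothesis g_size : (1 < size g)%N.

Lemma dig_divp_eq j : f %/ g ^+ j = (f %/ g ^+ j.+1) * g + dig f g j.
Proof.
rewrite /dig exprSr -Pdiv.IdomainUnit.divp_divl ?monic_unit ?monic_exp //.
exact: (Pdiv.IdomainUnit.divp_eq (monic_unit g_monic)).
Qed.

Lemma size_monic_exp (h : {poly int}) j : h \is monic -> size (h ^+ j) = ((size h).-1 * j).+1.
Proof.
move=> h_mon; rewrite -(prednK (_ : 0 < size (h ^+ j))%N) ?size_poly_gt0 ?monic_neq0 ?monic_exp //.
by rewrite size_exp.
Qed.

Lemma divp_exp_eq0 j : (size f <= j)%N -> f %/ g ^+ j = 0.
Proof.
move=> fj; apply: divp_small; apply: leq_ltn_trans fj _.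
by rewrite size_monic_exp // ltnS leq_pmull // -ltnS prednK // ltnW.
Qed.

Lemma dig_eq0 j : (size f <= j)%N -> dig f g j = 0.
Proof. by move=> fj; rewrite /dig divp_exp_eq0 // mod0p. Qed.

Lemma divp_exp_sum j : f %/ g ^+ j = \sum_(j <= s < size f) dig f g s * g ^+ (s - j).
Proof.
have [fj|] := leqP (size f) j; first by rewrite divp_exp_eq0 // big_geq.
move: {2}(size f - j)%N (leqnn (size f - j)) => k; elim: k j => [|k IH] j kj jf.
  by move: kj jf; lia.
rewrite dig_divp_eq big_ltn // subnn expr0 mulr1 addrC; congr (_ + _).
have [fj|jf'] := leqP (size f) j.+1.
  by rewrite divp_exp_eq0 // mul0r big_geq.
rewrite IH //; last by move: kj jf'; lia.
rewrite mulr_suml; apply: eq_big_nat => s /andP[js _].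
by rewrite -mulrA -exprSr -subSn.
Qed.

Lemma divp_exp_rem j : f = (f %/ g ^+ j) * g ^+ j + \sum_(s < j) dig f g s * g ^+ s.
Proof.
elim: j => [|j IH]; first by rewrite big_ord0 addr0 expr0 mulr1 divp1.
rewrite big_ord_recr /= [LHS]IH {1}dig_divp_eq exprSr; ring.
Qed.

Lemma dig_sum : f = \sum_(s < size f) dig f g s * g ^+ s.
Proof. by rewrite [LHS](divp_exp_rem (size f)) divp_exp_eq0 // mul0r add0r. Qed.
End Digits.

Lemma digD (f h g : {poly int}) s : g \is monic -> dig (f + h) g s = dig f g s + dig h g s.
Proof.
move=> g_mon; rewrite /dig (Pdiv.IdomainUnit.divpD (monic_unit (monic_exp s g_mon))).
by rewrite (Pdiv.IdomainUnit.modpD (monic_unit g_mon)).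
Qed.

Lemma digZ (c : int) (h g : {poly int}) s : g \is monic -> dig (c *: h) g s = c *: dig h g s.
Proof.
move=> g_mon; rewrite /dig (Pdiv.IdomainUnit.divpZl (monic_unit (monic_exp s g_mon))).
by rewrite (Pdiv.IdomainUnit.modpZl (monic_unit g_mon)).
Qed.

(** With [h] the product of the other factors, this gives the digits of [f] at [g] up to index [l],
    modulo [N]. *)
Lemma dig_expM (h g : {poly int}) l s : g \is monic -> (s <= l)%N ->
  dig (g ^+ l * h) g s = if (s < l)%N then 0 else h %% g.
Proof.
move=> g_mon sl; rewrite /dig; have gu := monic_unit (monic_exp s g_mon).
have -> : g ^+ l * h = g ^+ (l - s) * h * g ^+ s.
  by rewrite mulrAC -exprD subnK.
rewrite (Pdiv.IdomainUnit.mulpK gu); have [lt_sl|] := ltnP s l.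
  by rewrite -(subnK (_ : 0 < l - s)%N) ?subn_gt0 // addn1 exprS -mulrA mulrC modp_mull.
by rewrite -subn_eq0 => /eqP->; rewrite expr0 mul1r.
Qed.

(** * The exponent [v_N] and the unit part *)

Section NValuation.
Variable N : nat.
Hypothesis N1 : (1 < N)%N.

Lemma nvalrec_spec c fuel : (0 < c)%N -> (c <= fuel)%N ->
  exists d, c = (N ^ nvalrec N c fuel * d)%N /\ ~~ (N %| d)%N.
Proof.
elim: fuel c => [|fuel IH] c c0 cf /=; first by rewrite leqNgt c0 in cf.
rewrite c0 /=; case: ifP => [/dvdnP[k ck]|/negbT Nc]; last by exists c; rewrite mul1n.
have N0 : (0 < N)%N by apply: ltnW.
rewrite ck mulnK //; have [||d [ed Nd]] := IH k.
- by case: k ck c0 => // ->.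
- have := c0; rewrite ck muln_gt0 => /andP[k0 _].
  by rewrite -ltnS (leq_trans _ cf) // ck -[X in (X < _)%N]muln1 ltn_pmul2l.
by exists d; split=> //; rewrite {1}ed expnS [in LHS]mulnC mulnA.
Qed.

Lemma nval_exp_coprime k c : (0 < c)%N -> coprime c N -> nval N (N ^ k * c) = k.
Proof.
move=> c0 cN; have N0 : (0 < N)%N by apply: ltnW.
have [|d [ed Nd]] := @nvalrec_spec (N ^ k * c) (N ^ k * c) _ (leqnn _).
  by rewrite muln_gt0 expn_gt0 N0.
rewrite -/(nval N (N ^ k * c)) in ed; move: (nval _ _) ed => j ed.
have [kj|jk|//] := ltngtP k j.
  move: ed; rewrite -(subnK (ltnW kj)) addnC expnD -mulnA => /eqP.
  rewrite eqn_pmul2l ?expn_gt0 ?N0 // => /eqP ec.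
  have : (N %| c)%N.
    by rewrite ec -(subnK (_ : 0 < j - k)%N) ?subn_gt0 // addn1 expnS -mulnA dvdn_mulr.
  by move=> /coprime_dvdl/(_ cN); rewrite /coprime gcdnn gtn_eqF.
move: ed; rewrite -(subnK (ltnW jk)) addnC expnD -mulnA => /eqP.
rewrite eqn_pmul2l ?expn_gt0 ?N0 // => /eqP ed; case/negP: Nd.
by rewrite -ed -(subnK (_ : 0 < k - j)%N) ?subn_gt0 // addn1 expnS -mulnA dvdn_mulr.
Qed.

Lemma vNexpE k (b : {poly int}) : b != 0 -> coprime `|zcontents b|%N N ->
  vNexp N ((N%:Z ^+ k) *: b) = k.
Proof.
move=> b0 cb; rewrite /vNexp zcontentsZ abszM abszX /= nval_exp_coprime //.
by rewrite absz_gt0 zcontents_eq0.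
Qed.

Lemma unitpartE k (b : {poly int}) : b != 0 -> coprime `|zcontents b|%N N ->
  unitpart N ((N%:Z ^+ k) *: b) = b.
Proof.
move=> b0 cb; apply/polyP=> i; rewrite /unitpart vNexpE // coef_map_id0 ?div0z //.
by rewrite coefZ mulKz // expf_neq0 // eqz_nat -lt0n ltnW.
Qed.

Lemma vN_unitpart (a : {poly int}) : vN_defined N a -> a != 0 ->
  a = (N%:Z ^+ vNexp N a) *: unitpart N a /\ coprime `|zcontents (unitpart N a)|%N N.
Proof.
case=> [->|[k [b [-> cb]]] a0]; first by rewrite eqxx.
have b0 : b != 0 by apply: contra a0 => /eqP->; rewrite scaler0.
by rewrite vNexpE // unitpartE.
Qed.

Lemma vNexp_gt0 (a b : {poly int}) : vN_defined N a -> a != 0 -> a = N%:Z *: b ->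
  (0 < vNexp N a)%N.
Proof.
move=> da a0 ab; rewrite lt0n; apply/eqP=> u0.
have [ea] := vN_unitpart da a0; rewrite u0 expr0 scale1r in ea; rewrite -ea ab.
by rewrite zcontentsZ abszM coprimeMl /coprime gcdnn gtn_eqF.
Qed.

End NValuation.

(** * Reduction modulo [p] and evaluation modulo [M] *)

HB.instance Definition _ (p : nat) := GRing.RMorphism.copy (redp p)
  (map_poly (intr : int -> 'F_p)).

Section Reduction.
Variable p : nat.
Hypothesis p_pr : prime p.

Lemma redp_pZ (w : {poly int}) : redp p (p%:Z *: w) = 0.
Proof.
apply/polyP=> i; rewrite coef_map coefZ coef0 /= intrM.
by have := pchar_Fp_0 p_pr; rewrite -pmulrn => ->; rewrite mul0r.
Qed.

Lemma redp_dvd N (w : {poly int}) : (p %| N)%N -> redp p (N%:Z *: w) = 0.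
Proof. by case/dvdnP=> c ->; rewrite mulnC PoszM -scalerA redp_pZ. Qed.

Lemma redp_eq0 (a : {poly int}) : redp p a = 0 -> exists w, a = p%:Z *: w.
Proof.
move=> ra; exists (map_poly (fun c : int => (c %/ p%:Z)%Z) a).
apply/polyP=> i; rewrite coefZ coef_map_id0 ?div0z //.
have /polyP/(_ i) := ra; rewrite coef_map coef0 /= => /eqP.
by rewrite -(dvdz_pcharf (pchar_Fp p_pr)) mulrC => /divzK->.
Qed.

Lemma redp_surj (b : {poly 'F_p}) : exists a : {poly int}, redp p a = b.
Proof.
exists (map_poly (fun c : 'F_p => (c : nat)%:Z) b); apply/polyP=> i.
by rewrite coef_map coef_map_id0 //= -pmulrn natr_Zp.
Qed.

(** Bezout's identity over [F_p] lifted to [Z[x]], the form in which coprimality can be evaluated at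
    elements of [V]. *)
Lemma coprime_redp_lift (a b : {poly int}) : coprimep (redp p a) (redp p b) ->
  exists u v w, u * a + v * b = 1 + p%:Z *: w.
Proof.
move=> /Bezout_eq1_coprimepP[[u v] /= e].
have [u' eu] := redp_surj u; have [v' ev] := redp_surj v.
exists u', v'; have [|w ew] := @redp_eq0 (u' * a + v' * b - 1).
  by rewrite rmorphB rmorphD !rmorphM rmorph1 /= eu ev e subrr.
by exists w; rewrite -ew [RHS]addrC subrK.
Qed.

Lemma vNexp_eq0 N (a : {poly int}) : (1 < N)%N -> (p %| N)%N -> vN_defined N a ->
  redp p a != 0 -> vNexp N a = 0%N.
Proof.
move=> N1 pN da pa; apply/eqP; rewrite -leqn0 leqNgt; apply: contra pa => u0.
have [->|a0] := eqVneq a 0; first by rewrite rmorph0.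
have [-> _] := vN_unitpart N1 da a0; move: u0; case: (vNexp N a) => // u _.
by rewrite exprS -scalerA redp_dvd.
Qed.
End Reduction.

Definition ZtoC (a : {poly int}) : {poly algC} := map_poly intr a.
HB.instance Definition _ := GRing.RMorphism.copy ZtoC (map_poly (intr : int -> algC)).

Lemma ZtoC_int a : ZtoC a \is a polyOver Num.int.
Proof. by apply/polyOverP=> i; rewrite coef_map rpred_int. Qed.

Lemma ZtoC_over (S : subringClosed algC) a : ZtoC a \is a polyOver S.
Proof. by apply/polyOverP=> i; rewrite coef_map rpred_int. Qed.

Lemma ZtoCZ (c : int) a : ZtoC (c *: a) = c%:~R *: ZtoC a.
Proof. by apply/polyP=> i; rewrite coefZ !coef_map coefZ /= intrM. Qed.

Lemma size_ZtoC a : size (ZtoC a) = size a.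
Proof. by rewrite (size_map_inj_poly (@intr_inj algC)). Qed.

Lemma monic_ZtoC a : a \is monic -> ZtoC a \is monic.
Proof. exact: monic_map. Qed.

Section EvalIdeal.
Variables (p : nat) (V : subringClosed algC) (M : zmodClosed algC).
Hypothesis VM : valuation_ring p V M.
Hypothesis p_pr : prime p.
Variable x : algC.
Hypothesis Vx : x \in V.

Lemma eval_val a : (ZtoC a).[x] \in V.
Proof. by apply: rpred_horner => //; apply: ZtoC_over. Qed.

Lemma eval_pZ a : (ZtoC (p%:Z *: a)).[x] \in M.
Proof. by rewrite ZtoCZ hornerZ (val_idealr VM) ?eval_val // -pmulrn (val_prime VM). Qed.

Lemma eval_redp a b : redp p a = redp p b -> (ZtoC a).[x] - (ZtoC b).[x] \in M.
Proof.
move=> e; have [|w ew] := @redp_eq0 p p_pr (a - b); first by rewrite rmorphB /= e subrr.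
by rewrite -hornerN -hornerD -rmorphB ew eval_pZ.
Qed.

Lemma eval_coprime a b : coprimep (redp p a) (redp p b) -> (ZtoC b).[x] \in M ->
  (ZtoC a).[x] \notin M.
Proof.
move=> /(coprime_redp_lift p_pr)[u [v [w e]]] Mb; apply/negP=> Ma.
case/negP: (val_proper VM).
have -> : 1 = (ZtoC (u * a + v * b - p%:Z *: w)).[x].
  by rewrite e addrK rmorph1 hornerC.
rewrite rmorphB rmorphD !rmorphM hornerD hornerN hornerD !hornerM.
by rewrite rpredB ?eval_pZ // rpredD // (val_ideal VM) ?eval_val.
Qed.
End EvalIdeal.

(** * Integrality of the quotients *)

Lemma Aint_eigenvalue n (A : 'M[algC]_n) b :
  (forall i j, A i j \in Aint) -> eigenvalue A b -> b \in Aint.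
Proof.
move=> AA; rewrite eigenvalue_root_char => /Aint_root_monic; apply.
  exact: char_poly_monic.
rewrite rpred_sum // => s _; rewrite rpredMsign rpred_prod // => j _.
by rewrite !mxE rpredB ?rpredMn ?polyOverX ?polyOverC.
Qed.

(* Multiplication by [b] preserves the span of the powers [T^0, ..., T^(n-1)] over the
   algebraic integers: for [i < j] the product [b T^i] has low degree, and for [j <= i] it
   equals [- sum_(s < j) A s T^(s + i - j)]. *)
Lemma tail_Aint n (A : nat -> algC) T j : (0 < n)%N -> (0 < j)%N ->
  (forall s, A s \in Aint) -> \sum_(0 <= s < n) A s * T ^+ s = 0 -> (j <= n)%N ->
  \sum_(j <= s < n) A s * T ^+ (s - j) \in Aint.
Proof.
move=> n0 j0 AA e jn; set b := \sum_(j <= s < n) _.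
have bj : b * T ^+ j = - \sum_(0 <= s < j) A s * T ^+ s.
  rewrite (big_cat_nat (n := j)) //= in e.
  apply/eqP; rewrite -addr_eq0; apply/eqP; rewrite -[RHS]e addrC; congr (_ + _).
  rewrite mulr_suml; apply: eq_big_nat => s /andP[js _].
  by rewrite -mulrA -exprD subnK.
have /fin_all_exists[P HP] (i : 'I_n) : exists P : {poly algC},
    [/\ P \is a polyOver Aint, (size P <= n)%N & b * T ^+ i = P.[T]].
  have [ij|ji] := ltnP i j.
    exists (\sum_(j <= s < n) A s *: 'X^(s - j + i)); split.
    - by apply: rpred_sum => s _; apply: polyOverZ; rewrite ?rpredX ?polyOverX.
    - rewrite big_nat_cond; apply: (leq_trans (size_sum _ _ _)).
      apply/bigmax_leqP_seq=> s _ /andP[/andP[js sn] _].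
      rewrite (leq_trans (size_scale_leq _ _)) // size_polyXn.
      by move: js sn ij; lia.
    - rewrite horner_sum mulr_suml; apply: eq_bigr => s _.
      by rewrite hornerZ hornerXn exprD mulrA.
  exists (- \sum_(0 <= s < j) A s *: 'X^(s + (i - j))); split.
  - by rewrite rpredN; apply: rpred_sum => s _; apply: polyOverZ; rewrite ?rpredX ?polyOverX.
  - rewrite size_polyN big_nat_cond; apply: (leq_trans (size_sum _ _ _)).
    apply/bigmax_leqP_seq=> s _ /andP[/andP[_ sj] _].
    rewrite (leq_trans (size_scale_leq _ _)) // size_polyXn.
    by have := ltn_ord i; move: sj ji; lia.
  - rewrite -{1}(subnKC ji) exprD mulrA bj mulNr hornerN horner_sum mulr_suml.
    by congr (- _); apply: eq_bigr => s _; rewrite hornerZ hornerXn exprD mulrA.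
pose B := \matrix_(k < n, i < n) (P i)`_k.
apply: (@Aint_eigenvalue _ B).
  by move=> k i; rewrite mxE; have [/polyOverP + _ _] := HP i; apply.
(* The row of powers of [T] is an eigenvector of [B] for [b]; it is nonzero because its first entry
   is 1. *)
apply/eigenvalueP; exists (\row_(k < n) T ^+ k).
  apply/rowP=> i; rewrite !mxE; have [_ sP ->] := HP i.
  by rewrite (horner_coef_wide _ sP); apply: eq_bigr => k _; rewrite !mxE mulrC.
apply/eqP=> /rowP/(_ (Ordinal n0))/eqP; rewrite !mxE expr0.
by rewrite oner_eq0.
Qed.

Lemma eval_Aint a x : x \in Aint -> (ZtoC a).[x] \in Aint.
Proof. by move=> Ax; apply: rpred_horner => //; apply: ZtoC_over. Qed.

Section Quotients.
Variables (N : nat) (f g : {poly int}) (theta : algC).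
Hypotheses (N1 : (1 < N)%N) (f_monic : f \is monic) (g_monic : g \is monic).
Hypotheses (g_size : (1 < size g)%N) (f_theta : root (ZtoC f) theta).
Hypothesis fg_def : forall s, vN_defined N (dig f g s).

Lemma dig_scaled s (r : rat) : theta \in Aint ->
  (dig f g s != 0 -> r <= (vNexp N (dig f g s))%:R) ->
  (ZtoC (dig f g s)).[theta] / Npow N r \in Aint.
Proof.
move=> Ath le_r; have [->|a0] := eqVneq (dig f g s) 0.
  by rewrite rmorph0 horner0 mul0r rpred0.
have [ea _] := vN_unitpart N1 (fg_def s) a0.
rewrite [in ZtoC _]ea ZtoCZ hornerZ mulrAC rpredM ?eval_Aint //.
rewrite rmorphXn /= -pmulrn -Npow_nat ?(ltnW N1) // -NpowB ?(ltnW N1) //.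
by rewrite Npow_Aint ?(ltnW N1) // subr_ge0 le_r.
Qed.

Lemma root_monic_int : theta \in Aint.
Proof. by apply: (root_monic_Aint f_theta); rewrite ?monic_ZtoC ?ZtoC_int. Qed.

(** The hypothesis is a line of slope [- mu], of height [y] at [j], below all points. Dividing the
    digits by [N] to the height of the line gives algebraic integers [A s], and
    [T = g(theta) / N^mu] satisfies [sum A_s T^s = 0]. Since [T] need not be integral, [tail_Aint]
    is applied to the tail of this relation, which is the quotient in question. *)
Lemma quot_Aint j (y mu : rat) : (0 < j)%N ->
  (forall s, dig f g s != 0 -> y - mu * (s%:R - j%:R) <= (vNexp N (dig f g s))%:R) ->
  (ZtoC (f %/ g ^+ j)).[theta] / Npow N y \in Aint.
Proof.
move=> j0 sup; have Ath := root_monic_int; have N0 := ltnW N1.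
have [fj|jf] := leqP (size f) j.
  by rewrite divp_exp_eq0 // rmorph0 horner0 mul0r rpred0.
pose A s := (ZtoC (dig f g s)).[theta] / Npow N (y - mu * (s%:R - j%:R)).
pose T := (ZtoC g).[theta] / Npow N mu.
have AA s : A s \in Aint by apply: dig_scaled => //; apply: sup.
have scaled_digE s i : (i <= s)%N -> A s * T ^+ (s - i) =
    (ZtoC (dig f g s)).[theta] * (ZtoC g).[theta] ^+ (s - i) / Npow N (y + mu * (j%:R - i%:R)).
  move=> le_is; rewrite /A /T expr_div_n -NpowMn // natrB // mulf_div -NpowD //.
  congr (_ / Npow N _); lra.
have e0 : \sum_(0 <= s < size f) A s * T ^+ s = 0.
  rewrite (eq_bigr (fun s => (ZtoC (dig f g s)).[theta] * (ZtoC g).[theta] ^+ s /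
      Npow N (y + mu * j%:R))).
    rewrite -mulr_suml -[RHS](mul0r (Npow N (y + mu * j%:R))^-1); congr (_ / _).
    rewrite -[RHS](rootP f_theta) [in RHS](dig_sum f g_monic g_size) rmorph_sum /=.
    rewrite horner_sum big_mkord; apply: eq_bigr => s _.
    by rewrite rmorphM rmorphXn /= hornerM horner_exp.
  by move=> s _; have := scaled_digE s 0%N (leq0n s); rewrite subn0 subr0.
rewrite divp_exp_sum // rmorph_sum horner_sum mulr_suml.
rewrite (eq_big_nat _ _ (F2 := fun s => A s * T ^+ (s - j))); last first.
  move=> s /andP[js _]; rewrite scaled_digE // subrr mulr0 addr0.
  by rewrite rmorphM rmorphXn /= hornerM horner_exp.
by apply: tail_Aint => //; [apply: ltn_trans jf|apply: ltnW].
Qed.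
End Quotients.

(** * Lower convex hulls *)

Lemma separate_rat (A B : seq rat) : (forall a b, a \in A -> b \in B -> b <= a) ->
  exists mu, (forall a, a \in A -> mu <= a) /\ (forall b, b \in B -> b <= mu).
Proof.
elim: A => [_|a A IH AB].
  elim: B => [|b B [mu [_ IH]]]; first by exists 0.
  exists (Num.max b mu); split=> // c; rewrite inE le_max => /predU1P[->|/IH->].
    by rewrite lexx.
  by rewrite orbT.
have [|mu [IHA IHB]] := IH; first by move=> c b Ac; apply: AB; rewrite inE Ac orbT.
exists (Num.min a mu); split=> [c|b Bb].
  by rewrite inE ge_min => /predU1P[->|/IHA->]; rewrite ?lexx ?orbT.
by rewrite le_min IHB // AB // inE eqxx.
Qed.

Lemma foldr_min_mem (x : rat) c : foldr Order.min x c \in x :: c.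
Proof.
elim: c => [|y c IH] /=; first exact: mem_head.
rewrite minEle; case: ifP => _; first by rewrite !inE eqxx orbT.
by move: IH; rewrite !inE => /orP[->|->]; rewrite ?orbT.
Qed.

Lemma foldr_min_le (x : rat) c y : y \in c -> foldr Order.min x c <= y.
Proof.
elim: c => [//|z c IH] /=; rewrite inE ge_min => /predU1P[->|/IH->].
  by rewrite lexx.
by rewrite orbT.
Qed.

Section Hull.
Variables (N : nat) (f g : {poly int}).
Hypotheses (g_monic : g \is monic) (g_size : (1 < size g)%N).

Local Notation S s := (dig f g s != 0).
Local Notation U s := ((vNexp N (dig f g s))%:R : rat).
Local Notation pt s := (s, vNexp N (dig f g s)).

Lemma mem_pts P : reflect (P = pt P.1 /\ S P.1) (P \in pts N f g).
Proof.
apply: (iffP mapP) => [[s]|[eP SP]].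
  by rewrite mem_filter => /andP[Ss _] ->.
exists P.1 => //; rewrite mem_filter SP mem_iota /= add0n ltnNge.
by apply: contra SP => fP; rewrite dig_eq0.
Qed.

Definition chord s t j : rat := interp (pt s) (pt t) j.

Lemma candsP j x : reflect (exists s t, [/\ S s, S t, (s <= j <= t)%N & x = chord s t j])
  (x \in cands N f g j).
Proof.
apply: (iffP allpairsPdep) => [[P [Q [/mem_pts[eP SP] + ->]]]|[s [t [Ss St sjt ->]]]].
  rewrite mem_filter => /andP[PQ /mem_pts[eQ SQ]].
  by exists P.1, Q.1; split=> //; rewrite eP eQ.
exists (pt s), (pt t); split=> //; first by apply/mem_pts.
by rewrite mem_filter /= sjt; apply/mem_pts.
Qed.

Lemma hdefP j : reflect (exists s t, [/\ S s, S t & (s <= j <= t)%N]) (hdef N f g j).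
Proof.
rewrite /hdef; apply: (iffP idP) => [|[s [t [Ss St sjt]]]].
  case e : (cands N f g j) => [//|x c] _.
  have /candsP[s [t [Ss St sjt _]]] : x \in cands N f g j by rewrite e mem_head.
  by exists s, t.
have : chord s t j \in cands N f g j by apply/candsP; exists s, t.
by apply: contraTneq => ->; rewrite in_nil.
Qed.

Lemma hull_le s t j : S s -> S t -> (s <= j <= t)%N -> hull N f g j <= chord s t j.
Proof. by move=> Ss St sjt; apply: foldr_min_le; apply/candsP; exists s, t. Qed.

Lemma hull_attained j : hdef N f g j ->
  exists s t, [/\ S s, S t, (s <= j <= t)%N & hull N f g j = chord s t j].
Proof.
rewrite /hdef => h; apply/candsP; rewrite /hull.
case: (cands N f g j) h => [//|x c] _; have := foldr_min_mem x (x :: c).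
by rewrite inE => /predU1P[->|//]; apply: mem_head.
Qed.

Lemma chordE s t j : (s < t)%N ->
  chord s t j = U s + (U t - U s) * ((j%:R - s%:R) / (t%:R - s%:R)).
Proof. by move=> st; rewrite /chord /interp /= ltn_eqF // mulrA. Qed.

Lemma chord_refl s j : chord s s j = U s.
Proof. by rewrite /chord /interp eqxx. Qed.

Lemma chord_left s t : chord s t s = U s.
Proof. by rewrite /chord /interp; case: eqP => // _; rewrite subrr mulr0 mul0r addr0. Qed.

Lemma chord_right s t : (s <= t)%N -> chord s t t = U t.
Proof.
rewrite leq_eqVlt => /predU1P[->|st]; first by rewrite chord_left.
rewrite chordE // divff ?mulr1 ?subrKC // subr_eq0 eqr_nat gtn_eqF //.
Qed.

Lemma weight_bounds s t j : (s <= j <= t)%N -> (s < t)%N ->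
  exists l : rat, [/\ 0 <= l, l <= 1, chord s t j = (1 - l) * U s + l * U t,
    j%:R = (1 - l) * s%:R + l * t%:R & ((s < j < t)%N -> 0 < l < 1)].
Proof.
move=> /andP[sj jt] st; exists ((j%:R - s%:R) / (t%:R - s%:R)).
have ts0 : (0 : rat) < t%:R - s%:R by rewrite subr_gt0 ltr_nat.
split.
- by rewrite divr_ge0 ?subr_ge0 ?ler_nat // ltnW.
- by rewrite ler_pdivrMr // mul1r lerD2r ler_nat.
- by rewrite chordE //; ring.
- have := divfK (lt0r_neq0 ts0) (j%:R - s%:R); set l := _ / _ => e; lra.
- move=> /andP[sj' jt']; rewrite divr_gt0 ?subr_gt0 ?ltr_nat //=.
  by rewrite ltr_pdivrMr // mul1r ltrD2r ltr_nat.
Qed.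

Lemma chord_ge s t j (y mu : rat) : (s <= j <= t)%N ->
  y - mu * s%:R <= U s -> y - mu * t%:R <= U t -> y - mu * j%:R <= chord s t j.
Proof.
move=> sjt; have := sjt; have [|] := ltnP s t; last first.
  move=> ts /andP[sj jt] Us Ut.
  have <- : s = j by apply/eqP; rewrite eqn_leq sj (leq_trans jt ts).
  by rewrite chord_left.
move=> /(weight_bounds sjt)[l [l0 l1 -> -> _]] _ Us Ut; nra.
Qed.

(** A supporting line of slope [- mu] touching the hull at [j]. Convexity of the hull, which is
    defined by chords, is obtained from such lines. *)
Definition subgradient j mu := forall s, S s ->
  hull N f g j - mu * (s%:R - j%:R) <= U s.

(** Each point left of [j] bounds [mu] from above and each point right of [j] bounds it from below.
    The bounds are compatible because the hull at [j] lies below every chord over [j]. *)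
Lemma subgradient_exists j : exists mu, subgradient j mu.
Proof.
set y := hull N f g j.
pose A := [seq (U s - y) / (j%:R - s%:R) | s <- [seq s <- iota 0 (size f) | S s] & (s < j)%N].
pose B := [seq (y - U t) / (t%:R - j%:R) | t <- [seq s <- iota 0 (size f) | S s] & (j < t)%N].
have memS s : S s -> s \in [seq s <- iota 0 (size f) | S s].
  move=> Ss; rewrite mem_filter Ss mem_iota /= add0n ltnNge.
  by apply: contra Ss => fs; rewrite dig_eq0.
have [a b /mapP[s]|mu [muA muB]] := @separate_rat A B.
  rewrite !mem_filter => /and3P[sj Ss _] -> /mapP[t].
  rewrite !mem_filter => /and3P[jt St _] ->.
  have sjt : (s <= j <= t)%N by rewrite (ltnW sj) (ltnW jt).
  have := hull_le Ss St sjt; have st := ltn_trans sj jt.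
  rewrite -/y chordE //.
  have h1 : (0 : rat) < j%:R - s%:R by rewrite subr_gt0 ltr_nat.
  have h2 : (0 : rat) < t%:R - j%:R by rewrite subr_gt0 ltr_nat.
  rewrite ler_pdivrMr // mulrAC ler_pdivlMr //.
  have h3 : (0 : rat) < t%:R - s%:R by rewrite subr_gt0 ltr_nat.
  have := divfK (lt0r_neq0 h3) (j%:R - s%:R); set l := _ / _ => e.
  rewrite -(ler_pM2r h3) mulrDl -mulrA e; nra.
exists mu => s Ss; have [js|sj|->] := ltngtP j s.
- have := muB _ (map_f _ (_ : s \in _)); rewrite mem_filter js memS // => /(_ isT).
  by rewrite ler_pdivrMr ?subr_gt0 ?ltr_nat // -/y; lra.
- have := muA _ (map_f _ (_ : s \in _)); rewrite mem_filter sj memS // => /(_ isT).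
  by rewrite ler_pdivlMr ?subr_gt0 ?ltr_nat // -/y; lra.
- rewrite subrr mulr0 subr0 -(chord_refl s s); apply: hull_le => //.
  by rewrite leqnn.
Qed.

Lemma subgradient_hull j mu k : subgradient j mu -> hdef N f g k ->
  hull N f g j - mu * (k%:R - j%:R) <= hull N f g k.
Proof.
move=> sub /hull_attained[s [t [Ss St skt ->]]].
have := @chord_ge s t k (hull N f g j + mu * j%:R) mu skt.
by have := sub s Ss; have := sub t St; lra.
Qed.

Lemma subgradient_slope j mu : subgradient j mu -> hdef N f g j.+1 ->
  - mu <= slope N f g j.
Proof.
move=> sub /(subgradient_hull sub); rewrite /slope -[j.+1%:R]natr1; lra.
Qed.

Lemma subgradient_slope_pred j mu : subgradient j.+1 mu -> hdef N f g j ->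
  slope N f g j <= - mu.
Proof.
move=> sub /(subgradient_hull sub); rewrite /slope -[j.+1%:R]natr1; lra.
Qed.

(** Minus the parameter of a supporting line at [j.+1] separates the two slopes. *)
Lemma slope_mono j : hdef N f g j -> hdef N f g j.+2 -> slope N f g j <= slope N f g j.+1.
Proof.
move=> h0 h2; have [mu sub] := subgradient_exists j.+1.
exact: le_trans (subgradient_slope_pred sub h0) (subgradient_slope sub h2).
Qed.

(** Otherwise the hull at [j.+1] is an inner point of a chord. A supporting line there touches both
    ends of the chord, so over [j] and [j.+2] the hull is squeezed between chord and line, and the
    slope does not change. *)
Lemma hull_vertex j : hdef N f g j -> hdef N f g j.+1 -> hdef N f g j.+2 ->
  slope N f g j != slope N f g j.+1 -> S j.+1 /\ hull N f g j.+1 = U j.+1.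
Proof.
move=> h0 h1 h2 ne; have [s [t [Ss St sjt e]]] := hull_attained h1.
have /andP[sj jt] := sjt; move: sj; rewrite leq_eqVlt => /predU1P[es|sj].
  by rewrite -es in e *; rewrite e chord_left.
move: jt; rewrite leq_eqVlt => /predU1P[et|jt].
  by rewrite -et in St e; rewrite e chord_right // ltnW.
have [mu sub] := subgradient_exists j.+1; have st := ltn_trans sj jt.
case/eqP: ne; have [l [_ _ el jE /(_ _)]] := weight_bounds sjt st.
rewrite sj jt => /(_ isT)/andP[l0 l1].
have Us := sub s Ss; have Ut := sub t St; rewrite e in Us Ut.
have ej : j.+1%:R = j%:R + 1 :> rat by rewrite -natr1.
(* Heights of the two ends above the supporting line: both are nonnegative, and their mean with
   positive weights is zero. *)
pose ds := U s - (chord s t j.+1 - mu * (s%:R - j.+1%:R)).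
pose dt := U t - (chord s t j.+1 - mu * (t%:R - j.+1%:R)).
have /eqP : (1 - l) * ds + l * dt = 0.
  have -> : (1 - l) * ds + l * dt = ((1 - l) * U s + l * U t) - chord s t j.+1 +
      mu * (((1 - l) * s%:R + l * t%:R) - j.+1%:R) by rewrite /ds /dt; ring.
  by rewrite -el -jE !subrr mulr0 addr0.
have l1' : 0 < 1 - l by rewrite subr_gt0.
move=> /eqP sum0; have ds0 : 0 <= ds by rewrite subr_ge0.
have dt0 : 0 <= dt by rewrite subr_ge0.
have p1 : 0 <= (1 - l) * ds by rewrite mulr_ge0 // ltW.
have p2 : 0 <= l * dt by rewrite mulr_ge0 // ltW.
have /eqP : (1 - l) * ds = 0 by lra.
rewrite mulf_eq0 (gt_eqF l1') subr_eq0 => /eqP eUs.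
have /eqP : l * dt = 0 by lra.
rewrite mulf_eq0 (gt_eqF l0) subr_eq0 => /eqP eUt.
have cE k : (s <= k <= t)%N -> chord s t k = hull N f g j.+1 - mu * (k%:R - j.+1%:R).
  by move=> skt; have [l' [_ _ -> -> _]] := weight_bounds skt st; rewrite eUs eUt e; ring.
have sjt0 : (s <= j <= t)%N by move: sj jt; clear; lia.
have sjt2 : (s <= j.+2 <= t)%N by move: sj jt; clear; lia.
have c0 := hull_le Ss St sjt0; have c2 := hull_le Ss St sjt2.
have s0 := subgradient_hull sub h0; have s2 := subgradient_hull sub h2.
have ej2 : j.+2%:R = j%:R + 2%:R :> rat by rewrite -natrD addn2.
rewrite (cE _ sjt0) in c0; rewrite (cE _ sjt2) in c2.
by rewrite /slope; move: c0 c2 s0 s2; rewrite ej2 ej; clear; lra.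
Qed.
End Hull.

(** * The part of negative slope: vertices, sides and their lines *)

Section Polygon.
Variables (N : nat) (f g : {poly int}) (l : nat).
Hypotheses (g_monic : g \is monic) (g_size : (1 < size g)%N) (l_gt0 : (0 < l)%N).

Local Notation S s := (dig f g s != 0).
Local Notation U s := ((vNexp N (dig f g s))%:R : rat).
Local Notation y := (hull N f g).
Local Notation hd := (hdef N f g).
Local Notation sl := (slope N f g).

Hypotheses (S0 : S 0%N) (Sl : S l) (Ul : vNexp N (dig f g l) = 0%N).
Hypothesis Upos : forall s, (s < l)%N -> S s -> (0 < vNexp N (dig f g s))%N.

Lemma hdef_le j : (j <= l)%N -> hd j.
Proof. by move=> jl; apply/hdefP => //; exists 0%N, l. Qed.

Lemma hull_le_U s : S s -> y s <= U s.
Proof. by move=> Ss; rewrite -(chord_refl N f g s s) hull_le // leqnn. Qed.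

Lemma hull_ge0 j : hd j -> 0 <= y j.
Proof.
move=> /(hull_attained g_monic g_size)[s [t [Ss St sjt ->]]].
by have := @chord_ge N f g s t j 0 0 sjt; rewrite !mul0r subrr; apply; rewrite ler0n.
Qed.

Lemma hull_end : y l = 0.
Proof.
apply/le_anti; rewrite hull_ge0 ?hdef_le // andbT.
by have := hull_le_U Sl; rewrite Ul.
Qed.

Lemma chord_gt0 s t j : (s <= j < t)%N -> 0 < U s -> 0 < chord N f g s t j.
Proof.
move=> /andP[sj jt] Us; have st := leq_ltn_trans sj jt.
have w0 : 0 <= (j%:R - s%:R) / (t%:R - s%:R) :> rat.
  by rewrite divr_ge0 ?subr_ge0 ?ler_nat // ltnW.
have w1 : (j%:R - s%:R) / (t%:R - s%:R) < 1 :> rat.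
  by rewrite ltr_pdivrMr ?subr_gt0 ?ltr_nat // mul1r ltrD2r ltr_nat.
rewrite chordE //; move: (_ / _) w0 w1 => w w0 w1.
have Ut : (0 : rat) <= U t by rewrite ler0n.
have -> : U s + (U t - U s) * w = U s * (1 - w) + U t * w by ring.
by rewrite ltr_wpDr ?mulr_ge0 // mulr_gt0 // subr_gt0.
Qed.

Lemma hull_gt0 j : (j < l)%N -> 0 < y j.
Proof.
move=> jl; have [s [t [Ss St sjt ->]]] := hull_attained g_monic g_size (hdef_le (ltnW jl)).
have := sjt => /andP[sj]; rewrite leq_eqVlt => /predU1P[jt|jt].
  by rewrite -jt chord_right // ltr0n Upos // jt.
by rewrite chord_gt0 ?sj // ltr0n Upos // (leq_ltn_trans sj).
Qed.

Lemma slope_le i j : (i <= j)%N -> (j < l)%N -> sl i <= sl j.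
Proof.
elim: j => [|j IH]; first by rewrite leqn0 => /eqP->.
rewrite leq_eqVlt => /predU1P[-> //|ij jl].
apply: le_trans (IH ij (ltnW jl)) _; apply: slope_mono => //; apply: hdef_le => //.
by rewrite ltnW // ltnW.
Qed.

Lemma slope_lt0 j : (j < l)%N -> sl j < 0.
Proof.
move=> jl; have h : (j <= l.-1)%N by rewrite -ltnS prednK.
apply: le_lt_trans (slope_le h _) _; first by rewrite prednK.
by rewrite /slope prednK // hull_end sub0r oppr_lt0 hull_gt0 // prednK.
Qed.

Lemma hull_decr i j : (i < j)%N -> (j <= l)%N -> y j < y i.
Proof.
elim: j => [//|j IH]; rewrite ltnS leq_eqVlt => /predU1P[->|ij] jl.
  by have := slope_lt0 jl; rewrite /slope subr_lt0.
by apply: lt_trans (IH ij (ltnW jl)); have := slope_lt0 jl; rewrite /slope subr_lt0.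
Qed.

(** [is_side] looks one step past the end of a side; this settles that step when the side ends at
    [l]. *)
Lemma slope_after : ~~ hd l.+1 \/ 0 <= sl l.
Proof.
case: (boolP (hd l.+1)) => [h|]; [right|by left].
by rewrite /slope hull_end subr0 hull_ge0.
Qed.

(** The side ending or starting at [j] is kept because regularity states its coprimality condition
    at the ends of sides. *)
Definition vertex j :=
  [/\ S j, y j = U j & exists s len sigma, is_side N f g s len sigma /\ (j = s \/ j = s + len)%N].

(** [j] names the unit segment from [j] to [j.+1]. Convexity supplies the strict comparison with the
    segments outside the side, which makes its line touch the hull nowhere else up to [l]. *)
Record on_side j s len : Prop := OnSide {
  side_is : is_side N f g s len (sl j);
  side_mem : (s <= j < s + len)%N;
  side_le : (s + len <= l)%N;
  side_slope : forall k, (s <= k < s + len)%N -> sl k = sl j;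
  side_before : forall k, (k < s)%N -> sl k < sl j;
  side_after : forall k, (s + len <= k < l)%N -> sl j < sl k;
  side_left : vertex s;
  side_right : vertex (s + len)
}.

Lemma vertex_slope j : (0 < j)%N -> (j < l)%N -> sl j.-1 != sl j -> S j /\ y j = U j.
Proof.
case: j => // j _ jl; apply: hull_vertex => //; apply: hdef_le => //; do ?exact: ltnW.
exact/ltnW/ltnW.
Qed.

Lemma hull_start : y 0%N = U 0%N.
Proof.
have [s [t [Ss St sjt ->]]] := hull_attained g_monic g_size (hdef_le (leq0n l)).
by move: sjt; rewrite leqn0 => /andP[/eqP-> _]; rewrite chord_left.
Qed.

(** Slopes increase, so the segments with the slope of [j] form an interval; its least and greatest
    members delimit the side. *)
Lemma side_exists j : (j < l)%N -> exists s len, on_side j s len.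
Proof.
move=> jl.
have exs : exists s, (s <= j)%N && (sl s == sl j) by exists j; rewrite leqnn eqxx.
case: (ex_minnP exs) => s /andP[sj /eqP es] smin.
have ext : exists t, (j <= t < l)%N && (sl t == sl j) by exists j; rewrite leqnn jl eqxx.
have tb t : (j <= t < l)%N && (sl t == sl j) -> (t <= l)%N.
  by move=> /andP[/andP[_ /ltnW]].
case: (ex_maxnP ext tb) => t /andP[/andP[jt tl] /eqP et] tmax.
have eqs : (s + (t.+1 - s) = t.+1)%N by move: sj jt; clear; lia.
have mid k : (s <= k < t.+1)%N -> sl k = sl j.
  move=> /andP[sk kt]; apply/le_anti; rewrite -{1}et -es !slope_le //.
  by apply: leq_ltn_trans tl.
have bef k : (k < s)%N -> sl k < sl j.
  move=> ks; rewrite lt_neqAle slope_le ?andbT //; last by rewrite (leq_trans (ltnW ks)).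
  by apply/eqP=> e; move: (smin k); rewrite e eqxx andbT (leq_trans (ltnW ks)) // leqNgt ks => /(_ isT).
have aft k : (t.+1 <= k < l)%N -> sl j < sl k.
  move=> /andP[tk kl]; have jk : (j <= k)%N by rewrite (leq_trans jt) // ltnW.
  rewrite lt_neqAle slope_le // andbT eq_sym.
  by apply/eqP=> e; move: (tmax k); rewrite e eqxx jk kl /= leqNgt tk => /(_ isT).
have side : is_side N f g s (t.+1 - s) (sl j).
  split.
  - by rewrite subn_gt0 ltnS (leq_trans sj).
  - exact: slope_lt0.
  - move=> k; rewrite eqs => kr; rewrite mid // eqxx andbT.
    by rewrite !hdef_le //; move: kr tl; clear; lia.
  - have [->|s0] := posnP s; first by left.
    by right; right; rewrite lt_eqF // bef // prednK.
  - rewrite eqs; move: (tl); rewrite leq_eqVlt => /predU1P[tl'|tl'].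
      have [h|h] := slope_after; first by left; rewrite tl'.
      by right; rewrite tl' gt_eqF // (lt_le_trans (slope_lt0 jl)).
    by right; rewrite gt_eqF // aft // leqnn tl'.
have sl' : (s < l)%N by apply: leq_ltn_trans jl.
exists s, (t.+1 - s)%N; split; rewrite ?eqs //.
- by rewrite sj ltnS.
- have [s0|s0] := posnP s.
    by split; rewrite ?s0 ?hull_start //; exists s, (t.+1 - s)%N, (sl j); rewrite s0 in side *; split=> //; left.
  have ne : sl s.-1 != sl s by rewrite es lt_eqF // bef // prednK.
  have [] := vertex_slope s0 sl' ne.
  by split=> //; exists s, (t.+1 - s)%N, (sl j); split=> //; left.
- have ex : exists s0 len sigma, is_side N f g s0 len sigma /\ (t.+1 = s0 \/ t.+1 = s0 + len)%N.
    by exists s, (t.+1 - s)%N, (sl j); split=> //; right.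
  move: tl; rewrite leq_eqVlt => /predU1P[tl|tl].
    by split=> //; rewrite tl // hull_end Ul.
  have ne : sl t.+1.-1 != sl t.+1 by rewrite et lt_eqF // aft // leqnn.
  by have [] := vertex_slope (ltn0Sn t) tl ne; split.
Qed.

Lemma vertex_break j : (0 < j)%N -> (j < l)%N -> sl j.-1 != sl j -> vertex j.
Proof.
move=> j0 jl ne; have [s [len os]] := side_exists jl.
have /andP[sj _] := side_mem os; move: (sj); rewrite leq_eqVlt => /predU1P[<-|sj'].
  exact: side_left os.
case/eqP: ne; apply: (side_slope os); have /andP[_ h] := side_mem os.
by move: j0 sj' h; clear; lia.
Qed.

Lemma vertex_start : vertex 0.
Proof.
have [s [len os]] := side_exists l_gt0.
have /andP[sj _] := side_mem os; move: sj; rewrite leqn0 => /eqP s0.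
by have := side_left os; rewrite s0.
Qed.

Lemma vertex_end : vertex l.
Proof.
have h : (l.-1 < l)%N by rewrite prednK.
have [s [len os]] := side_exists h; have := side_right os.
have -> : (s + len = l)%N; last by [].
by have := side_mem os; have := side_le os; move: h; clear; lia.
Qed.

Lemma hullS k : y k.+1 = y k + sl k.
Proof. by rewrite /slope subrKC. Qed.

Lemma side_line j s len k : on_side j s len -> (s <= k <= s + len)%N ->
  y k = y s + sl j * (k%:R - s%:R).
Proof.
move=> os; elim: k => [|k IH] /andP[].
  by rewrite leqn0 => /eqP-> _; rewrite subrr mulr0 addr0.
rewrite leq_eqVlt => /predU1P[<- _|sk kt]; first by rewrite subrr mulr0 addr0.
rewrite ltnS in sk; rewrite hullS (side_slope os) ?sk ?kt // IH ?sk ?(ltnW kt) //.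
by rewrite -[k.+1%:R]natr1; ring.
Qed.

Lemma side_below j s len k : on_side j s len -> (k < s)%N ->
  y s + sl j * (k%:R - s%:R) < y k.
Proof.
move=> os ks; have [d e] : exists d, (k.+1 + d = s)%N by exists (s - k.+1)%N; rewrite subnKC.
elim: d k ks e => [|d IH] k ks e; have := side_before os ks; have := hullS k.
  by rewrite addn0 in e; rewrite e -e -[k.+1%:R]natr1; lra.
have := IH k.+1; rewrite -e !addSn !addnS ltnS ltnS leq_addr => /(_ isT erefl).
by rewrite -[k.+1%:R]natr1; lra.
Qed.

Lemma side_above j s len k : on_side j s len -> (s + len < k <= l)%N ->
  y s + sl j * (k%:R - s%:R) < y k.
Proof.
move=> os; elim: k => [|k IH]; first by rewrite ltn0.
move=> /andP[]; rewrite ltnS leq_eqVlt => /predU1P[e kl|lk kl].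
  have := side_after os (k := k); rewrite -e leqnn e kl => /(_ isT).
  have := side_line os (k := k); rewrite -e leq_addr leqnn => /(_ isT); rewrite e.
  rewrite hullS -[k.+1%:R]natr1; lra.
have := IH; rewrite lk ltnW // => /(_ isT).
have := side_after os (k := k); rewrite ltnW // kl => /(_ isT).
rewrite hullS -[k.+1%:R]natr1; lra.
Qed.

Lemma side_hull j s len k : on_side j s len -> (k <= l)%N ->
  y s + sl j * (k%:R - s%:R) <= y k.
Proof.
move=> os kl; have [ks|sk] := ltnP k s; first exact/ltW/(side_below os).
have [ke|ek] := leqP k (s + len).
  by rewrite (side_line os (k := k)) ?lexx // sk.
by rewrite ltW // (side_above os) // ek.
Qed.

(** Up to [l] this is convexity. Beyond [l] the line is negative, being at most 0 at [l] and
    decreasing, while exponents are nonnegative. *)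
Lemma side_support j s len k : (j < l)%N -> on_side j s len -> S k ->
  y s + sl j * (k%:R - s%:R) <= U k.
Proof.
move=> jl os Sk; have [kl|lk] := leqP k l.
  exact: le_trans (side_hull os kl) (hull_le_U Sk).
have := side_hull os (leqnn l); have := slope_lt0 jl; rewrite hull_end.
have : (0 : rat) <= U k by rewrite ler0n.
have : (l%:R : rat) <= k%:R by rewrite ler_nat ltnW.
nra.
Qed.

Lemma side_strict j s len k : (j < l)%N -> on_side j s len -> S k ->
  ~~ ((s <= k <= s + len)%N && (y k == U k)) -> y s + sl j * (k%:R - s%:R) < U k.
Proof.
move=> jl os Sk; rewrite negb_and => ne; have [kl|lk] := leqP k l; last first.
  have := side_hull os (leqnn l); have := slope_lt0 jl; rewrite hull_end.
  have : (0 : rat) <= U k by rewrite ler0n.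
  have : (l%:R : rat) < k%:R by rewrite ltr_nat.
  nra.
have [ks|sk] := ltnP k s; first exact: lt_le_trans (side_below os ks) (hull_le_U Sk).
have [ke|ek] := leqP k (s + len); last first.
  by apply: lt_le_trans (hull_le_U Sk); rewrite (side_above os) // ek.
rewrite sk ke /= in ne; rewrite -(side_line os (k := k)) ?sk //.
by rewrite lt_neqAle ne hull_le_U.
Qed.
End Polygon.

(** * Residual polynomials *)

(** A nonconstant factor has degree less than [p], so the leading term of its derivative survives in
    characteristic [p]. *)
Lemma sqfree_separable (F : fieldType) (p : nat) (r : {poly F}) : p \in [pchar F] ->
  (size r <= p)%N -> sqfree r -> separable_poly r.
Proof.
move=> charFp rp sq_r; have r0 : r != 0.
  apply/eqP=> e; have := sq_r 'X; rewrite e dvdp0 size_polyX => /(_ isT).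
  by [].
apply/separable_polyP; split=> [u v uv_r|u u_r u1].
  have : gcdp u v * gcdp u v %| r.
    by apply: dvdp_trans uv_r; apply: dvdp_mul; rewrite ?dvdp_gcdl ?dvdp_gcdr.
  move=> /sq_r; rewrite /coprimep leq_eqVlt ltnS leqn0 size_poly_eq0 => /orP[//|].
  rewrite gcdp_eq0 => /andP[/eqP u0 _]; move: uv_r; rewrite u0 mul0r dvd0p.
  by rewrite (negPf r0).
have su : (size u <= p)%N by apply: leq_trans (dvdp_leq r0 u_r) rp.
apply/eqP=> /polyP/(_ (size u).-2); rewrite coef_deriv coef0.
have e : ((size u).-2.+1 = (size u).-1)%N by rewrite -subn2 -subn1; move: u1; lia.
rewrite e -lead_coefE -mulr_natr => /eqP; rewrite mulf_eq0 lead_coef_eq0.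
rewrite -(dvdn_pcharf charFp) -size_poly_eq0 gtnNdvd ?orbF; move: u1 su; lia.
Qed.

Definition evalZ (x : algC) (a : {poly int}) : algC := (ZtoC a).[x].
HB.instance Definition _ x := GRing.RMorphism.copy (evalZ x) (horner_eval x \o ZtoC).

Section Residual.
Variables (p : nat) (V : subringClosed algC) (M : zmodClosed algC).
Hypothesis VM : valuation_ring p V M.
Hypothesis p_pr : prime p.
Variable x : algC.
Hypothesis Vx : x \in V.

(** The kernel of the map from [F_p[X]] to [V / M] sending [X] to the class of [x], expressed by
    lifts so that [V / M] need not be formed. *)
Definition residual_ideal (b : {poly 'F_p}) : Prop :=
  exists2 a, redp p a = b & (ZtoC a).[x] \in M.

Lemma residual_idealP a : residual_ideal (redp p a) -> (ZtoC a).[x] \in M.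
Proof.
move=> [c e Mc]; rewrite -(subrK (ZtoC c).[x] (ZtoC a).[x]) rpredD //.
exact: (eval_redp VM p_pr Vx).
Qed.

Lemma residual_idealM b c : residual_ideal c -> residual_ideal (b * c).
Proof.
move=> [a ea Ma]; have [b' eb] := redp_surj b; exists (b' * a).
  by rewrite rmorphM /= ea eb.
by rewrite rmorphM /= hornerM (val_ideal VM) ?(eval_val Vx).
Qed.

Lemma residual_idealB b c : residual_ideal b -> residual_ideal c -> residual_ideal (b - c).
Proof.
move=> [a ea Ma] [d ed Md]; exists (a - d); first by rewrite rmorphB /= ea ed.
by rewrite rmorphB /= hornerD hornerN rpredB.
Qed.

Lemma residual_ideal_prime b c : residual_ideal (b * c) -> residual_ideal b \/ residual_ideal c.
Proof.
have [b' <-] := redp_surj b; have [c' <-] := redp_surj c; rewrite -rmorphM.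
move=> /residual_idealP; rewrite rmorphM /= hornerM => /(valM VM).
by rewrite !(eval_val Vx) => /(_ isT isT)/orP[Mb|Mc]; [left; exists b'|right; exists c'].
Qed.

Lemma residual_ideal_const c : c != 0 -> ~ residual_ideal c%:P.
Proof.
move=> c0 /(residual_idealM (c^-1)%:P); rewrite -polyCM mulVf // polyC1 -(rmorph1 (redp p)).
by move=> /residual_idealP; rewrite rmorph1 hornerC; apply/negP/(val_proper VM).
Qed.

(** The kernel is a prime ideal and contains the nonzero reduction of [g]; a monic element of least
    degree is irreducible and divides every element. The residue field generated by [x] is thus
    [F_p[X] / phi]. *)
Lemma residual_generator g : (ZtoC g).[x] \in M -> redp p g != 0 ->
  exists phi : {poly 'F_p}, [/\ monic_irreducible_poly phi, residual_ideal phi &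
    phi %| redp p g].
Proof.
move=> Mg g0.
pose P k := `[< exists b, [/\ b \is monic, residual_ideal b & size b = k] >].
have monicize b : b != 0 -> residual_ideal b -> P (size b).
  move=> b0 Ib; apply/asboolP; exists ((lead_coef b)^-1 *: b).
  have lb : (lead_coef b)^-1 != 0 by rewrite invr_eq0 lead_coef_eq0.
  split; last by rewrite size_scale.
    by rewrite monicE lead_coefZ mulVf // lead_coef_eq0.
  by rewrite -mul_polyC; apply: residual_idealM.
have exP : exists k, P k by exists (size (redp p g)); apply: monicize => //; exists g.
case: (ex_minnP exP) => k /asboolP[phi [phi_mon Iphi sphi]] kmin.
have phi0 := monic_neq0 phi_mon.
have minsize b : b != 0 -> residual_ideal b -> (size phi <= size b)%N.
  by move=> b0 /(monicize _ b0)/kmin; rewrite sphi.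
exists phi; split=> //; last first.
  rewrite /dvdp; apply: contraT => r0.
  have : residual_ideal (redp p g %% phi).
    rewrite -[redp p g %% phi](addKr (redp p g %/ phi * phi)) -divp_eq addrC.
    apply: residual_idealB; first by exists g.
    exact: residual_idealM.
  by move=> /(minsize _ r0); rewrite leqNgt ltn_modp phi0.
split=> //; split.
  rewrite ltnNge; apply/negP=> s1; have := phi0; rewrite (size1_polyC s1) in Iphi *.
  by rewrite polyC_eq0 => c0; apply: (residual_ideal_const c0 Iphi).
move=> q q1 q_phi; have /dvdpP[c ec] := q_phi.
have cq0 : c * q != 0 by rewrite -ec.
have [c0 q0] : c != 0 /\ q != 0 by move: cq0; rewrite mulf_eq0 negb_or => /andP.
have [Ic|Iq] : residual_ideal c \/ residual_ideal q.
- by apply: residual_ideal_prime; rewrite -ec.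
- have := minsize c c0 Ic; rewrite ec size_mul //.
  move=> h; exfalso; move: q1 c0 q0 h; rewrite -!size_poly_gt0.
  have arith (a b : nat) : (b != 1 -> 0 < a -> 0 < b -> (a + b).-1 <= a -> False)%N by lia.
  exact: arith.
- by rewrite -dvdp_size_eqp // eqn_leq (dvdp_leq phi0 q_phi) minsize.
Qed.

Lemma in_qpoly_eq0 (phi a : {poly 'F_p}) : phi \is monic -> (1 < size phi)%N ->
  in_qpoly phi a = 0 -> phi %| a.
Proof.
move=> phi_mon s1 /(congr1 val) /= e; rewrite /dvdp.
have em : mk_monic phi = phi by rewrite /mk_monic s1 phi_mon.
by move: e; rewrite em -Pdiv.IdomainMonic.modpE // => ->.
Qed.

(** A Bezout relation between the residual polynomial and its derivative over [F] is lifted to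
    [Z[x]] and evaluated at [x] and [t]. In this way [t] may have its residue class in an extension
    of [F]. *)
Lemma residual_bezout (F : fieldType) (psi : {rmorphism {poly int} -> F})
  (R : {poly {poly int}}) (t : algC) : t \in V ->
  (forall y, exists a, psi a = y) -> (forall a, psi a = 0 -> (ZtoC a).[x] \in M) ->
  separable_poly (map_poly psi R) ->
  (map_poly (evalZ x) R).[t] \in M -> (map_poly (evalZ x) R^`()).[t] \in M -> False.
Proof.
move=> Vt psi_surj psi_ker; rewrite unlock => sepR MR MR'.
have /Bezout_eq1_coprimepP[[a b] /= eab] := sepR.
have lift (c : {poly F}) : exists c', map_poly psi c' = c.
  have /fin_all_exists[h hE] (i : 'I_(size c)) : exists a, psi a = c`_i by apply: psi_surj.
  exists (\poly_(i < size c) (if insub i is Some j then h j else 0)).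
  apply/polyP=> i; rewrite coef_map coef_poly; case: ltnP => ic; last first.
    by rewrite nth_default //; apply: rmorph0.
  by rewrite insubT; apply: (hE (Ordinal ic)).
have [a' ea] := lift a; have [b' eb] := lift b.
have e0 : map_poly psi (a' * R + b' * R^`() - 1) = 0.
  by rewrite rmorphB rmorphD !rmorphM rmorph1 /= -deriv_map ea eb eab subrr.
have ME : (map_poly (evalZ x) (a' * R + b' * R^`() - 1)).[t] \in M.
  apply: (horner_ideal VM) => //; apply/polyOverP=> i; rewrite coef_map.
  by apply: psi_ker; have /polyP/(_ i) := e0; rewrite coef_map coef0.
have Vc (c : {poly {poly int}}) : (map_poly (evalZ x) c).[t] \in V.
  apply: rpred_horner => //; apply/polyOverP=> i; rewrite coef_map.
  exact: (eval_val Vx).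
case/negP: (val_proper VM).
have -> : 1 = (map_poly (evalZ x) a').[t] * (map_poly (evalZ x) R).[t] +
   (map_poly (evalZ x) b').[t] * (map_poly (evalZ x) R^`()).[t] -
   (map_poly (evalZ x) (a' * R + b' * R^`() - 1)).[t].
  rewrite rmorphB rmorphD !rmorphM rmorph1 /= hornerD hornerN hornerD !hornerM hornerC.
  by ring.
by rewrite rpredB // rpredD // (val_ideal VM).
Qed.
(** [F_p[X] / phi] is the quotient of [Z[x] / (N, g)] by a maximal ideal, so regularity applies to
    the morphism [psi]. *)
Lemma residual_separable (N : nat) (g : {poly int}) (R : {poly {poly int}}) (t : algC) :
  (p %| N)%N -> redp p g != 0 -> (ZtoC g).[x] \in M -> t \in V -> (size R <= p)%N ->
  (forall (F : fieldType) (psi : {rmorphism {poly int} -> F}),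
      (forall y, exists a, psi a = y) -> psi N%:R = 0 -> psi g = 0 -> sqfree (map_poly psi R)) ->
  (map_poly (evalZ x) R).[t] \in M -> (map_poly (evalZ x) R^`()).[t] \notin M.
Proof.
move=> pN g0 Mg Vt Rp sqR MR; apply/negP=> MR'.
have [phi [mi Iphi phi_g]] := residual_generator Mg g0.
have [[s1 _] phi_mon] := mi.
pose F : fieldType := {poly %/ phi with mi}.
pose psi : {rmorphism {poly int} -> F} := (in_qpoly phi : {poly 'F_p} -> F) \o redp p.
have psi_surj y : exists a, psi a = y.
  have [a ea] := redp_surj (val y); exists a; rewrite /= ea.
  exact/val_inj/in_qpoly_small/size_mk_monic.
have psi_ker a : psi a = 0 -> (ZtoC a).[x] \in M.
  move=> /(in_qpoly_eq0 phi_mon s1)/dvdpP[c ec]; apply: residual_idealP.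
  by rewrite ec; apply: residual_idealM.
have charF : p \in [pchar F].
  apply/andP; split=> //; rewrite -(rmorph_nat psi) /= rmorph_nat.
  have -> : p%:R = 0 :> {poly 'F_p} by rewrite -polyC1 -polyCMn pchar_Fp_0.
  by rewrite rmorph0.
have psiN : psi N%:R = 0.
  by have /dvdnP[c ->] := pN; rewrite natrM rmorphM !rmorph_nat (pcharf0 charF) mulr0.
have psig : psi g = 0.
  have /dvdpP[c ec] := phi_g; rewrite /= ec.
  rewrite in_qpolyM; have -> : in_qpoly phi phi = 0; last by rewrite mulr0.
  by apply/val_inj; rewrite /= /mk_monic s1 phi_mon Pdiv.RingMonic.rmodpp.
have sepR : separable_poly (map_poly psi R).
  apply: (sqfree_separable charF); last exact: sqR.
  by apply: leq_trans Rp; apply: size_poly.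
exact: residual_bezout Vt psi_surj psi_ker sepR MR MR'.
Qed.
End Residual.

(** * The derivative at the roots *)

Lemma deriv_over_ideal (M : zmodClosed algC) (a : {poly algC}) :
  a \is a polyOver M -> a^`() \is a polyOver M.
Proof.
by move=> /polyOverP Ma; apply/polyOverP=> i; rewrite coef_deriv rpredMn.
Qed.

Section Roots.
Variables (p : nat) (V : subringClosed algC) (M : zmodClosed algC).
Hypothesis VM : valuation_ring p V M.
Hypothesis p_pr : prime p.
Variables (N : nat) (f g : {poly int}) (l : nat) (x : algC).
Hypotheses (N1 : (1 < N)%N) (pN : (p %| N)%N) (p_big : ((size f).-1 < p)%N).
Hypotheses (f_monic : f \is monic) (g_monic : g \is monic) (g_size : (1 < size g)%N).
Hypotheses (l_gt0 : (0 < l)%N) (lf : (l < size f)%N).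

Local Notation S s := (dig f g s != 0).
Local Notation U s := ((vNexp N (dig f g s))%:R : rat).
Local Notation y := (hull N f g).
Local Notation sl := (slope N f g).

Hypotheses (S0 : S 0%N) (Sl : S l) (Ul : vNexp N (dig f g l) = 0%N).
Hypothesis Upos : forall s, (s < l)%N -> S s -> (0 < vNexp N (dig f g s))%N.
Hypothesis fg_def : forall s, vN_defined N (dig f g s).
Hypothesis reg_vertex : forall s len sigma, is_side N f g s len sigma ->
  forall r, (r = s \/ r = s + len)%N ->
  coprimep (redp p (unitpart N (dig f g r))) (redp p g).
Hypothesis reg_side : forall s len sigma, is_side N f g s len sigma ->
  forall (F : fieldType) (psi : {rmorphism {poly int} -> F}),
    (forall y, exists x, psi x = y) -> psi (N%:R) = 0 -> psi g = 0 ->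
    sqfree (map_poly psi (respoly N f g s len sigma)).
Hypothesis g_deriv : coprimep (redp p g^`()) (redp p g).
Hypotheses (fx : root (ZtoC f) x) (gx : (ZtoC g).[x] \in M).

Let N0 : (0 < N)%N. Proof. exact: ltnW. Qed.
Let Vx : x \in V.
Proof. by apply: (val_Aint VM); apply: root_monic_int fx. Qed.
Let gm := (ZtoC g).[x].
Let Vval := eval_val Vx.

Lemma vertex_unit j : vertex N f g j -> (ZtoC (unitpart N (dig f g j))).[x] \notin M.
Proof.
move=> [_ _ [s [len [sigma [side jE]]]]].
exact: (eval_coprime VM p_pr Vx (reg_vertex side jE) gx).
Qed.

Lemma eval_dig s : S s ->
  (ZtoC (dig f g s)).[x] = Npow N (U s) * (ZtoC (unitpart N (dig f g s))).[x].
Proof.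
move=> Ss; have [e _] := vN_unitpart N1 (fg_def s) Ss.
by rewrite [in LHS]e ZtoCZ hornerZ rmorphXn /= Npow_nat // -pmulrn.
Qed.

Lemma eval_dig_sum : \sum_(s < size f) (ZtoC (dig f g s)).[x] * gm ^+ s = 0.
Proof.
rewrite -[RHS](rootP fx) [in RHS](dig_sum f g_monic g_size) rmorph_sum /= horner_sum.
by apply: eq_bigr => s _; rewrite rmorphM rmorphXn /= hornerM horner_exp.
Qed.

(** If the valuation of [g(x)] lies strictly between the negated slopes on both sides of the vertex
    [j], the term of index [j] strictly dominates the expansion of [f(x) = 0]. Nonvanishing of [gm]
    is demanded separately, since a quotient by zero is 0 and lies in [M]. *)
Lemma no_vertex_root j : (j <= l)%N -> vertex N f g j ->
  (forall k, (k < j)%N -> Npow N (- sl k) / gm \in M) -> ((0 < j)%N -> gm != 0) ->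
  (forall k, (j <= k < l)%N -> gm / Npow N (- sl k) \in M) -> False.
Proof.
move=> jl vj below gm0 above; pose D := Npow N (y j) * gm ^+ j.
have gmj : gm ^+ j != 0 by case: j gm0 {jl vj below above D} => [|j] g0; rewrite ?oner_eq0 ?expf_neq0 ?g0.
have lo s : (s < j)%N -> Npow N (y s - y j) / gm ^+ (j - s) \in M.
  move=> sj; have [d e] : exists d, (s.+1 + d = j)%N by exists (j - s.+1)%N; rewrite subnKC.
  elim: d s sj e => [|d IH] s sj e.
    have -> : (j - s = 1)%N by rewrite -e addn0 subSnn.
    rewrite addn0 in e; rewrite expr1 -e.
    by have := below s sj; rewrite hullS; congr (Npow N _ / _ \in M); lra.
  have -> : (j - s = (j - s.+1).+1)%N by rewrite subnSK.
  have -> : y s - y j = - sl s + (y s.+1 - y j) by rewrite hullS; lra.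
  rewrite NpowD // exprS invfM mulrACA (val_idealr VM) //; first exact: below.
  have e' : (s.+2 + d)%N = j by rewrite -e addnS.
  by apply/(val_sub VM)/(IH _ _ e'); rewrite -e' addSn ltnS leq_addr.
have hi s : (j <= s <= l)%N -> Npow N (y s - y j) * gm ^+ (s - j) \in (if s == j then V : {pred algC} else M).
  elim: s => [|s IH]; first by rewrite leqn0 => /andP[/eqP-> _]; rewrite subrr Npow0 // mul1r expr0 rpred1.
  move=> /andP[]; rewrite leq_eqVlt => /predU1P[<- _|js sl'].
    by rewrite eqxx subnn subrr Npow0 // mul1r expr0 rpred1.
  rewrite gtn_eqF //; rewrite ltnS in js; rewrite subSn // exprSr.
  have -> : y s.+1 - y j = (y s - y j) + sl s by rewrite hullS; lra.
  rewrite NpowD // mulrACA -[sl s]opprK NpowN // [_^-1 * gm]mulrC (val_ideal VM) //; last first.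
    by apply: above; rewrite js.
  have := IH; rewrite js ltnW // => /(_ isT); case: ifP => // _; exact: (val_sub VM).
have term s : S s -> s != j -> exists2 m, m \in M & (ZtoC (dig f g s)).[x] * gm ^+ s = D * m.
  have eU : Npow N (U s) = Npow N (U s - y s) * (Npow N (y s - y j) * Npow N (y j)).
    by rewrite -!NpowD //; congr (Npow N _); lra.
  move=> Ss; rewrite neq_ltn eval_dig // => /orP[sj|js].
    exists ((ZtoC (unitpart N (dig f g s))).[x] * Npow N (U s - y s) * (Npow N (y s - y j) / gm ^+ (j - s))).
      rewrite (val_ideal VM) ?lo // rpredM ?Vval // (Npow_val N VM) //.
      by rewrite subr_ge0; apply: hull_le_U.
    have ej : gm ^+ j = gm ^+ (j - s) * gm ^+ s by rewrite -exprD subnK // ltnW.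
    have gmjs : gm ^+ (j - s) != 0 by apply: contra gmj; rewrite ej => /eqP->; rewrite mul0r.
    by rewrite /D eU ej; field.
  have [sl'|ls] := leqP s l.
    exists ((ZtoC (unitpart N (dig f g s))).[x] * Npow N (U s - y s) * (Npow N (y s - y j) * gm ^+ (s - j))).
      have := hi s; rewrite ltnW // sl' gtn_eqF // => /(_ isT) h.
      rewrite (val_ideal VM) // rpredM ?Vval // (Npow_val N VM) //.
      by rewrite subr_ge0; apply: hull_le_U.
    have es : gm ^+ s = gm ^+ j * gm ^+ (s - j) by rewrite -exprD subnKC // ltnW.
    by rewrite /D eU es; ring.
  (* Beyond [l] only the integrality of the digit is used; the extra factors [g(x)], which lie in
     [M], make the term small. *)
  exists ((ZtoC (unitpart N (dig f g s))).[x] * Npow N (U s) * (Npow N (y l - y j) * gm ^+ (l - j)) * gm ^+ (s - l)).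
    have := hi l; rewrite jl leqnn => /(_ isT) h.
    have {}h : Npow N (y l - y j) * gm ^+ (l - j) \in V by move: h; case: ifP => // _; apply: (val_sub VM).
    rewrite (val_ideal VM) //; last first.
      rewrite -(subnK (_ : 0 < s - l)%N) ?subn_gt0 // addn1 exprS (val_idealr VM) // rpredX //.
      exact: (val_sub VM).
    by rewrite rpredM // rpredM ?Vval // (Npow_val N VM) // ler0n.
  rewrite /D; have -> : gm ^+ s = gm ^+ j * gm ^+ (l - j) * gm ^+ (s - l).
    by rewrite -!exprD subnKC // subnKC // ltnW.
  rewrite (@hull_end N f g l) // sub0r NpowN //.
  by have := Npow_neq0 N0 (y j) => h; field.
have [Sj yj _] := vj; case/negP: (vertex_unit vj).
have jf : (j < size f)%N by apply: leq_ltn_trans jl lf.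
have D0 : D != 0 by rewrite mulf_neq0 ?Npow_neq0.
have := eval_dig_sum; rewrite (bigD1 (Ordinal jf)) //= eval_dig // -yj mulrAC -/D.
have [m Mm ->] : exists2 m, m \in M &
    \sum_(s < size f | s != Ordinal jf) (ZtoC (dig f g s)).[x] * gm ^+ s = D * m.
  apply: (big_ind (fun z => exists2 m, m \in M & z = D * m)).
  - by exists 0; rewrite ?rpred0 ?mulr0.
  - by move=> _ _ [a Ma ->] [b Mb ->]; exists (a + b); rewrite ?rpredD ?mulrDr.
  - move=> s; rewrite -val_eqE /= => sj; have [e|Ss] := eqVneq (dig f g s) 0.
      by exists 0; rewrite ?rpred0 // e rmorph0 horner0 mul0r mulr0.
    exact: term.
rewrite -mulrDr => /eqP; rewrite mulf_eq0 (negPf D0) /= addr_eq0 => /eqP->.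
by rewrite rpredN.
Qed.

(** Take the first [j] for which [N^(- sl j)] divides [g(x)] in [V]. If the quotient were not a
    unit, or if no such [j] existed, the valuation of [g(x)] would fall strictly between the slopes
    at a vertex, [j] or [l], against [no_vertex_root]. *)
Lemma root_slope : exists j s len, [/\ (j < l)%N, on_side N f g l j s len,
  gm / Npow N (- sl j) \in V & gm / Npow N (- sl j) \notin M].
Proof.
pose T k := gm / Npow N (- sl k).
have inv k : T k \notin V -> Npow N (- sl k) / gm \in M.
  by move=> Tk; have [|] := val_total VM (T k); rewrite ?(negPf Tk) // invf_div.
have nz k : T k \notin V -> gm != 0.
  by apply: contra => /eqP e; rewrite /T e mul0r rpred0.
have [/existsP[j0 Tj0]|none] := boolP [exists j : 'I_l, T j \in V]; last first.
  have notV k : (k < l)%N -> T k \notin V.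
    by move=> kl; apply: contra none => h; apply/existsP; exists (Ordinal kl).
  exfalso; apply: (@no_vertex_root l) => //.
  - exact: vertex_end.
  - by move=> k /notV/inv.
  - by move=> l0; apply: (nz 0%N); apply: notV.
  - by move=> k /andP[lk kl]; move: (leq_ltn_trans lk kl); rewrite ltnn.
have exj : exists j, (j < l)%N && (T j \in V) by exists j0; rewrite ltn_ord.
case: (ex_minnP exj) => j /andP[jl Tj] jmin {j0 Tj0}.
have notV k : (k < j)%N -> T k \notin V.
  move=> kj; apply/negP=> Tk; move: (jmin k); rewrite Tk (ltn_trans kj) // leqNgt kj.
  by move/(_ isT).
have [s [len os]] := side_exists g_monic g_size l_gt0 S0 Sl Ul Upos jl.
exists j, s, len; split=> //; apply/negP=> MT.
apply: (@no_vertex_root j) => //; first exact: ltnW.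
- have [->|j0] := posnP j; first exact: (vertex_start g_monic g_size l_gt0 S0 Sl Ul Upos).
  apply: (vertex_break g_monic g_size l_gt0 S0 Sl Ul Upos) => //.
  apply/eqP=> e; move: (notV j.-1); rewrite /T e prednK // leqnn => /(_ isT).
  by rewrite (val_sub VM).
- by move=> k /notV/inv.
- by move=> j0; apply: (nz 0%N); apply: notV.
- move=> k /andP[jk kl].
  have -> : gm / Npow N (- sl k) = Npow N (sl k - sl j) * T j.
    by rewrite /T NpowB // !NpowN // !invrK; have := Npow_neq0 N0 (sl j) => h; field.
  rewrite (val_ideal VM) // (Npow_val N VM) // subr_ge0.
  exact: (slope_le N g_monic g_size S0 Sl jk kl).
Qed.

Section OnSide.
Variables (j s len : nat).
Hypotheses (jl : (j < l)%N) (os : on_side N f g l j s len).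
Let mu := - sl j.
Let rho := gm / Npow N mu.
Hypotheses (Vrho : rho \in V) (Mrho : rho \notin M).

Let line k : rat := y s + sl j * (k%:R - s%:R).
Let A k : algC := (ZtoC (dig f g k)).[x] / Npow N (line k).
Let W : {poly algC} := \poly_(k < size f) A k.
Let e := `|denq (sl j)|%N.
Let R := respoly N f g s len (sl j).
Let Rx := map_poly (evalZ x) R.
Let P := 'X^s * (Rx \Po 'X^e).

Let e_gt0 : (0 < e)%N. Proof. by rewrite absz_gt0 denq_neq0. Qed.
Let mu_gt0 : 0 < mu.
Proof. by rewrite oppr_gt0; apply: (slope_lt0 g_monic g_size l_gt0 S0 Sl Ul Upos). Qed.

Lemma scaled_digE k : S k -> A k = (ZtoC (unitpart N (dig f g k))).[x] * Npow N (U k - line k).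
Proof. by move=> Sk; rewrite /A eval_dig // NpowB //; ring. Qed.

Lemma scaled_dig_val k : A k \in V.
Proof.
have [e0|Sk] := eqVneq (dig f g k) 0; first by rewrite /A e0 rmorph0 horner0 mul0r rpred0.
rewrite scaled_digE // rpredM ?Vval // (Npow_val N VM) // subr_ge0.
exact: (side_support g_monic g_size l_gt0 S0 Sl Ul Upos jl os Sk).
Qed.

(* The points on the side have abscissae congruent to [s] modulo the denominator of the
   slope, since their ordinates are integers. *)
Lemma dvdn_side k : (s <= k <= s + len)%N -> y k = U k -> (e %| k - s)%N.
Proof.
move=> kr yU; have [_ yUs _] := side_left os; have /andP[sk _] := kr.
have := side_line os kr; rewrite yU yUs => eq.
have : sl j * (k - s)%N%:R \in Num.int.
  rewrite natrB //; have -> : sl j * (k%:R - s%:R) = U k - U s by rewrite eq; ring.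
  by rewrite rpredB ?rpred_nat.
move=> /intrP[z ez]; have : (denq (sl j) %| (k - s)%N%:Z * numq (sl j))%Z.
  apply/dvdzP; exists z; apply: (@intr_inj rat); rewrite !intrM -ez numqE -pmulrn; ring.
by rewrite Gauss_dvdzl // coprimezE coprime_sym coprime_num_den.
Qed.

Lemma side_poly_coef k : P`_k = if (s <= k <= s + len)%N && (e %| k - s)%N then
  (ZtoC (rescoef N f g k)).[x] else 0.
Proof.
rewrite /P coefXnM; case: ltnP => [ks|sk] //=.
rewrite coef_comp_poly_Xn //; case: ifP => [/dvdnP[t et]|]; last by rewrite andbF.
rewrite et mulnK // andbT coef_map coef_poly /= ltnS leq_divRL //.
have -> : (k <= s + len)%N = (t * e <= len)%N by rewrite -et leq_subLR.
by case: ifP => _; rewrite ?rmorph0 // -et subnKC.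
Qed.

Lemma WP_ideal : W - P \is a polyOver M.
Proof.
apply/polyOverP=> k; rewrite coefB coef_poly side_poly_coef.
have -> : (if (k < size f)%N then A k else 0) = A k.
  by case: ltnP => // fk; rewrite /A dig_eq0 // rmorph0 horner0 mul0r.
have [e0|Sk] := eqVneq (dig f g k) 0.
  by rewrite /A e0 rmorph0 horner0 mul0r /rescoef e0 eqxx rmorph0 horner0 if_same subrr rpred0.
have strict := side_strict g_monic g_size l_gt0 S0 Sl Ul Upos jl os Sk.
have [/andP[kr yU]|nk] := boolP ((s <= k <= s + len)%N && (y k == U k)).
  rewrite kr (dvdn_side kr (eqP yU)) /= /rescoef Sk yU /= scaled_digE // /line.
  by rewrite -(side_line os kr) (eqP yU) subrr Npow0 mulr1 subrr rpred0.
have -> : (if (s <= k <= s + len)%N && (e %| k - s)%N then (ZtoC (rescoef N f g k)).[x] else 0) = 0.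
  case: ifP => // /andP[kr _]; rewrite kr /= in nk.
  by rewrite /rescoef Sk (negPf nk) rmorph0 horner0.
rewrite subr0 scaled_digE // (val_ideal VM) ?Vval // (Npow_ideal VM pN) // subr_gt0.
exact: strict.
Qed.

Lemma gmX k : gm ^+ k = rho ^+ k * Npow N mu ^+ k.
Proof. by rewrite -exprMn /rho divfK ?Npow_neq0. Qed.

Lemma dig_term k : (ZtoC (dig f g k)).[x] = A k * Npow N (line k).
Proof. by rewrite /A divfK ?Npow_neq0. Qed.

Lemma Npow_line k : Npow N (line k) * Npow N mu ^+ k = Npow N (line 0).
Proof. by rewrite -NpowMn // -NpowD //; congr (Npow N _); rewrite /line /mu; ring. Qed.

Lemma W_root : W.[rho] = 0.
Proof.
apply: (mulIf (Npow_neq0 N0 (line 0))); rewrite mul0r -[RHS]eval_dig_sum horner_poly mulr_suml.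
apply: eq_bigr => k _; rewrite dig_term gmX -(Npow_line k).
by move: (A k) (rho ^+ k) (Npow N (line k)) (Npow N mu ^+ k) => a b c d; ring.
Qed.

Lemma W_derivE : W^`().[rho] = \sum_(k < size f) A k * (rho ^+ k.-1 *+ k).
Proof.
rewrite /W poly_def raddf_sum horner_sum; apply: eq_bigr => k _ /=.
by rewrite derivZ derivXn hornerZ hornerMn hornerXn.
Qed.

Lemma W_deriv : (ZtoC f^`()).[x] / Npow N (line 0 - mu) - (ZtoC g^`()).[x] * W^`().[rho] \in M.
Proof.
have -> : (ZtoC f^`()).[x] = \sum_(k < size f) ((ZtoC (dig f g k)^`()).[x] * gm ^+ k +
    (ZtoC (dig f g k)).[x] * ((ZtoC g^`()).[x] * gm ^+ k.-1 *+ k)).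
  rewrite [in LHS](dig_sum f g_monic g_size) raddf_sum rmorph_sum /= horner_sum.
  apply: eq_bigr => k _; rewrite derivM deriv_exp rmorphD !rmorphM rmorphMn rmorphM /=.
  by rewrite !rmorphXn /= hornerD !hornerM hornerMn hornerM !horner_exp.
rewrite W_derivE mulr_suml mulr_sumr -sumrB; apply: rpred_sum => k _.
have [e0|Sk] := eqVneq (dig f g k) 0.
  by rewrite /A e0 deriv0 rmorph0 horner0 !mul0r mulr0 addr0 mul0r subrr rpred0.
rewrite mulrDl; set a1 := _ / _; set a2 := _ / _; set a3 := _ * _.
have -> : a2 = a3.
  rewrite /a2 /a3; case: (nat_of_ord k) => [|i]; first by rewrite !mulr0n !mulr0 mul0r.
  rewrite dig_term /= gmX.
  have -> : Npow N (line 0 - mu) = Npow N (line i.+1) * Npow N mu ^+ i.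
    by rewrite -NpowMn // -NpowD //; congr (Npow N _); rewrite /line /mu -[i.+1%:R]natr1; ring.
  rewrite -[in LHS]mulr_natr -[in RHS]mulr_natr.
  have n1 := Npow_neq0 N0 (line i.+1).
  have n2 : Npow N mu ^+ i != 0 by rewrite expf_neq0 ?Npow_neq0.
  by field; rewrite n1 n2.
rewrite addrK /a1.
have [e1 _] := vN_unitpart N1 (fg_def k) Sk.
have -> : (ZtoC (dig f g k)^`()).[x] = Npow N (U k) * (ZtoC (unitpart N (dig f g k))^`()).[x].
  by rewrite [in LHS]e1 derivZ ZtoCZ hornerZ rmorphXn /= Npow_nat // -pmulrn.
have -> : Npow N (U k) * (ZtoC (unitpart N (dig f g k))^`()).[x] * gm ^+ k / Npow N (line 0 - mu) =
  (ZtoC (unitpart N (dig f g k))^`()).[x] * rho ^+ k * Npow N (U k - line k) * Npow N mu.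
  rewrite gmX.
  have -> : Npow N (line 0 - mu) = Npow N (line k) * Npow N mu ^+ k / Npow N mu.
    by rewrite Npow_line NpowB.
  rewrite NpowB //; have n1 := Npow_neq0 N0 (line k); have n3 := Npow_neq0 N0 mu.
  have n2 : Npow N mu ^+ k != 0 by rewrite expf_neq0.
  by field; rewrite n1 n2 n3.
rewrite (val_ideal VM) ?(Npow_ideal VM pN) // !rpredM ?rpredX ?Vval //.
rewrite (Npow_val N VM) // subr_ge0.
exact: (side_support g_monic g_size l_gt0 S0 Sl Ul Upos jl os Sk).
Qed.

Lemma nat_unit k : ~~ (p %| k)%N -> k%:R \notin M.
Proof.
move=> pk; have -> : k%:R = (ZtoC k%:R).[x] by rewrite rmorph_nat -polyC_natr hornerC.
apply: (eval_coprime VM p_pr Vx _ gx); rewrite rmorph_nat -polyC_natr -alg_polyC coprimepZl.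
  exact: coprime1p.
by rewrite -(dvdn_pcharf (pchar_Fp p_pr)).
Qed.

Lemma unitsM a b : a \in V -> b \in V -> a \notin M -> b \notin M -> a * b \notin M.
Proof.
by move=> Va Vb /negPf Ma /negPf Mb; apply/negP=> /(valM VM)/(_ Va Vb); rewrite Ma Mb.
Qed.

Lemma rhoX k : rho ^+ k \notin M.
Proof. by apply: contra Mrho; apply: (valX VM). Qed.

(** Modulo [M] this is [P'(rho)]. One term of it contains [Rx(rho^e)], which lies in [M] because
    [W(rho) = 0]; the other is [e] times a power of [rho] times [Rx'(rho^e)], a unit by
    regularity. *)
Lemma W_deriv_unit : W^`().[rho] \notin M.
Proof.
pose t := rho ^+ e; have Vt : t \in V by rewrite rpredX.
have VR (c : {poly {poly int}}) : (map_poly (evalZ x) c).[t] \in V.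
  by apply: rpred_horner => //; apply/polyOverP=> i; rewrite coef_map; apply: Vval.
have MR : Rx.[t] \in M.
  have : P.[rho] \in M.
    rewrite -[P.[rho]]opprK -[- P.[rho]]add0r -W_root -hornerN -hornerD rpredN.
    by apply: (horner_ideal VM) => //; apply: WP_ideal.
  rewrite /P hornerM horner_comp !hornerXn => /(valM VM).
  by rewrite rpredX // VR (negPf (rhoX s)) => /(_ isT isT).
have len_p : (len < p)%N.
  apply: leq_ltn_trans p_big; rewrite -ltnS (ltn_predK lf).
  by apply: leq_ltn_trans lf; apply: leq_trans (side_le os); apply: leq_addl.
have len0 : (0 < len)%N by have [] := side_is os.
have MR' : (map_poly (evalZ x) R^`()).[t] \notin M.
  apply: (residual_separable VM p_pr Vx pN _ gx Vt _ (reg_side (side_is os)) MR).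
    by rewrite monic_neq0 ?monic_map.
  by apply: leq_trans (size_poly _ _) _; apply: leq_ltn_trans len_p; apply: leq_div.
(* Both ends of the side carry points, so [e] divides [len], which is less than [p]. *)
have e_p : ~~ (p %| e)%N.
  rewrite gtnNdvd //; apply: leq_ltn_trans len_p; apply: dvdn_leq => //.
  have [_ yU _] := side_right os; have := dvdn_side _ yU.
  by rewrite leq_addr leqnn addKn; apply.
have MP : W^`().[rho] - P^`().[rho] \in M.
  rewrite -hornerN -hornerD -derivB; apply: (horner_ideal VM) => //.
  by apply: deriv_over_ideal; apply: WP_ideal.
apply/negP=> MW; have : P^`().[rho] \in M.
  by rewrite -[P^`().[rho]](subKr W^`().[rho]) rpredB.
rewrite /P derivM deriv_comp !derivXn hornerD !hornerM !hornerMn !horner_comp !hornerXn.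
rewrite deriv_map -/t => h; have : rho ^+ s * ((map_poly (evalZ x) R^`()).[t] * (rho ^+ e.-1 *+ e)) \in M.
  rewrite -(addKr (rho ^+ s.-1 *+ s * Rx.[t]) (_ * _)) rpredD // rpredN.
  by rewrite (val_ideal VM) // rpredMn // rpredX.
apply/negP; rewrite -[_ *+ e]mulr_natr.
by do ![apply: unitsM]; rewrite ?rpredM ?rpredX ?rpred_nat ?VR ?rhoX ?nat_unit.
Qed.

Lemma deriv_bound : Npow N (line 0 - mu) / (ZtoC f^`()).[x] \in V.
Proof.
have : (ZtoC f^`()).[x] / Npow N (line 0 - mu) \notin M.
  apply/negP=> h; have : (ZtoC g^`()).[x] * W^`().[rho] \in M.
    by rewrite -[X in X \in M](subKr ((ZtoC f^`()).[x] / Npow N (line 0 - mu))) rpredB ?W_deriv.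
  apply/negP/unitsM; rewrite ?Vval //; last exact: W_deriv_unit.
    by rewrite W_derivE; apply: rpred_sum => k _; rewrite rpredM ?scaled_dig_val ?rpredMn ?rpredX.
  exact: (eval_coprime VM p_pr Vx g_deriv gx).
move=> h; have [|] := val_total VM (Npow N (line 0 - mu) / (ZtoC f^`()).[x]) => //.
by rewrite invf_div (negPf h).
Qed.

(** The exponents of [N] add up to [y k - line k], which is nonnegative because the line of the side
    stays below the hull. *)
Lemma side_weight k : (0 < k <= l)%N -> Npow N (y k) * gm ^+ k.-1 / (ZtoC f^`()).[x] \in V.
Proof.
move=> /andP[k0 kl].
have -> : Npow N (y k) * gm ^+ k.-1 / (ZtoC f^`()).[x] =
   Npow N (y k - line k) * rho ^+ k.-1 * (Npow N (line 0 - mu) / (ZtoC f^`()).[x]).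
  rewrite gmX -NpowMn //.
  have -> : Npow N (y k) = Npow N (y k - line k) * Npow N (line k) by rewrite -NpowD // subrK.
  have -> : Npow N (line 0 - mu) = Npow N (line k) * Npow N (mu * k.-1%:R).
    rewrite -NpowD //; congr (Npow N _); rewrite /line /mu -{1}(prednK k0) -[k.-1.+1%:R]natr1; ring.
  by ring.
apply: rpredM; last exact: deriv_bound.
rewrite rpredM ?rpredX // (Npow_val N VM) // subr_ge0.
exact: (side_hull os).
Qed.

Lemma side_weight_end : gm ^+ l / (ZtoC f^`()).[x] \in V.
Proof.
have -> : gm ^+ l / (ZtoC f^`()).[x] =
   Npow N (y l - line l) * Npow N mu * rho ^+ l * (Npow N (line 0 - mu) / (ZtoC f^`()).[x]).
  rewrite gmX.
  have -> : Npow N mu ^+ l = Npow N (y l - line l) * Npow N mu * Npow N (line 0 - mu).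
    rewrite -NpowMn // -!NpowD // (hull_end g_monic g_size S0 Sl Ul).
    by congr (Npow N _); rewrite /line /mu; ring.
  by move: (Npow N (y l - line l)) (rho ^+ l) (Npow N _) (Npow N _) (_^-1) => a b c d i; ring.
apply: rpredM; last exact: deriv_bound.
rewrite !rpredM ?rpredX // (Npow_val N VM) ?(ltW mu_gt0) // subr_ge0.
exact: (side_hull os).
Qed.
End OnSide.

Lemma root_weight k : (0 < k <= l)%N -> Npow N (y k) * gm ^+ k.-1 / (ZtoC f^`()).[x] \in V.
Proof.
have [j [s [len [jl os Vr Mr]]]] := root_slope; exact: (side_weight jl os Vr Mr).
Qed.

Lemma root_weight_end : gm ^+ l / (ZtoC f^`()).[x] \in V.
Proof.
have [j [s [len [jl os Vr Mr]]]] := root_slope; exact: (side_weight_end jl os Vr Mr).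
Qed.
End Roots.

(** * Euler's trace form *)

Section EulerForm.
Variables (F : {poly algC}) (rs : seq algC).
Hypotheses (F_split : F = \prod_(r <- rs) ('X - r%:P)) (rs_uniq : uniq rs).

Definition euler (h : {poly algC}) : algC := \sum_(r <- rs) h.[r] / F^`().[r].

Lemma eulerD h k : euler (h + k) = euler h + euler k.
Proof. by rewrite /euler -big_split; apply: eq_bigr => r _; rewrite hornerD mulrDl. Qed.

Lemma eulerN h : euler (- h) = - euler h.
Proof. by rewrite /euler -sumrN; apply: eq_bigr => r _; rewrite hornerN mulNr. Qed.

Lemma eulerB h k : euler (h - k) = euler h - euler k.
Proof. by rewrite eulerD eulerN. Qed.

Lemma eulerZ c h : euler (c *: h) = c * euler h.
Proof. by rewrite /euler mulr_sumr; apply: eq_bigr => r _; rewrite hornerZ mulrA. Qed.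

Lemma euler_sum (I : Type) (s : seq I) (P : pred I) (E : I -> {poly algC}) :
  euler (\sum_(i <- s | P i) E i) = \sum_(i <- s | P i) euler (E i).
Proof.
apply: (big_morph euler eulerD); rewrite /euler big1 // => r _.
by rewrite horner0 mul0r.
Qed.

Lemma split_root r : r \in rs -> F.[r] = 0.
Proof. by move=> rrs; apply/rootP; rewrite F_split root_prod_XsubC. Qed.

Lemma eulerM0 h : euler (F * h) = 0.
Proof.
by rewrite /euler big_seq big1 // => r rrs; rewrite hornerM split_root // mul0r mul0r.
Qed.

Lemma split_monic : F \is monic.
Proof. by rewrite F_split monic_prod_XsubC. Qed.

Lemma size_split : size F = (size rs).+1.
Proof. by rewrite F_split size_prod_XsubC. Qed.

Lemma split_cofactor r : r \in rs -> exists L : {poly algC},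
  [/\ F = L * ('X - r%:P), L \is monic, size L = size rs &
      forall r', r' \in rs -> r' != r -> L.[r'] = 0].
Proof.
move=> rrs; have /factor_theorem[L FL] : root F r by apply/rootP/split_root.
have L_mon : L \is monic by have := split_monic; rewrite FL monicMr ?monicXsubC.
exists L; split=> //.
  have := size_split; rewrite FL size_Mmonic ?monicXsubC ?monic_neq0 //.
  by rewrite size_XsubC addn2 /= => -[].
move=> r' r'rs ne; have := split_root r'rs; rewrite FL hornerM hornerXsubC => /eqP.
by rewrite mulf_eq0 subr_eq0 (negPf ne) orbF => /eqP.
Qed.

Lemma deriv_cofactor r (L : {poly algC}) : F = L * ('X - r%:P) -> F^`().[r] = L.[r].
Proof. by move=> ->; rewrite derivM derivXsubC !hornerE subrr mulr0 add0r. Qed.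

Lemma split_deriv_neq0 r : r \in rs -> F^`().[r] != 0.
Proof.
move=> rrs; have [L [FL L_mon sL Lr]] := split_cofactor rrs.
rewrite (deriv_cofactor FL); apply/negP=> /eqP Lr0.
have : (size rs < size L)%N; last by rewrite sL ltnn.
apply: max_poly_roots rs_uniq; first exact: monic_neq0.
by apply/allP=> r' r'rs; apply/rootP; have [->//|/Lr->] := eqVneq r' r.
Qed.

(* Lagrange interpolation at the roots of [F], read off at the top coefficient. *)
Lemma euler_top (h : {poly algC}) : (size h <= size rs)%N -> euler h = h`_(size rs).-1.
Proof.
move=> sh; have [rs0|rs0] := posnP (size rs).
  have -> : h = 0 by apply/eqP; rewrite -size_poly_leq0 -rs0.
  rewrite coef0 /euler big1 // => r _; by rewrite horner0 mul0r.
pose L r := F %/ ('X - r%:P).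
have LP r : r \in rs -> [/\ F = L r * ('X - r%:P), L r \is monic, size (L r) = size rs &
      forall r', r' \in rs -> r' != r -> (L r).[r'] = 0].
  move=> rrs; have [L' [FL L_mon sL Lr]] := split_cofactor rrs.
  by have -> : L r = L' by rewrite /L FL mulpK ?polyXsubC_eq0.
pose H := \sum_(r <- rs) (h.[r] / F^`().[r]) *: L r.
have hH : h - H = 0.
  apply/eqP; apply: contraTT rs_uniq => nz; apply/negP=> u.
  have : (size rs < size (h - H)%R)%N.
    apply: max_poly_roots u => //; apply/allP=> r rrs; apply/rootP.
    rewrite hornerD hornerN /H horner_sum (bigD1_seq r) //= big1_seq ?addr0.
      have [FL _ _ _] := LP r rrs.
      by rewrite hornerZ -(deriv_cofactor FL) divfK ?subrr // split_deriv_neq0.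
    move=> r' /andP[ne r'rs]; have [_ _ _ z] := LP r' r'rs.
    by rewrite hornerZ z ?mulr0 // eq_sym.
  rewrite ltnNge (leq_trans (size_polyD _ _)) // geq_max sh size_polyN.
  rewrite /H big_seq; apply: leq_trans (size_sum _ _ _) _; apply/bigmax_leqP_seq=> r rrs _.
  by rewrite (leq_trans (size_scale_leq _ _)) //; have [_ _ ->] := LP r rrs.
move/eqP: hH; rewrite subr_eq0 => /eqP {2}->; rewrite /H coef_sum /euler.
apply: eq_big_seq => r rrs; have [_ Lm sL _] := LP r rrs.
by rewrite coefZ; move/monicP: Lm; rewrite lead_coefE sL => ->; rewrite mulr1.
Qed.
End EulerForm.

Section EulerIdeal.
Variables (p : nat) (V : subringClosed algC) (M : zmodClosed algC).
Hypothesis VM : valuation_ring p V M.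
Variables (f : {poly int}) (rs : seq algC).
Hypotheses (f_monic : f \is monic) (rs_uniq : uniq rs).
Hypothesis f_split : ZtoC f = \prod_(r <- rs) ('X - r%:P).

(** Each [X^k] can be reduced modulo the monic [f] within [Z[x]], and the form then reads off an
    integer coefficient. *)
Lemma euler_ideal (h : {poly algC}) : h \is a polyOver M -> euler (ZtoC f) rs h \in M.
Proof.
move=> /polyOverP Mh; rewrite -[h]coefK poly_def euler_sum; apply: rpred_sum => k _.
rewrite eulerZ (val_idealr VM) //.
have -> : ('X^k : {poly algC}) = ZtoC ('X^k %/ f) * ZtoC f + ZtoC ('X^k %% f).
  rewrite -rmorphM -rmorphD -(Pdiv.IdomainUnit.divp_eq (monic_unit f_monic)).
  exact/esym/map_polyXn.
rewrite eulerD mulrC eulerM0 // add0r euler_top //.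
  by rewrite coef_map rpred_int.
rewrite size_ZtoC -ltnS -(size_split f_split) size_ZtoC.
by rewrite ltn_modp monic_neq0.
Qed.
End EulerIdeal.

(* The properties of the polygon of [f] at [g] on which the comparison with the
   trace form rests; they also hold when [f = g], where there is no polygon. *)
Record polygon_data (V : subringClosed algC) (M : zmodClosed algC) (N : nat)
    (f g : {poly int}) (l : nat) : Prop := PolygonData {
  pd_ge0 : forall j, (0 < j <= l)%N -> 0 <= hull N f g j;
  pd_decr : forall j k, (0 < j < k)%N -> (k <= l)%N -> hull N f g k < hull N f g j;
  pd_below : forall s j, (s < j)%N -> (0 < j <= l)%N -> dig f g s != 0 ->
    hull N f g j < (vNexp N (dig f g s))%:R;
  pd_weight : forall x j, root (ZtoC f) x -> (ZtoC g).[x] \in M -> (0 < j <= l)%N ->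
    Npow N (hull N f g j) * (ZtoC g).[x] ^+ j.-1 / (ZtoC f^`()).[x] \in V;
  pd_weight_end : forall x, root (ZtoC f) x -> (ZtoC g).[x] \in M ->
    (ZtoC g).[x] ^+ l / (ZtoC f^`()).[x] \in V
}.

(** * Independence of the scaled quotients modulo [M] *)

Section Core.
Variables (p : nat) (V : subringClosed algC) (M : zmodClosed algC).
Hypotheses (VM : valuation_ring p V M) (p_pr : prime p).
Variables (N : nat) (f : {poly int}) (rs : seq algC) (m : nat).
Variables (g : 'I_m -> {poly int}) (l : 'I_m -> nat).
Hypotheses (N1 : (1 < N)%N) (pN : (p %| N)%N).
Hypotheses (f_monic : f \is monic) (rs_uniq : uniq rs).
Hypothesis f_split : ZtoC f = \prod_(r <- rs) ('X - r%:P).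
Hypotheses (g_monic : forall i, g i \is monic) (g_size : forall i, (1 < size (g i))%N).
Hypothesis l_gt0 : forall i, (0 < l i)%N.
Hypothesis f_red : redp p f = redp p (\prod_(i < m) g i ^+ l i).
Hypothesis g_coprime : forall i j, i != j -> coprimep (redp p (g i)) (redp p (g j)).
Hypothesis fg_def : forall i s, vN_defined N (dig f (g i) s).
Hypothesis data : forall i, polygon_data V M N f (g i) (l i).

Let N0 : (0 < N)%N. Proof. exact: ltnW. Qed.
Local Notation y i j := (hull N f (g i) j).
Local Notation Q i j := (ZtoC (f %/ g i ^+ j)).
Local Notation eu := (euler (ZtoC f) rs).

Let eu_ideal := euler_ideal VM f_monic rs_uniq f_split.

Lemma polyOverMr (a b : {poly algC}) : a \is a polyOver M -> b \is a polyOver V -> a * b \is a polyOver M.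
Proof. by move=> Ma Vb; rewrite mulrC (polyOver_idealM VM). Qed.

Lemma scale_ideal c (a : {poly algC}) : c \in M -> a \is a polyOver V -> c *: a \is a polyOver M.
Proof.
by move=> Mc /polyOverP Va; apply/polyOverP=> i; rewrite coefZ (val_idealr VM).
Qed.

Lemma ZtoC_redp a b : redp p a = redp p b -> ZtoC a - ZtoC b \is a polyOver M.
Proof.
move=> e; have [|w ew] := @redp_eq0 p p_pr (a - b); first by rewrite rmorphB /= e subrr.
rewrite -rmorphB /= ew ZtoCZ scale_ideal ?ZtoC_over // -pmulrn; exact: (val_prime VM).
Qed.

Let G i : {poly int} := \prod_(k < m | k != i) g k ^+ l k.

Lemma prod_G i : \prod_(k < m) g k ^+ l k = g i ^+ l i * G i.
Proof. by rewrite (bigD1 i). Qed.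

Lemma G_monic i : G i \is monic.
Proof. by apply: monic_prod => k _; apply: monic_exp. Qed.

Lemma f_red_G i : redp p f = redp p (g i ^+ l i * G i).
Proof. by rewrite f_red (prod_G i). Qed.

(** The remainder collects the digits below [j], whose exponents exceed [y i j] because the polygon
    strictly decreases. *)
Lemma quot_rem i j : (0 < j <= l i)%N -> exists2 r : {poly algC},
  Q i j * ZtoC (g i) ^+ j = ZtoC f - r & Npow N (- y i j) *: r \is a polyOver M.
Proof.
move=> jl; exists (ZtoC (\sum_(s < j) dig f (g i) s * g i ^+ s)).
  rewrite -rmorphXn -rmorphM -rmorphB /=; congr ZtoC; apply: (canRL (addrK _)).
  exact/esym/divp_exp_rem.
rewrite rmorph_sum scaler_sumr; apply: rpred_sum => s _ /=; rewrite rmorphM /= scalerAl.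
apply: polyOverMr; last exact: ZtoC_over.
have [->|Ss] := eqVneq (dig f (g i) s) 0; first by rewrite rmorph0 scaler0 rpred0.
have [e _] := vN_unitpart N1 (fg_def i s) Ss.
rewrite [in ZtoC _]e ZtoCZ scalerA rmorphXn /= -pmulrn -Npow_nat // -NpowD //.
rewrite scale_ideal ?ZtoC_over // (Npow_ideal VM pN) // addrC subr_gt0.
by apply: (pd_below (data i)).
Qed.

(** The form annihilates multiples of [f], so a factor [g_i^j] beside [q_ij] brings the value into
    [M] despite the denominator. *)
Lemma euler_quot i j K : (0 < j <= l i)%N -> K \is a polyOver V ->
  eu (Npow N (- y i j) *: (Q i j * (ZtoC (g i) ^+ j * K))) \in M.
Proof.
move=> jl VK; have [r e Mr] := quot_rem jl.
rewrite mulrA e mulrBl scalerBr eulerB eulerZ eulerM0 // mulr0 sub0r rpredN.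
by apply: eu_ideal; rewrite scalerAl polyOverMr.
Qed.

Lemma redp_quot i j : (0 < j <= l i)%N ->
  redp p (f %/ g i ^+ j) = redp p (g i ^+ (l i - j) * G i).
Proof.
move=> jl; have nz : redp p (g i) ^+ j != 0 by rewrite monic_neq0 // monic_exp // monic_map.
apply: (mulIf nz); rewrite -rmorphXn -!rmorphM /= mulrAC -exprD subnK; last by case/andP: jl.
rewrite -f_red_G [in RHS](divp_exp_rem f (g_monic i) j) rmorphD /= -[LHS]addr0; congr (_ + _).
rewrite rmorph_sum big1 // => s _; rewrite rmorphM /=.
have [->|Ss] := eqVneq (dig f (g i) s) 0; first by rewrite rmorph0 mul0r.
have [e _] := vN_unitpart N1 (fg_def i s) Ss.
have := pd_below (data i) (ltn_ord s) jl Ss; case: (vNexp _ _) e => [|u] e h.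
  by have := pd_ge0 (data i) jl; rewrite leNgt h.
have -> : redp p (dig f (g i) s) = 0; last by rewrite mul0r.
by rewrite e exprS -scalerA redp_dvd.
Qed.

Lemma root_V r : r \in rs -> r \in V.
Proof.
move=> rrs; apply: (val_Aint VM); apply: (root_monic_Aint _ (monic_ZtoC f_monic)).
  by rewrite f_split root_prod_XsubC.
exact: ZtoC_int.
Qed.

Lemma root_over r : r \in rs -> exists i, (ZtoC (g i)).[r] \in M.
Proof.
move=> rrs; have Vr := root_V rrs.
have : (ZtoC (\prod_(i < m) g i ^+ l i)).[r] \in M.
  rewrite -[_.[r]]opprK rpredN -[- _]add0r -(split_root f_split rrs) -hornerN -hornerD.
  by apply: (horner_ideal VM) => //; apply: ZtoC_redp.
rewrite rmorph_prod horner_prod.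
suff [_ h] : \prod_(i < m) (ZtoC (g i ^+ l i)).[r] \in V /\
    (\prod_(i < m) (ZtoC (g i ^+ l i)).[r] \in M -> exists i, (ZtoC (g i)).[r] \in M) by [].
elim/big_ind: _.
- by rewrite rpred1 (negPf (val_proper VM)).
- move=> a b [Va ha] [Vb hb]; split; first exact: rpredM.
  by move=> /(valM VM)/(_ Va Vb)/orP[/ha|/hb].
- move=> i _; split; first exact: eval_val.
  by rewrite rmorphXn horner_exp => /(valX VM); exists i.
Qed.

Variables (C : 'I_m -> nat -> {poly algC}).
Hypotheses (C_over : forall i j, C i j \is a polyOver V)
  (C_size : forall i j, (size (C i j) <= (size (g i)).-1)%N).

Let Z := \sum_(i < m) \sum_(1 <= j < (l i).+1) Npow N (- y i j) *: (C i j * Q i j).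
Hypothesis Z_root : forall r, r \in rs -> Z.[r] \in M.

Section Component.
Variables (i0 : 'I_m) (j0 : nat).
Hypothesis j0l : (0 < j0 <= l i0)%N.
Let gam := ZtoC (g i0).
Let Gam := ZtoC (G i0).

(** A test polynomial for the pair [(i0, j0)]. At a root over [g i0] the first two factors
    compensate [f']; at a root over another [g i] the factor [g_i^l_i] of [Gam] does. [B] remains
    free, to be specialised later. *)
Let w B := Npow N (y i0 j0) *: (gam ^+ j0.-1 * (Gam * B)).

Lemma weight_V B r : B \is a polyOver V -> r \in rs -> (w B).[r] / (ZtoC f^`()).[r] \in V.
Proof.
move=> VB rrs; have Vr := root_V rrs; have [i Mi] := root_over rrs.
have fr : root (ZtoC f) r by rewrite f_split root_prod_XsubC.
have VBr : B.[r] \in V by apply: rpred_horner.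
rewrite /w hornerZ !hornerM horner_exp; have [ei|ne] := eqVneq i i0.
  rewrite ei in Mi; have h := pd_weight (data i0) fr Mi j0l.
  have -> : Npow N (y i0 j0) * (gam.[r] ^+ j0.-1 * (Gam.[r] * B.[r])) / (ZtoC f^`()).[r] =
     Npow N (y i0 j0) * gam.[r] ^+ j0.-1 / (ZtoC f^`()).[r] * (Gam.[r] * B.[r]).
    by move: (_^-1) => D; ring.
  by rewrite rpredM // rpredM ?eval_val.
rewrite /Gam /G (bigD1 i) //= rmorphM rmorphXn /= hornerM horner_exp.
set a := (ZtoC (\prod_(k < m | _) _)).[r]; set c := gam.[r] ^+ _; set d := _ ^+ l i.
have -> : Npow N (y i0 j0) * (c * (d * a * B.[r])) / (ZtoC f^`()).[r] =
   Npow N (y i0 j0) * c * a * B.[r] * (d / (ZtoC f^`()).[r]) by move: (_^-1) => D; ring.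
rewrite rpredM ?(pd_weight_end (data i)) // !rpredM ?rpredX ?eval_val //.
by rewrite (Npow_val N VM) // (pd_ge0 (data i0)).
Qed.

Lemma euler_Zw B : B \is a polyOver V -> eu (Z * w B) \in M.
Proof.
move=> VB; rewrite /euler big_seq; apply: rpred_sum => r rrs.
by rewrite hornerM -mulrA (val_idealr VM) ?Z_root // deriv_map weight_V.
Qed.

(** For [i] other than [i0], [Gam] supplies the factor [g_i^j] required by [euler_quot]; for
    [i = i0] and [j < j0] the power [gam^(j0 - 1)] does. For [j > j0] the polygon decreases, and a
    positive power of [N] is left. *)
Lemma euler_other i j B : B \is a polyOver V -> (0 < j <= l i)%N -> (i, j) != (i0, j0) ->
  eu (Npow N (- y i j) *: (C i j * Q i j) * w B) \in M.
Proof.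
move=> VB jl ne; have Vy := Npow_val N VM (pd_ge0 (data i0) j0l).
have [ei|nei] := eqVneq i i0; last first.
  rewrite /w /Gam /G (bigD1 i) //= rmorphM rmorphXn /=.
  set a := ZtoC (\prod_(k < m | _) _); set c := gam ^+ _.
  have -> : ZtoC (g i) ^+ l i = ZtoC (g i) ^+ j * ZtoC (g i) ^+ (l i - j).
    by rewrite -exprD subnKC //; case/andP: jl.
  set b := _ ^+ (l i - j).
  rewrite -!scalerAl -!scalerAr.
  have -> : C i j * Q i j * (c * (ZtoC (g i) ^+ j * b * a * B)) =
     Q i j * (ZtoC (g i) ^+ j * (C i j * c * b * a * B)) by ring.
  rewrite scalerA mulrC -scalerA eulerZ (val_ideal VM) //; apply: euler_quot => //.
  by rewrite !rpredM ?rpredX ?ZtoC_over.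
rewrite {}ei in jl ne *; have {}ne : j != j0 by apply: contra ne => /eqP->.
rewrite /w -!scalerAl -!scalerAr; move: ne; rewrite neq_ltn => /orP[jj|jj].
  have -> : gam ^+ j0.-1 = gam ^+ j * gam ^+ (j0.-1 - j).
    by rewrite -exprD subnKC // -ltnS prednK //; case/andP: j0l.
  set b := _ ^+ (j0.-1 - j).
  have -> : C i0 j * Q i0 j * (gam ^+ j * b * (Gam * B)) =
     Q i0 j * (gam ^+ j * (C i0 j * b * Gam * B)) by ring.
  rewrite scalerA mulrC -scalerA eulerZ (val_ideal VM) //; apply: euler_quot => //.
  by rewrite !rpredM ?rpredX ?ZtoC_over.
rewrite scalerA -NpowD //; apply: eu_ideal; apply: scale_ideal.
  rewrite (Npow_ideal VM pN) // addrC subr_gt0 (pd_decr (data i0)) //.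
    by rewrite jj andbT; case/andP: j0l.
  by case/andP: jl.
by rewrite !rpredM ?C_over ?VB ?rpredX //; apply: ZtoC_over.
Qed.

Lemma euler_main B : B \is a polyOver V -> eu (C i0 j0 * Q i0 j0 * (gam ^+ j0.-1 * (Gam * B))) \in M.
Proof.
move=> VB; have := euler_Zw VB.
rewrite /Z (bigD1 i0) //= (bigD1_seq j0) ?mem_index_iota ?iota_uniq //=.
rewrite !mulrDl !eulerD => h.
have -> : C i0 j0 * Q i0 j0 * (gam ^+ j0.-1 * (Gam * B)) =
   Npow N (- y i0 j0) *: (C i0 j0 * Q i0 j0) * w B.
  by rewrite /w -!scalerAl -!scalerAr scalerA -NpowD // addNr Npow0 scale1r.
have h1 : eu ((\sum_(1 <= j < (l i0).+1 | j != j0) Npow N (- y i0 j) *: (C i0 j * Q i0 j)) * w B) \in M.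
  rewrite mulr_suml euler_sum big_nat_cond; apply: rpred_sum => j /andP[/andP[j1 jl] ne].
  by apply: euler_other; rewrite ?j1 // xpair_eqE eqxx.
have h2 : eu ((\sum_(i < m | i != i0) \sum_(1 <= j < (l i).+1) Npow N (- y i j) *: (C i j * Q i j)) * w B) \in M.
  rewrite mulr_suml euler_sum; apply: rpred_sum => i ne.
  rewrite mulr_suml euler_sum big_nat_cond; apply: rpred_sum => j /andP[/andP[j1 jl] _].
  by apply: euler_other; rewrite ?j1 // xpair_eqE (negPf ne).
set a := eu (_ *: _ * w B) in h *.
by have := rpredB (rpredB h h2) h1; rewrite addrK addrK.
Qed.

Let K := gam ^+ (l i0).-1 * Gam.

Lemma gamK : gam * K = ZtoC (g i0 ^+ l i0 * G i0).
Proof. by rewrite /K mulrA -exprS prednK ?l_gt0 // rmorphM rmorphXn. Qed.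

(** Modulo [p] the quotient is [g_i^(l_i - j) G_i], so [j0] disappears from the second factor, at
    the price of a surplus [Gam]. *)
Lemma euler_square B : B \is a polyOver V -> eu (C i0 j0 * (K * Gam * B)) \in M.
Proof.
move=> VB; have := euler_main VB.
have e : Q i0 j0 - ZtoC (g i0 ^+ (l i0 - j0) * G i0) \is a polyOver M.
  by apply: ZtoC_redp; apply: redp_quot.
have h : eu (C i0 j0 * (Q i0 j0 - ZtoC (g i0 ^+ (l i0 - j0) * G i0)) *
    (gam ^+ j0.-1 * (Gam * B))) \in M.
  apply: eu_ideal; apply: polyOverMr; first exact: (polyOver_idealM VM).
  by rewrite !rpredM ?rpredX ?ZtoC_over.
move=> h'; have := rpredB h' h; rewrite -eulerB mulrBr mulrBl subKr.
congr (eu _ \in M); rewrite rmorphM rmorphXn /= -/gam -/Gam /K.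
have -> : (l i0).-1 = (l i0 - j0 + j0.-1)%N by case/andP: j0l => a b; move: a b; clear; lia.
by rewrite exprD; ring.
Qed.

Lemma redp_G_coprime : coprimep (redp p (G i0)) (redp p (g i0)).
Proof.
rewrite rmorph_prod /=; elim/big_ind: _ => [|a b ha hb|k ne]; first exact: coprime1p.
  by rewrite coprimepMl ha.
by rewrite rmorphXn coprimep_expl // g_coprime.
Qed.

(** The surplus [Gam] is removed by a relation [u G_i + v g_i = 1 + p t], since [gam * K] is [f]
    modulo [p] and the form annihilates [f]. *)
Lemma euler_simple B : B \is a polyOver V -> eu (C i0 j0 * (K * B)) \in M.
Proof.
move=> VB; have [u [v [t e]]] := coprime_redp_lift p_pr redp_G_coprime.
have h : eu (C i0 j0 * (K * Gam * (ZtoC u * B))) \in M.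
  by apply: euler_square; rewrite rpredM ?ZtoC_over.
have h2 : eu (C i0 j0 * (ZtoC v * B) * (gam * K)) \in M.
  rewrite gamK -[ZtoC (_ * G i0)](subKr (ZtoC f)) mulrBr mulrC eulerB eulerM0 // sub0r rpredN.
  apply: eu_ideal; rewrite (polyOver_idealM VM) ?rpredM ?ZtoC_over //.
  by apply: ZtoC_redp; apply: f_red_G.
have h3 : eu (C i0 j0 * (K * B) * ZtoC (p%:Z *: t)) \in M.
  apply: eu_ideal; rewrite (polyOver_idealM VM) ?rpredM ?rpredX ?ZtoC_over //.
  by rewrite ZtoCZ scale_ideal ?ZtoC_over // -pmulrn (val_prime VM).
have := rpredB (rpredD h h2) h3; rewrite -eulerD -eulerB; congr (eu _ \in M).
have e' : ZtoC u * Gam + ZtoC v * gam = 1 + ZtoC (p%:Z *: t).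
  by rewrite /Gam /gam -!rmorphM -rmorphD e rmorphD rmorph1.
have -> : ZtoC (p%:Z *: t) = ZtoC u * Gam + ZtoC v * gam - 1 by rewrite e' addrAC subrr add0r.
by ring.
Qed.

Lemma K_monic : K \is monic.
Proof. by rewrite /K monicMl ?monic_exp ?monic_ZtoC ?G_monic. Qed.

Lemma size_f : size rs = ((size (g i0)).-1 + (size K).-1)%N.
Proof.
have sm (a : {poly int}) : a \is monic -> size (redp p a) = size a.
  by move=> a_mon; rewrite /redp size_map_poly_id0 // (monicP a_mon) oner_neq0.
have : size (ZtoC f) = size (gam * K).
  rewrite gamK !size_ZtoC -sm // (f_red_G i0) sm //.
  by rewrite monicMl ?monic_exp ?G_monic.
rewrite (size_split f_split) size_Mmonic ?K_monic ?monic_neq0 ?monic_ZtoC // size_ZtoC.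
have := g_size i0; have : (0 < size K)%N by rewrite size_poly_gt0 monic_neq0 ?K_monic.
by move: (size K) (size (g i0)) => [|a] [|b] // _ _; rewrite addSn addnS /= => -[].
Qed.

(** Let [d] be the last index whose coefficient is not in [M]. Up to [M] the polynomial may be
    truncated after [d]; multiplied by [K] and a suitable [X^k] it has degree [n - 1], and as [K] is
    monic the form returns exactly the coefficient at [d]. *)
Lemma component_ideal : C i0 j0 \is a polyOver M.
Proof.
apply: contraT => /polyOverP notM.
have [k0 hk0] : exists k, (C i0 j0)`_k \notin M.
  by apply: contrapT => h; apply: notM => k; apply: contraT => hk; case: h; exists k.
have bound k : (C i0 j0)`_k \notin M -> (k <= (size (g i0)).-2)%N.
  move=> hk; rewrite leqNgt; apply: contra hk => gk; rewrite nth_default ?rpred0 //.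
  by apply: leq_trans (C_size _ _) _; move: gk; case: (size (g i0)) => [|[]].
have exk : exists k, (C i0 j0)`_k \notin M by exists k0.
case: (ex_maxnP exk bound) => d Md dmax {k0 hk0}.
(* That is [deg g - 1 - d], which raises the degree to [n - 1] because [deg K = n - deg g]. *)
pose k := ((size (g i0)).-2 - d)%N.
pose lo := take_poly d.+1 (C i0 j0).
have hi : C i0 j0 - lo \is a polyOver M.
  apply/polyOverP=> i; rewrite coefB coef_take_poly; case: ltnP => [_|di].
    by rewrite subrr rpred0.
  rewrite subr0; apply: contraT => /dmax; by rewrite leqNgt di.
have h := euler_simple (rpredX k (polyOverX V)).
have VK : K * 'X^k \is a polyOver V.
  by rewrite /K !rpredM ?rpredX ?polyOverX //; apply: ZtoC_over.
have h2 : eu ((C i0 j0 - lo) * (K * 'X^k)) \in M by apply: eu_ideal; rewrite polyOverMr.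
have : eu (lo * (K * 'X^k)) \in M.
  by have := rpredB h h2; rewrite -eulerB mulrBl subKr.
have lod : lo`_d = (C i0 j0)`_d by rewrite coef_take_poly ltnSn.
have Cd0 : (C i0 j0)`_d != 0 by apply: contra Md => /eqP->; rewrite rpred0.
have slo : size lo = d.+1.
  apply/eqP; rewrite eqn_leq size_take_poly ltnNge; apply/negP=> /(nth_default 0).
  by rewrite lod => /eqP; rewrite (negPf Cd0).
have Xmon : K * 'X^k \is monic by rewrite monicMl ?K_monic ?monicXn.
have sX : size (K * 'X^k) = ((size K).-1 + k).+1.
  have K0 : (0 < size K)%N by rewrite size_poly_gt0 monic_neq0 ?K_monic.
  by rewrite size_Mmonic ?monicXn ?monic_neq0 ?K_monic // size_polyXn addnS /= -{1}(prednK K0).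
have sz : size (lo * (K * 'X^k)) = size rs.
  have lo0 : lo != 0 by rewrite -size_poly_gt0 slo.
  rewrite size_Mmonic // slo sX size_f addSn addnS /=.
  have := bound d Md; have := g_size i0; rewrite /k; move: (size (g i0)) (size K) => [|[|a]] b // _ /=.
  by clear; lia.
rewrite euler_top ?sz // -sz -lead_coefE lead_coef_Mmonic // lead_coefE slo /= lod.
by rewrite (negPf Md).
Qed.
End Component.

Theorem coefficients_ideal i j : (0 < j <= l i)%N -> C i j \is a polyOver M.
Proof. exact: component_ideal. Qed.
End Core.

(** * Polygon data under the hypotheses on [f] and the [g_i] *)

Section Instance.
Variables (N : nat) (f : {poly int}) (m : nat) (g : 'I_m -> {poly int}) (l : 'I_m -> nat).
Hypotheses (f_monic : f \is monic) (N1 : (1 < N)%N).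
Hypothesis f_irr : irreducible_poly (map_poly (intr : int -> rat) f).
Hypothesis f_size : (1 < (size f).-1)%N.
Hypotheses (g_monic : forall i, g i \is monic) (g_size : forall i, (1 < size (g i))%N).
Hypothesis l_gt0 : forall i, (0 < l i)%N.
Hypothesis f_mod : forall k, (N%:Z %| (f - \prod_(i < m) g i ^+ l i)`_k)%Z.
Hypothesis p_big : forall p, prime p -> (p %| N)%N -> ((size f).-1 < p)%N.
Hypothesis g_red : forall p, prime p -> (p %| N)%N ->
  (forall i, sqfree (redp p (g i))) /\
  (forall i j, i != j -> coprimep (redp p (g i)) (redp p (g j))).
Hypothesis f_reg : N_regular N f g.

Let fg_def i s : vN_defined N (dig f (g i) s). Proof. by case: f_reg. Qed.

Lemma f_mod_lift : exists w, f = \prod_(i < m) g i ^+ l i + N%:Z *: w.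
Proof.
exists (map_poly (fun c : int => (c %/ N%:Z)%Z) (f - \prod_(i < m) g i ^+ l i)).
apply/polyP=> k; rewrite coefD coefZ coef_map_id0 ?div0z // mulrC divzK //.
by rewrite coefB subrKC.
Qed.

Lemma f_redp p : prime p -> (p %| N)%N -> redp p f = redp p (\prod_(i < m) g i ^+ l i).
Proof. by move=> pp pN; have [w ->] := f_mod_lift; rewrite rmorphD /= redp_dvd // addr0. Qed.

Lemma dig_lt i s : (s < l i)%N -> exists w, dig f (g i) s = N%:Z *: w.
Proof.
move=> sl; have [w ->] := f_mod_lift; exists (dig w (g i) s).
rewrite digD // digZ // (bigD1 i) //= dig_expM ?sl ?add0r //; exact: ltnW.
Qed.

Lemma coprime_cofactor p i : prime p -> (p %| N)%N ->
  coprimep (redp p (\prod_(k < m | k != i) g k ^+ l k)) (redp p (g i)).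
Proof.
move=> pp pN; rewrite rmorph_prod /=; elim/big_ind: _ => [|a b ha hb|k ne].
- exact: coprime1p.
- by rewrite coprimepMl ha.
- by rewrite rmorphXn coprimep_expl //; have [_] := g_red pp pN; apply.
Qed.

Lemma size_redp_monic p a : a \is monic -> size (redp p a) = size a.
Proof. by move=> a_mon; rewrite /redp size_map_poly_id0 // (monicP a_mon) oner_neq0. Qed.

(** Modulo [p] this digit is the product of the other factors reduced modulo [g i]; if it vanished,
    [g i] would divide a polynomial coprime to it. *)
Lemma dig_end_redp p i : prime p -> (p %| N)%N -> redp p (dig f (g i) (l i)) != 0.
Proof.
move=> pp pN; have [w ->] := f_mod_lift.
rewrite digD // digZ // (bigD1 i) //= dig_expM // ltnn rmorphD /= redp_dvd // addr0.
set G := \prod_(k < m | _) _; apply/eqP=> e.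
have : redp p (g i) %| redp p G.
  rewrite [G](Pdiv.IdomainUnit.divp_eq (monic_unit (g_monic i))) rmorphD rmorphM /= e addr0.
  exact: dvdp_mull.
move=> d; have := coprime_cofactor i pp pN; rewrite coprimep_sym -/G /coprimep.
by rewrite (eqp_size (dvdp_gcd_idl d)) size_redp_monic // gtn_eqF.
Qed.

Let p0_prime : prime (pdiv N). Proof. exact: pdiv_prime. Qed.

Lemma dig_end_neq0 i : dig f (g i) (l i) != 0.
Proof.
by have := dig_end_redp i p0_prime (pdiv_dvd N); apply: contra => /eqP->; rewrite rmorph0.
Qed.

Lemma vNexp_end i : vNexp N (dig f (g i) (l i)) = 0%N.
Proof. exact: (vNexp_eq0 p0_prime N1 (pdiv_dvd N) (fg_def _ _) (dig_end_redp i p0_prime (pdiv_dvd N))). Qed.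

Lemma vNexp_lt i s : (s < l i)%N -> dig f (g i) s != 0 -> (0 < vNexp N (dig f (g i) s))%N.
Proof. by move=> sl Ss; have [w e] := dig_lt sl; apply: vNexp_gt0 e. Qed.

Lemma end_lt_size i : (l i < size f)%N.
Proof. by rewrite ltnNge; apply: contra (dig_end_neq0 i) => h; rewrite dig_eq0. Qed.

Lemma size_g_le i : (size (g i) <= size f)%N.
Proof.
rewrite leqNgt; apply: contra (dig_end_neq0 i) => h; rewrite /dig divp_small ?mod0p //.
apply: (leq_trans h); apply: dvdp_leq; first by rewrite monic_neq0 ?monic_exp.
by rewrite -(prednK (l_gt0 i)) exprS dvdp_mulr.
Qed.

Lemma deriv_coprime p i : prime p -> (p %| N)%N ->
  coprimep (redp p (g i)^`()) (redp p (g i)).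
Proof.
move=> pp pN; have [sq _] := g_red pp pN.
have : separable_poly (redp p (g i)).
  apply: (sqfree_separable (pchar_Fp pp)) (sq i).
  rewrite size_redp_monic //; apply: leq_trans (size_g_le i) _.
  by have := p_big pp pN; case: (size f).
by rewrite unlock /redp deriv_map coprimep_sym.
Qed.

Section Degenerate.
Variable i : 'I_m.
Hypothesis dig0 : dig f (g i) 0 = 0.

(** A zero digit at 0 means that [g i] divides the irreducible [f]. The only point is then [(1, 0)],
    so the treatment of polygons starting at abscissa 0 does not apply. *)
Lemma degenerate_eq : f = g i.
Proof.
have [q fE] : exists q, f = q * g i.
  exists (f %/ g i); rewrite {1}(Pdiv.IdomainUnit.divp_eq (monic_unit (g_monic i)) f).
  by move: dig0; rewrite /dig expr0 divp1 => ->; rewrite addr0.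
have dv : map_poly intr (g i) %| map_poly (intr : int -> rat) f.
  by rewrite fE rmorphM dvdp_mull.
have [_ irr] := f_irr; have := irr _ _ dv.
rewrite (size_map_inj_poly (@intr_inj rat)) // gtn_eqF // => /(_ isT).
rewrite eqp_monic ?monic_map // => /eqP e; apply/polyP=> k; apply: (@intr_inj rat).
by have /polyP/(_ k) := e; rewrite !coef_map.
Qed.

Lemma degenerate_length : l i = 1%N.
Proof.
have := f_redp p0_prime (pdiv_dvd N); rewrite (bigD1 i) //=.
set G := \prod_(k < m | _) _ => /(congr1 (fun a : {poly _} => size a)).
have Gm : G \is monic by apply: monic_prod => k _; apply: monic_exp.
rewrite !size_redp_monic ?monicMl ?monic_exp //.
rewrite size_Mmonic ?monic_neq0 ?monic_exp // size_monic_exp // {1}degenerate_eq.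
have : (0 < size G)%N by rewrite size_poly_gt0 monic_neq0.
have := g_size i; have := l_gt0 i.
by case: (l i) (size G) (size (g i)) => [|[|a]] // [|b] // [|[|c]] //=; clear; lia.
Qed.

Lemma degenerate_support s : dig f (g i) s != 0 -> s = 1%N.
Proof.
case: s => [|[//|s]]; first by rewrite dig0 eqxx.
rewrite -degenerate_eq /dig divp_small ?mod0p ?eqxx //.
rewrite size_monic_exp // ltnS mulnC.
by move: f_size; case: (size f) => [|[|a]] //=; clear; lia.
Qed.

Lemma degenerate_hull : hull N f (g i) 1 = 0.
Proof.
have S1 : dig f (g i) 1 != 0 by have := dig_end_neq0 i; rewrite degenerate_length.
have U1 : vNexp N (dig f (g i) 1) = 0%N by have := vNexp_end i; rewrite degenerate_length.
apply/le_anti; rewrite (hull_ge0 (g_monic i) (g_size i)) ?andbT.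
  by have := hull_le_U N (g_monic i) (g_size i) S1; rewrite U1.
by apply/hdefP => //; exists 1%N, 1%N.
Qed.

Lemma degenerate_no_side s len sigma : ~ is_side N f (g i) s len sigma.
Proof.
case=> len0 _ h _ _; have := h s; rewrite leqnn -[X in (X < _)%N]addn0 ltn_add2l len0.
move=> /(_ isT)/and3P[/(hdefP N f (g_monic i) (g_size i))[a [_ [Sa _ /andP[sa _]]]]].
move=> /(hdefP N f (g_monic i) (g_size i))[_ [b [_ Sb /andP[_ sb]]]] _.
have ea := degenerate_support Sa; have eb := degenerate_support Sb.
by move: sa sb; rewrite ea eb; case: s {h} => [|[|s]].
Qed.
End Degenerate.

Section Data.
Variables (p : nat) (V : subringClosed algC) (M : zmodClosed algC).
Hypotheses (VM : valuation_ring p V M) (p_pr : prime p) (pN : (p %| N)%N).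

Lemma polygon_data_of i : polygon_data V M N f (g i) (l i).
Proof.
have [_ reg2 reg3] := f_reg.
have gm := g_monic i; have gs := g_size i; have l0 := l_gt0 i.
have Sl := dig_end_neq0 i; have Ul := vNexp_end i.
have Up s : (s < l i)%N -> dig f (g i) s != 0 -> (0 < vNexp N (dig f (g i) s))%N.
  exact: vNexp_lt.
have [S0|S0] := eqVneq (dig f (g i) 0) 0.
  have l1 := degenerate_length S0; have fE := degenerate_eq S0.
  split; rewrite l1.
  - by move=> [|[|j]] // _; rewrite degenerate_hull.
  - by move=> j [|[|k]] //; case: j.
  - by move=> [|s] [|[|j]] //; rewrite S0 eqxx.
  (* Here [f' = g'], and its value at [x] is a unit because [g] is separable modulo [p]. *)
  - move=> x [|[|j]] // fx gx _; rewrite degenerate_hull // Npow0 expr0 !mul1r.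
    have Vx : x \in V by apply: (val_Aint VM); apply: root_monic_int fx.
    rewrite (val_unit VM) ?eval_val // {1}fE.
    by apply: (eval_coprime VM p_pr Vx _ gx); apply: deriv_coprime.
  - by move=> x /rootP fx _; rewrite expr1 -{1}fE fx mul0r rpred0.
split.
- by move=> j /andP[_ jl]; rewrite (hull_ge0 gm gs) // (hdef_le N gm gs S0 Sl).
- by move=> j k /andP[_ jk] kl; apply: (hull_decr gm gs l0 S0 Sl Ul Up jk kl).
- move=> s j sj /andP[_ jl] Ss; apply: lt_le_trans (hull_le_U N gm gs Ss).
  exact: (hull_decr gm gs l0 S0 Sl Ul Up sj jl).
- move=> x j fx gx jl.
  apply: (root_weight VM p_pr N1 pN (p_big p_pr pN)) jl => //.
  + exact: end_lt_size.
  + by move=> s len sigma side r rE; apply: (reg2 i s len sigma side).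
  + exact: reg3.
  + exact: deriv_coprime.
- move=> x fx gx.
  apply: (root_weight_end VM p_pr N1 pN (p_big p_pr pN)) => //.
  + exact: end_lt_size.
  + by move=> s len sigma side r rE; apply: (reg2 i s len sigma side).
  + exact: reg3.
  + exact: deriv_coprime.
Qed.
End Data.
End Instance.

(** * The family as an indexed sum *)

Definition index_triples (m : nat) (l d : 'I_m -> nat) : seq ('I_m * nat * nat) :=
  flatten [seq flatten [seq [seq (i, j, k) | k <- iota 0 (d i)] | j <- iota 1 (l i)]
          | i <- enum 'I_m].

Lemma mem_index_triples m (l d : 'I_m -> nat) i j k :
  ((i, j, k) \in index_triples l d) = (0 < j <= l i)%N && (k < d i)%N.
Proof.
apply/flatten_mapP/andP=> [[i' _ /flatten_mapP[j' hj /mapP[k' hk [-> -> ->]]]]|[hj hk]].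
  by move: hj hk; rewrite !mem_iota add1n ltnS add0n => -> /andP[_ ->].
exists i; first by rewrite mem_enum.
apply/flatten_mapP; exists j; first by rewrite mem_iota add1n ltnS.
by apply/mapP; exists k => //; rewrite mem_iota.
Qed.

Lemma uniq_flatten_map (T S : eqType) (s : seq T) (F : T -> seq S) (tag : S -> T) :
  uniq s -> (forall x, x \in s -> uniq (F x)) ->
  (forall x y, x \in s -> y \in F x -> tag y = x) -> uniq (flatten [seq F x | x <- s]).
Proof.
elim: s => [//|x s IH] /= /andP[xs us] uF tagF; rewrite cat_uniq uF ?mem_head //=.
rewrite IH ?andbT //; first last.
- by move=> y z ys; apply: tagF; rewrite inE ys orbT.
- by move=> y ys; apply: uF; rewrite inE ys orbT.
apply/hasPn=> y /flatten_mapP[z zs yz]; apply/negP=> yx.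
have e1 : tag y = x by apply: tagF => //; apply: mem_head.
have e2 : tag y = z by apply: tagF yz; rewrite inE zs orbT.
by move: xs; rewrite -e1 e2 zs.
Qed.

Lemma uniq_index_triples m (l d : 'I_m -> nat) : uniq (index_triples l d).
Proof.
apply: (@uniq_flatten_map _ _ _ _ (fun t => t.1.1)); first exact: enum_uniq.
  move=> i _; apply: (@uniq_flatten_map _ _ _ _ (fun t => t.1.2)); first exact: iota_uniq.
    by move=> j _; rewrite map_inj_uniq ?iota_uniq // => k k' [].
  by move=> j _ _ /mapP[k _ ->].
by move=> i _ _ /flatten_mapP[j _ /mapP[k _ ->]].
Qed.

Lemma big_index_triples (R : nmodType) m (l d : 'I_m -> nat) (F : 'I_m * nat * nat -> R) :
  \sum_(t <- index_triples l d) F t =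
  \sum_(i < m) \sum_(1 <= j < (l i).+1) \sum_(k < d i) F (i, j, k : nat).
Proof.
rewrite big_flatten big_map big_enum; apply: eq_bigr => i _.
rewrite big_flatten big_map /index_iota subn1; apply: eq_bigr => j _.
by rewrite big_map -[in RHS](big_mkord xpredT (fun k => F (i, j, k))) /index_iota subn0.
Qed.

(** * Denominators and coefficients of least valuation *)

Section ValuationMore.
Variables (p : nat) (V : subringClosed algC) (M : zmodClosed algC).
Hypotheses (VM : valuation_ring p V M) (p_pr : prime p).

Lemma int_unit (a : int) : ~~ (p %| `|a|)%N -> a%:~R \notin M.
Proof.
move=> pa; apply/negP=> Ma; case/negP: (val_proper VM).
have /coprimezP[[u v] /= e] : coprimez p%:Z a by rewrite coprimezE /= prime_coprime.
rewrite -[1]/(1%:~R : algC) -e intrD !intrM rpredD // (val_ideal VM) ?rpred_int //.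
by rewrite -pmulrn (val_prime VM).
Qed.

(** If [p] divides the denominator of [c], then [N^delta / p] lies in [V]. For [delta = 0] this is
    absurd; for [delta < 1], multiplying by [N^(1 - delta)] puts [N / p] into [M], so [p^2] divides
    [N]. *)
Lemma Zloc_val N (c delta : rat) : (p %| N)%N -> (1 < N)%N -> 0 <= delta < 1 ->
  (~~ (p * p %| N)%N \/ delta = 0) -> ratr c * Npow N delta \in V -> Zloc p c.
Proof.
move=> pN N1 /andP[d0 d1] hyp h; have N0 : (0 < N)%N by apply: ltnW.
rewrite /Zloc; apply/negP=> /dvdnP[e ee].
have p0 : (p%:R : algC) != 0 by rewrite pnatr_eq0 -lt0n prime_gt0.
have e0 : (e%:R : algC) != 0.
  by rewrite pnatr_eq0; apply: contraTneq (denq_neq0 c) => e0; rewrite -absz_eq0 ee e0.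
have num_unit : (numq c)%:~R \notin M.
  apply: int_unit; apply/negP=> pn; have := coprime_num_den c.
  rewrite ee => /(coprime_dvdl pn); rewrite coprimeMr => /andP[_].
  by rewrite prime_coprime // dvdnn.
have numV : (numq c)%:~R^-1 \in V by rewrite (val_unit VM) ?rpred_int.
have h1 : Npow N delta / p%:R \in V.
  have n0 : ((numq c)%:~R : algC) != 0 by apply: contra num_unit => /eqP->; rewrite rpred0.
  have -> : Npow N delta / p%:R = ratr c * Npow N delta * e%:R * (numq c)%:~R^-1.
    have -> : (ratr c : algC) = (numq c)%:~R / (e%:R * p%:R).
      by rewrite /ratr -natrM -ee pmulrn gez0_abs // denq_ge0.
    by field; rewrite n0 e0 p0.
  by apply: rpredM => //; apply: rpredM => //; apply: rpred_nat.
case: hyp => [ppN|dz]; last first.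
  rewrite dz Npow0 mul1r in h1; exact: (val_unit_out VM p0 (val_prime VM) h1).
have /dvdnP[N' eN] := pN.
have : N'%:R \in M.
  have -> : N'%:R = Npow N delta / p%:R * Npow N (1 - delta).
    rewrite mulrAC -NpowD // subrKC (Npow_nat N 1) expr1 eN natrM mulfK //.
  by rewrite (val_ideal VM) // (Npow_ideal VM pN) // subr_gt0.
apply/negP; have := @int_unit N'%:Z; rewrite -pmulrn; apply.
by apply: contra ppN => /= h2; rewrite eN dvdn_mul.
Qed.

(** Divisibility in [V] is total, so the least valuation in a finite list is attained. *)
Lemma max_val (L : seq algC) : has (fun e => e != 0) L ->
  exists2 k, (k \in L) && (k != 0) & forall e, e \in L -> e / k \in V.
Proof.
elim: L => [//|a L IH] /=; have [hL|nL] := boolP (has (fun e => e != 0) L).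
  move=> _; have [k /andP[kL k0] hk] := IH hL.
  have [ak|] := val_total VM (a / k).
    exists k => [|e]; first by rewrite inE kL orbT.
    by rewrite inE => /predU1P[->|/hk].
  rewrite invf_div => /(val_sub VM) ka; have [a0|a0] := eqVneq a 0.
    exists k => [|e]; first by rewrite inE kL orbT.
    by rewrite inE => /predU1P[->|/hk //]; rewrite a0 mul0r rpred0.
  exists a => [|e]; first by rewrite inE eqxx.
  rewrite inE => /predU1P[->|/hk ek]; first by rewrite divff // rpred1.
  have -> : e / a = e / k * (k / a) by rewrite mulrA divfK.
  exact: rpredM.
rewrite orbF => a0; exists a => [|e]; first by rewrite inE eqxx.
rewrite inE => /predU1P[->|eL]; first by rewrite divff // rpred1.
by have /hasPn/(_ e eL) := nL; rewrite negbK => /eqP->; rewrite mul0r rpred0.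
Qed.
End ValuationMore.

Section Combination.
Variables (p : nat) (V : subringClosed algC) (M : zmodClosed algC).
Hypotheses (VM : valuation_ring p V M) (p_pr : prime p).
Variables (N : nat) (f : {poly int}) (rs : seq algC) (m : nat).
Variables (g : 'I_m -> {poly int}) (l : 'I_m -> nat).
Hypotheses (N1 : (1 < N)%N) (pN : (p %| N)%N).
Hypotheses (f_monic : f \is monic) (rs_uniq : uniq rs).
Hypothesis f_split : ZtoC f = \prod_(r <- rs) ('X - r%:P).
Hypotheses (g_monic : forall i, g i \is monic) (g_size : forall i, (1 < size (g i))%N).
Hypothesis l_gt0 : forall i, (0 < l i)%N.
Hypothesis f_red : redp p f = redp p (\prod_(i < m) g i ^+ l i).
Hypothesis g_coprime : forall i j, i != j -> coprimep (redp p (g i)) (redp p (g j)).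
Hypothesis fg_def : forall i s, vN_defined N (dig f (g i) s).
Hypothesis data : forall i, polygon_data V M N f (g i) (l i).

Local Notation y i j := (hull N f (g i) j).
Local Notation Q i j := (ZtoC (f %/ g i ^+ j)).
Local Notation d := (fun i => (size (g i)).-1).

Definition combination (D : 'I_m -> nat -> nat -> algC) : {poly algC} :=
  \sum_(i < m) \sum_(1 <= j < (l i).+1) (\poly_(k < d i) D i j k) * Q i j.

(** By contradiction: after division by the scaled coefficient [K] of least valuation, which is not
    in [V], the coefficients lie in [V] and the values at the roots in [M], while the coefficient
    belonging to [K] becomes 1. *)
Lemma combination_val D : (forall r, r \in rs -> (combination D).[r] \in V) ->
  forall i j k, (0 < j <= l i)%N -> (k < d i)%N -> D i j k * Npow N (y i j) \in V.
Proof.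
move=> ZV i j k hj hk; apply: contraT => notV; have N0 := ltnW N1.
pose E (t : 'I_m * nat * nat) := D t.1.1 t.1.2 t.2 * Npow N (y t.1.1 t.1.2).
pose L := [seq E t | t <- index_triples l d].
have inL : E (i, j, k) \in L by apply: map_f; rewrite mem_index_triples hj hk.
have hasL : has (fun e => e != 0) L.
  apply/hasP; exists (E (i, j, k)) => //; apply: contra notV => /eqP.
  by rewrite /E /= => ->; rewrite rpred0.
have [_ /andP[/mapP[[[i0 j0] k0] t0 ->] K0] maxL] := max_val VM hasL.
move: (t0); rewrite mem_index_triples => /andP[hj0 hk0].
pose K := E (i0, j0, k0); rewrite -/K in K0 maxL.
have KM : K^-1 \in M.
  have [KV|//] := val_total VM K; case/negP: notV.
  by have := rpredM (maxL _ inL) KV; rewrite divfK.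
pose C i j := if (0 < j <= l i)%N then \poly_(k < d i) (E (i, j, k) / K) else 0.
have C_over i1 j1 : C i1 j1 \is a polyOver V.
  rewrite /C; case: ifP => hj1; last exact: rpred0.
  apply/polyOverP=> k1; rewrite coef_poly; case: ifP => hk1; last exact: rpred0.
  by apply: maxL; apply: map_f; rewrite mem_index_triples hj1 hk1.
have C_size i1 j1 : (size (C i1 j1) <= (size (g i1)).-1)%N.
  by rewrite /C; case: ifP => _; rewrite ?size_poly0 ?size_poly.
pose Z := \sum_(i < m) \sum_(1 <= j < (l i).+1) Npow N (- y i j) *: (C i j * Q i j).
have Z_root r : r \in rs -> Z.[r] \in M.
  move=> /ZV h; have -> : Z = K^-1 *: combination D.
    rewrite scaler_sumr; apply: eq_bigr => i1 _; rewrite scaler_sumr.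
    apply: eq_big_nat => j1 hj1; rewrite ltnS in hj1; rewrite /C hj1 !scalerAl; congr (_ * _).
    apply/polyP=> k1; rewrite !coefZ !coef_poly; case: ifP => _; rewrite ?mulr0 //.
    by rewrite /E /= NpowN //; have n0 := Npow_neq0 N0 (y i1 j1); field; rewrite n0 K0.
  by rewrite hornerZ (val_idealr VM).
have /polyOverP/(_ k0) : C i0 j0 \is a polyOver M.
  exact: (coefficients_ideal VM p_pr N1 pN f_monic rs_uniq f_split g_monic g_size l_gt0 f_red g_coprime
    fg_def data C_over C_size Z_root).
by rewrite /C hj0 coef_poly hk0 -/K divff // (negPf (val_proper VM)).
Qed.
End Combination.

(** * Conjugates of [theta] *)

Definition evalQ (x : algC) (P : {poly rat}) : algC := (map_poly ratr P).[x].
HB.instance Definition _ x := GRing.RMorphism.copy (evalQ x)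
  (horner_eval x \o map_poly (ratr : rat -> algC)).

Lemma evalQZ x c P : evalQ x (c *: P) = ratr c * evalQ x P.
Proof. by rewrite /evalQ map_polyZ hornerZ. Qed.

Lemma ratr_ZtoC (a : {poly int}) : map_poly ratr (map_poly intr a) = ZtoC a.
Proof. by rewrite -map_poly_comp; apply: eq_map_poly => z /=; rewrite ratr_int. Qed.

Lemma evalQ_int x (a : {poly int}) : evalQ x (map_poly intr a) = (ZtoC a).[x].
Proof. by rewrite /evalQ ratr_ZtoC. Qed.

Section Conjugates.
Variables (f : {poly int}) (theta : algC).
Hypotheses (f_monic : f \is monic) (f_theta : root (ZtoC f) theta).
Hypothesis f_irr : irreducible_poly (map_poly (intr : int -> rat) f).

Local Notation fQ := (map_poly (intr : int -> rat) f).

Lemma irreducible_dvd P : evalQ theta P = 0 -> fQ %| P.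
Proof.
move=> P0; have [_ irr] := f_irr.
have [co|nco] := boolP (size (gcdp fQ P) == 1%N).
  have /Bezout_eq1_coprimepP[[u v] /= e] := co.
  have /eqP := congr1 (evalQ theta) e; rewrite rmorphD !rmorphM rmorph1 /= P0 mulr0 addr0.
  by rewrite evalQ_int (rootP f_theta) mulr0 eq_sym oner_eq0.
by rewrite -(eqp_dvdl _ (irr _ nco (dvdp_gcdl _ _))) dvdp_gcdr.
Qed.

Lemma split_roots : exists2 rs : seq algC, uniq rs & ZtoC f = \prod_(r <- rs) ('X - r%:P).
Proof.
have [rs e] := closed_field_poly_normal (ZtoC f).
rewrite (monicP (monic_ZtoC f_monic)) scale1r in e; exists rs => //.
rewrite -separable_prod_XsubC -e -ratr_ZtoC separable_map unlock.
have [f1 irr] := f_irr; apply: contraT => nco.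
have d := irr _ nco (dvdp_gcdl _ _).
have : fQ %| fQ^`() by rewrite -(eqp_dvdl _ d) dvdp_gcdr.
have f0 : fQ != 0 by rewrite monic_neq0 ?monic_map.
have fd0 : fQ^`() != 0.
  apply/eqP=> /polyP/(_ (size fQ).-2); rewrite coef_deriv coef0.
  have -> : ((size fQ).-2.+1 = (size fQ).-1)%N by move: f1; case: (size fQ) => [|[]].
  rewrite -lead_coefE (monicP (monic_map _ f_monic)) => /eqP.
  by rewrite pnatr_eq0; move: f1; case: (size fQ) => [|[]].
by move=> /(dvdp_leq fd0); rewrite leqNgt lt_size_deriv.
Qed.

Variable rs : seq algC.
Hypothesis f_split : ZtoC f = \prod_(r <- rs) ('X - r%:P).

Lemma conjugate_root r P : r \in rs -> evalQ theta P = 0 -> evalQ r P = 0.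
Proof.
move=> rrs /irreducible_dvd/dvdpP[q ->]; rewrite rmorphM /= evalQ_int.
by rewrite (split_root f_split rrs) mulr0.
Qed.

(** If a monic integer polynomial [h] kills [P(theta)], then [h o P] vanishes at [theta], hence at
    every root of [f]. *)
Lemma conjugate_Aint r P : r \in rs -> evalQ theta P \in Aint -> evalQ r P \in Aint.
Proof.
move=> rrs /Aint_integral[h h_mon hr].
have comp x : evalQ x (map_poly intr h \Po P) = (ZtoC h).[evalQ x P].
  by rewrite /evalQ map_comp_poly horner_comp ratr_ZtoC.
apply: (root_monic_Aint _ (monic_ZtoC h_mon) (ZtoC_int h)).
by apply/rootP; rewrite -comp; apply: conjugate_root => //; rewrite comp; apply/rootP.
Qed.
End Conjugates.

(** * The family in [K] and the two implications *)

Section Family.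
Variables (N : nat) (f : {poly int}) (theta : algC) (m : nat).
Variables (g : 'I_m -> {poly int}) (l : 'I_m -> nat).
Hypotheses (f_monic : f \is monic) (N1 : (1 < N)%N).
Hypothesis f_irr : irreducible_poly (map_poly (intr : int -> rat) f).
Hypothesis f_size : (1 < (size f).-1)%N.
Hypothesis f_theta : root (ZtoC f) theta.
Hypotheses (g_monic : forall i, g i \is monic) (g_size : forall i, (1 < size (g i))%N).
Hypothesis l_gt0 : forall i, (0 < l i)%N.
Hypothesis f_mod : forall k, (N%:Z %| (f - \prod_(i < m) g i ^+ l i)`_k)%Z.
Hypothesis p_big : forall p, prime p -> (p %| N)%N -> ((size f).-1 < p)%N.
Hypothesis g_red : forall p, prime p -> (p %| N)%N ->
  (forall i, sqfree (redp p (g i))) /\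
  (forall i j, i != j -> coprimep (redp p (g i)) (redp p (g j))).
Hypothesis f_reg : N_regular N f g.

Local Notation y i j := (hull N f (g i) j).
Local Notation d := (fun i => (size (g i)).-1).
Local Notation idx := (index_triples l d).
Local Notation s := (alpha_family theta N f g l).

Let N0 : (0 < N)%N. Proof. exact: ltnW. Qed.

(** Rational polynomials stand for the members of the family, so that these can be evaluated at
    every conjugate of [theta]. *)
Definition family_poly (t : 'I_m * nat * nat) : {poly rat} :=
  (N%:R ^ Num.floor (y t.1.1 t.1.2))^-1 *: (map_poly intr (f %/ g t.1.1 ^+ t.1.2) * 'X^(t.2)).

Lemma evalQ_family x i j k : evalQ x (family_poly (i, j, k)) =
  (ZtoC (f %/ g i ^+ j)).[x] * x ^+ k / N%:R ^ Num.floor (y i j).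
Proof.
rewrite /family_poly evalQZ rmorphM /= evalQ_int mulrC; congr (_ * _ * _).
  by rewrite /evalQ map_polyXn hornerXn.
by rewrite fmorphV rmorphXz ?unitfE ?pnatr_eq0 -?lt0n // rmorph_nat.
Qed.

Lemma alpha_familyE : s = [seq evalQ theta (family_poly t) | t <- idx].
Proof.
rewrite /alpha_family /index_triples map_flatten -map_comp; congr flatten.
apply: eq_map => i /=; rewrite map_flatten -map_comp; congr flatten.
apply: eq_map => j /=; rewrite -map_comp; apply: eq_map => k /=.
by rewrite evalQ_family.
Qed.

Definition lin_poly (c : seq rat) : {poly rat} :=
  \sum_(t <- idx) c`_(index t idx) *: family_poly t.

Lemma lincombE c : lincomb c s = evalQ theta (lin_poly c).
Proof.
rewrite /lincomb /lin_poly rmorph_sum alpha_familyE size_map.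
have [idx0|idx0] := posnP (size idx); first by rewrite idx0 (size0nil idx0) big_ord0 big_nil.
have [t0 _] : exists t, t \in idx by case: idx idx0 => // t u _; exists t; apply: mem_head.
rewrite (big_nth t0) big_mkord; apply: eq_bigr => k _.
by rewrite /= evalQZ (nth_map t0) // index_uniq // uniq_index_triples.
Qed.

Lemma family_Aint t : t \in idx -> evalQ theta (family_poly t) \in Aint.
Proof.
case: t => [[i j] k]; rewrite mem_index_triples => /andP[jl _].
have Ath : theta \in Aint by apply: root_monic_int f_theta.
rewrite evalQ_family mulrAC rpredM ?rpredX //.
have -> : (ZtoC (f %/ g i ^+ j)).[theta] / N%:R ^ Num.floor (y i j) =
    (ZtoC (f %/ g i ^+ j)).[theta] / Npow N (y i j) * Npow N (y i j - (Num.floor (y i j))%:~R).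
  rewrite NpowB // Npow_int //; have n0 := Npow_neq0 N0 (y i j).
  by rewrite mulrA divfK.
apply: rpredM; last by rewrite Npow_Aint // subr_ge0 floor_le.
have [mu sub] := subgradient_exists N f (g_monic i) (g_size i) j.
apply: (quot_Aint N1 f_monic (g_monic i) (g_size i) f_theta _ _ sub); last by case/andP: jl.
by case: f_reg.
Qed.

Section AtPrime.
Variables (p : nat) (V : subringClosed algC) (M : zmodClosed algC) (rs : seq algC).
Hypotheses (VM : valuation_ring p V M) (p_pr : prime p) (pN : (p %| N)%N).
Hypotheses (rs_uniq : uniq rs) (f_split : ZtoC f = \prod_(r <- rs) ('X - r%:P)).

Let coefD (c : seq rat) (i : 'I_m) (j k : nat) : algC :=
  ratr c`_(index (i, j, k) idx) / N%:R ^ Num.floor (y i j).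

Lemma evalQ_lin_poly c x : evalQ x (lin_poly c) = (combination f g l (coefD c)).[x].
Proof.
rewrite /lin_poly rmorph_sum big_index_triples /combination horner_sum.
apply: eq_bigr => i _; rewrite horner_sum; apply: eq_bigr => j _.
rewrite hornerM horner_poly mulr_suml; apply: eq_bigr => k _.
by rewrite /= evalQZ evalQ_family /coefD; move: (_^-1) => a; ring.
Qed.

Lemma combinationZ a D x : (combination f g l (fun i j k => a * D i j k)).[x] =
  a * (combination f g l D).[x].
Proof.
rewrite /combination !horner_sum mulr_sumr; apply: eq_bigr => i _.
rewrite !horner_sum mulr_sumr; apply: eq_bigr => j _.
rewrite !hornerM !horner_poly !mulr_suml mulr_sumr.
by apply: eq_bigr => k _; rewrite !mulrA.
Qed.

Lemma combination_scaled_val a D : (forall r, r \in rs -> a * (combination f g l D).[r] \in V) ->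
  forall i j k, (i, j, k) \in idx -> a * (D i j k * Npow N (y i j)) \in V.
Proof.
move=> h i j k; rewrite mem_index_triples => /andP[jl kd]; rewrite mulrA.
have [_ g_co] := g_red p_pr pN.
apply: (combination_val VM p_pr N1 pN f_monic rs_uniq f_split g_monic g_size l_gt0
  (f_redp f_mod p_pr pN) g_co _ _ (D := fun i j k => a * D i j k)) => //.
- by case: f_reg.
- by move=> i'; eapply polygon_data_of; eassumption.
- by move=> r rrs; rewrite combinationZ; apply: h.
Qed.

Lemma coefD_Npow c i j k : coefD c i j k * Npow N (y i j) =
  ratr c`_(index (i, j, k) idx) * Npow N (y i j - (Num.floor (y i j))%:~R).
Proof. by rewrite /coefD NpowB // Npow_int // mulrAC mulrA. Qed.

Lemma lin_poly_val c : evalQ theta (lin_poly c) \in Aint -> forall i j k, (i, j, k) \in idx ->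
  ratr c`_(index (i, j, k) idx) * Npow N (y i j - (Num.floor (y i j))%:~R) \in V.
Proof.
move=> h i j k t; rewrite -coefD_Npow -[X in X \in V]mul1r.
apply: combination_scaled_val t => r rrs; rewrite mul1r -evalQ_lin_poly.
apply: (val_Aint VM); exact: (conjugate_Aint f_theta f_irr f_split rrs h).
Qed.

(** A combination that vanishes at [theta] vanishes at all roots, and so has values in [V] under any
    scaling. Scaling a nonzero coefficient to [1/p] then contradicts the bound on coefficients. *)
Lemma lin_poly_free c : evalQ theta (lin_poly c) = 0 ->
  forall t, t \in idx -> c`_(index t idx) = 0.
Proof.
move=> h [[i j] k] t; apply/eqP; apply: contraT => c0.
pose x := coefD c i j k * Npow N (y i j).
have x0 : x != 0.
  by rewrite /x coefD_Npow mulf_neq0 ?Npow_neq0 // fmorph_eq0.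
have p0 : (p%:R : algC) != 0 by rewrite pnatr_eq0 -lt0n prime_gt0.
have : (p%:R * x)^-1 * x \in V.
  apply: combination_scaled_val t => r rrs; rewrite -evalQ_lin_poly.
  by rewrite (conjugate_root f_theta f_irr f_split rrs h) mulr0 rpred0.
rewrite invfM mulfVK // => pV; case: (val_unit_out VM p0 (val_prime VM) pV).
Qed.
End AtPrime.
Lemma free_lin_poly c : evalQ theta (lin_poly c) = 0 -> forall t, t \in idx -> c`_(index t idx) = 0.
Proof.
have pp : prime (pdiv N) by apply: pdiv_prime.
have [V [M VM]] := valuation_exists pp.
have [rs rs_uniq f_split] := split_roots f_monic f_irr.
exact: (lin_poly_free VM pp (pdiv_dvd N) rs_uniq f_split).
Qed.

Lemma free_lincomb c : size c = size s -> lincomb c s = 0 -> all (fun a => a == 0) c.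
Proof.
move=> sc; rewrite lincombE => /free_lin_poly h; apply/(all_nthP 0) => a ac.
have ai : (a < size idx)%N by rewrite sc alpha_familyE size_map in ac.
have [t0 _] : exists t, t \in idx by case: idx ai => // t u _; exists t; apply: mem_head.
by have := h _ (mem_nth t0 ai); rewrite index_uniq ?uniq_index_triples // => ->.
Qed.

(** [f] and the product of the [g_i^l_i] are monic and agree modulo a prime, so their degrees are
    equal. *)
Lemma size_idx : size idx = (size f).-1.
Proof.
rewrite -sum1_size (big_index_triples l d (fun=> 1%N)).
have -> : (\sum_(i < m) \sum_(1 <= j < (l i).+1) \sum_(k < d i) 1 = \sum_(i < m) l i * d i)%N.
  by apply: eq_bigr => i _; rewrite sum1_card card_ord sum_nat_const_nat subn1.
have pp : prime (pdiv N) by apply: pdiv_prime.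
have [h1 h2] : \prod_(i < m) g i ^+ l i \is monic /\
    size (\prod_(i < m) g i ^+ l i) = (\sum_(i < m) l i * d i).+1.
  apply: (big_ind2 (fun (a : {poly int}) b => a \is monic /\ size a = b.+1)).
  - by rewrite rpred1 size_poly1.
  - move=> a1 b1 a2 b2 [m1 s1] [m2 s2]; rewrite monicMl // size_Mmonic ?monic_neq0 //.
    by rewrite s1 s2 addSn addnS.
  - by move=> i _; rewrite monic_exp // size_monic_exp // mulnC.
by rewrite -(size_redp_monic (pdiv N) f_monic) (f_redp f_mod pp (pdiv_dvd N)) size_redp_monic // h2.
Qed.

Local Notation fQ := (map_poly (intr : int -> rat) f).
Let F a : {poly rat} := [seq family_poly t | t <- idx]`_a.

Lemma family_nth a : (a < size s)%N -> s`_a = evalQ theta (F a).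
Proof.
rewrite alpha_familyE size_map => ai.
have [t0 _] : exists t, t \in idx by case: idx ai => // t u _; exists t; apply: mem_head.
by rewrite /F !(nth_map t0).
Qed.

Lemma evalQ_mod P : evalQ theta (P %% fQ) = evalQ theta P.
Proof.
rewrite [in RHS](divp_eq P fQ) rmorphD rmorphM /= evalQ_int (rootP f_theta).
by rewrite mulr0 add0r.
Qed.

Lemma size_fQ : size fQ = (size s).+1.
Proof.
rewrite (size_map_inj_poly (@intr_inj rat)) // alpha_familyE size_map size_idx.
by move: f_size; case: (size f).
Qed.

(** Coordinates of the family with respect to the powers of [theta]. The matrix is square, so
    freeness of the family gives invertibility and hence spanning. *)
Let A : 'M[rat]_(size s) := \matrix_(a, b) (F a %% fQ)`_b.

Lemma lincomb_row (v : 'rV[rat]_(size s)) P : v *m A = \row_b (P %% fQ)`_b ->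
  lincomb [seq v ord0 a | a <- enum 'I_(size s)] s = evalQ theta P.
Proof.
move=> e; rewrite /lincomb -evalQ_mod.
have -> : P %% fQ = \sum_(a < size s) v ord0 a *: (F a %% fQ).
  apply/polyP=> b; rewrite coef_sum; have [bs|sb] := ltnP b (size s).
    have /rowP/(_ (Ordinal bs)) := e; rewrite !mxE /= => <-.
    by apply: eq_bigr => a _; rewrite !mxE coefZ.
  have small Q : (Q %% fQ)`_b = 0.
    rewrite nth_default //; apply: leq_trans sb; rewrite -ltnS -size_fQ.
    by rewrite ltn_modp monic_neq0 ?monic_map.
  by rewrite small big1 // => a _; rewrite coefZ small mulr0.
rewrite rmorph_sum; apply: eq_bigr => a _ /=.
rewrite evalQZ evalQ_mod -family_nth // (nth_map a) ?size_enum_ord //.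
by rewrite nth_ord_enum.
Qed.

Lemma family_unitmx : A \in unitmx.
Proof.
rewrite -row_free_unit; apply: inj_row_free => v vA.
have e : v *m A = \row_b (0 %% fQ)`_b.
  by rewrite vA; apply/rowP=> b; rewrite !mxE mod0p coef0.
have := lincomb_row e; rewrite rmorph0 => /free_lincomb.
rewrite size_map size_enum_ord => /(_ erefl)/allP h.
by apply/rowP=> a; rewrite mxE; apply/eqP/h/map_f; rewrite mem_enum.
Qed.

Lemma span_lincomb z : inK theta z -> exists2 c : seq rat, size c = size s & z = lincomb c s.
Proof.
move=> [q ->].
exists [seq (\row_b (q %% fQ)`_b *m invmx A) ord0 a | a <- enum 'I_(size s)].
  by rewrite size_map size_enum_ord.
by symmetry; apply: lincomb_row; rewrite mulmxKV ?family_unitmx.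
Qed.

Lemma family_ZK x : x \in s -> ZK theta x.
Proof.
by rewrite alpha_familyE => /mapP[t ti ->]; split; [exists (family_poly t)|exact: family_Aint].
Qed.

Let polygon i (S0 : dig f (g i) 0 != 0) j (jl : (j < l i)%N) :=
  side_exists (g_monic i) (g_size i) (l_gt0 i) S0
    (dig_end_neq0 N1 g_monic g_size f_mod g_red i) (vNexp_end N1 g_monic g_size f_mod g_red f_reg i)
    (fun s => @vNexp_lt N f m g l N1 g_monic f_mod f_reg i s) jl.

(** Descending from ordinate 0 at [l i], each step subtracts an integral slope. *)
Lemma hull_int i j :
  (forall s len sigma, is_side N f (g i) s len sigma -> denq sigma = 1) ->
  (0 < j <= l i)%N -> y i j - (Num.floor (y i j))%:~R = 0.
Proof.
move=> den1 /andP[j0 jl]; suff : y i j \is a Num.int.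
  by rewrite intrEfloor => /eqP->; rewrite subrr.
have [S0|S0] := eqVneq (dig f (g i) 0) 0.
  have l1 : l i = 1%N.
    exact: (degenerate_length f_monic N1 f_irr g_monic g_size l_gt0 f_mod S0).
  have -> : j = 1%N by move: jl; rewrite l1; case: j j0 => [|[]].
  rewrite (degenerate_hull f_monic N1 f_irr g_monic g_size l_gt0 f_mod g_red f_reg S0).
  exact: rpred0.
have {j0} [e je] : exists e, (j + e = l i)%N by exists (l i - j)%N; rewrite subnKC.
elim: e j jl je => [|e IH] j jl je.
  rewrite addn0 in je; rewrite je (hull_end (g_monic i) (g_size i) S0) ?rpred0 //.
    exact: (dig_end_neq0 N1 g_monic g_size f_mod g_red i).
  exact: (vNexp_end N1 g_monic g_size f_mod g_red f_reg i).
have jl' : (j < l i)%N by rewrite -je addnS ltnS leq_addr.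
have [s0 [len os]] := polygon S0 jl'.
have : slope N f (g i) j \is a Num.int.
  by rewrite -(divq_num_den (slope N f (g i) j)) (den1 _ _ _ (side_is os)) divr1 rpred_int.
have -> : y i j = y i j.+1 - slope N f (g i) j by rewrite hullS addrK.
by move=> h; rewrite rpredB // IH // -je addSnnS.
Qed.

Lemma integral_basis_of : (sqfree_nat N \/
    forall i s len sigma, is_side N f (g i) s len sigma -> denq sigma = 1) ->
  N_integral_basis theta N s.
Proof.
move=> cond p p_pr pN; split; first exact: family_ZK.
  move=> z [Kz Az]; have [c sc zE] := span_lincomb Kz; exists c; split=> //.
  have [V [M VM]] := valuation_exists p_pr.
  have [rs rs_uniq f_split] := split_roots f_monic f_irr.
  apply/(all_nthP 0) => a ac.
  have ai : (a < size idx)%N by rewrite sc alpha_familyE size_map in ac.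
  have [t0 _] : exists t, t \in idx by case: idx ai => // t u _; exists t; apply: mem_head.
  have := mem_nth t0 ai; case e: (nth t0 idx a) => [[i j] k] ti.
  have ei : index (i, j, k) idx = a by rewrite -e index_uniq ?uniq_index_triples.
  rewrite zE lincombE in Az.
  have := lin_poly_val VM p_pr pN rs_uniq f_split Az ti; rewrite ei.
  apply: (Zloc_val VM p_pr pN N1).
    by have /andP[h1 h2] := floor_itv (y i j); rewrite subr_ge0 h1 ltrBlDl -[1]/(1%:~R) -intrD.
  case: cond => [sq|den1]; first by left; apply: sq.
  right; apply: hull_int; first exact: den1.
  by move: ti; rewrite mem_index_triples => /andP[].
by move=> c sc _; apply: free_lincomb.
Qed.

(** [is_side] does not mention [l], so sides beyond it must be excluded. A supporting line at
    [k > l i] with negative slope would be positive at [l i], where the hull is 0. *)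
Lemma negative_slope_lt i k : dig f (g i) 0 != 0 -> hdef N f (g i) k -> hdef N f (g i) k.+1 ->
  slope N f (g i) k < 0 -> (k < l i)%N.
Proof.
move=> S0 hk hk1 neg; rewrite ltnNge; apply/negP=> lk.
have Sl := dig_end_neq0 N1 g_monic g_size f_mod g_red i.
have Ul := vNexp_end N1 g_monic g_size f_mod g_red f_reg i.
have yk := hull_ge0 (g_monic i) (g_size i) hk.
have yk1 := hull_ge0 (g_monic i) (g_size i) hk1.
have yl := hull_end (g_monic i) (g_size i) S0 Sl Ul.
have [mu sub] := subgradient_exists N f (g_monic i) (g_size i) k.
have := subgradient_hull (g_monic i) (g_size i) sub (hdef_le N (g_monic i) (g_size i) S0 Sl (leqnn (l i))).
have h1 := subgradient_slope (g_monic i) (g_size i) sub hk1; rewrite yl.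
move: lk; rewrite leq_eqVlt => /predU1P[e|lk].
  by move: neg; rewrite /slope -e yl subr0 e ltNge yk1.
have : ((l i)%:R : rat) < k%:R by rewrite ltr_nat.
move: (hull N f (g i) k) yk (slope N f (g i) k) neg h1 => a a0 c neg h1 lk_lt le0.
have mu0 : 0 < mu by rewrite -oppr_lt0 (le_lt_trans h1).
have : mu * ((l i)%:R - k%:R) < 0 by rewrite pmulr_rlt0 // subr_lt0.
by rewrite ltNge; case/negP; rewrite (le_trans a0) // -subr_le0.
Qed.

(* The ordinates next to the ends of a side of non-integral slope [sigma] have the
   fractional parts of [sigma] and of [- sigma], one of which is at least 1/2. *)
Lemma half_fraction i k len sigma : is_side N f (g i) k len sigma -> denq sigma != 1 ->
  exists2 j, (0 < j <= l i)%N & 2^-1 <= y i j - (Num.floor (y i j))%:~R.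
Proof.
move=> side den; have [len0 neg h _ _] := side.
have [S0|S0] := eqVneq (dig f (g i) 0) 0.
  by case: (degenerate_no_side f_monic f_irr f_size g_monic g_size S0 side).
have := h k; rewrite leqnn -[X in (X < _)%N]addn0 ltn_add2l len0 => /(_ isT)/and3P[hk hk1 /eqP slk].
have kl : (k < l i)%N by apply: negative_slope_lt => //; rewrite slk.
have [s0 [n os]] := polygon S0 kl; rewrite -slk in den neg.
have nint : slope N f (g i) k \isn't a Num.int.
  apply: contra den => /intrP[z ->]; by rewrite denq_int.
have ln := side_le os; have := side_mem os => /andP[s0k kn].
have [_ yl _] := side_left os; have [_ yr _] := side_right os.
have line := side_line os.
(* A side of length 1 joins two integral points and would have an integral slope. With [n > 1] the
   abscissa [s0 + n - 1] is positive even when [s0 = 0]. *)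
have n1 : (1 < n)%N.
  rewrite ltnNge; apply/negP=> n1; have en : n = 1%N by move: n1 s0k kn; clear; lia.
  case/negP: nint; have := line (s0 + n)%N; rewrite leqnn leq_addr => /(_ isT).
  rewrite yl yr en natrD addrAC subrr add0r mulr1 => e.
  have -> : slope N f (g i) k = (vNexp N (dig f (g i) (s0 + 1)))%:R - (vNexp N (dig f (g i) s0))%:R.
    by rewrite e; ring.
  by rewrite rpredB ?rpred_nat.
have frac (x : rat) (z : nat) (e : rat) : x = z%:R + e ->
    x - (Num.floor x)%:~R = e - (Num.floor e)%:~R.
  by move=> ->; rewrite floorDzr ?rpred_nat // [z%:R]pmulrn intrKfloor intrD; ring.
have ya : y i s0.+1 = (vNexp N (dig f (g i) s0))%:R + slope N f (g i) k.
  rewrite line -?yl; first by rewrite -[s0.+1%:R]natr1; ring.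
  by move: n1; clear; lia.
have yb : y i (s0 + n).-1 = (vNexp N (dig f (g i) (s0 + n)))%:R + - slope N f (g i) k.
  have e := hullS N f (g i) (s0 + n).-1; rewrite prednK in e; last by move: n1; clear; lia.
  rewrite -yr e (side_slope os) ?addrK //; by move: n1; clear; lia.
have [ha|ha] := leP 2^-1 (slope N f (g i) k - (Num.floor (slope N f (g i) k))%:~R).
  exists s0.+1; first by move: n1 ln; clear; lia.
  by rewrite (frac _ _ _ ya).
exists (s0 + n).-1; first by move: n1 ln; clear; lia.
rewrite (frac _ _ _ yb); move: (slope N f (g i) k) nint ha => x xint ha.
have xa : (Num.floor x)%:~R < x.
  by rewrite lt_neqAle floor_le andbT; apply: contra xint => /eqP<-; rewrite rpred_int.
(* For nonintegral [x] the fractional parts of [x] and [- x] add up to 1, so if the first is below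
   1/2 the second is above; one inequality suffices. *)
have : (Num.floor (- x) + 1)%:~R <= (- Num.floor x)%:~R :> rat.
  rewrite ler_int lezD1 -(ltr_int rat) (le_lt_trans (floor_le _)) // intrN ltrN2 //.
by rewrite intrD intrN; lra.
Qed.

Lemma sqr_Aint (x : algC) : x ^+ 2 \in Aint -> x \in Aint.
Proof.
move=> h; apply: (@Aint_root_monic ('X^2 - (x ^+ 2)%:P)).
- exact: monicXnsubC.
- by rewrite rootE !hornerE subrr.
- by apply: rpredB; [rewrite rpredX ?polyOverX|rewrite polyOverC].
Qed.

Lemma basis_condition : N_integral_basis theta N s ->
  sqfree_nat N \/ forall i s len sigma, is_side N f (g i) s len sigma -> denq sigma = 1.
Proof.
move=> basis; have [|nsq] := EM (sqfree_nat N); [by left|right].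
move=> i k len sigma side; apply/eqP; apply: contraT => den.
have [p p_pr ppN] : exists2 p, prime p & (p * p %| N)%N.
  apply: contrapT => h; apply: nsq => p p_pr; apply/negP=> ppN; apply: h; by exists p.
have pN : (p %| N)%N by apply: dvdn_trans ppN; apply: dvdn_mulr.
have p0 : (p%:R : algC) != 0 by rewrite pnatr_eq0 -lt0n prime_gt0.
have [j jl hj] := half_fraction side den; set del := y i j - _ in hj.
have ti : (i, j, 0%N) \in idx.
  by rewrite mem_index_triples jl -subn1 subn_gt0 g_size.
pose x := evalQ theta (family_poly (i, j, 0%N)).
pose q := (ZtoC (f %/ g i ^+ j)).[theta] / Npow N (y i j).
have Aq : q \in Aint.
  have [mu sub] := subgradient_exists N f (g_monic i) (g_size i) j.
  apply: (quot_Aint N1 f_monic (g_monic i) (g_size i) f_theta _ _ sub); last by case/andP: jl.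
  by case: f_reg.
have xE : x = q * Npow N del.
  rewrite /x evalQ_family expr0 mulr1 /q /del NpowB // Npow_int // mulrA divfK //.
  exact: Npow_neq0.
have Az : x / p%:R \in Aint.
  apply: sqr_Aint; have /dvdnP[c eN] := ppN.
  (* Squaring doubles [del], and [2 del >= 1] allows a whole factor [N] to be split off, which
     absorbs [p^2] because [N = c p^2]. *)
  have -> : (x / p%:R) ^+ 2 = q ^+ 2 * Npow N (del * 2%:R - 1) * c%:R.
    rewrite xE exprMn exprVn exprMn -NpowMn // NpowB // (Npow_nat N 1) expr1.
    have N0' : (N%:R : algC) != 0 by rewrite pnatr_eq0 -lt0n.
    have -> : (c%:R : algC) = N%:R / p%:R ^+ 2 by rewrite eN !natrM expr2 mulfK // mulf_neq0.
    by rewrite mulrA -!mulrA; congr (_ * (_ * _)); rewrite mulKf.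
  apply: rpredM; last exact: rpred_nat.
  apply: rpredM; first exact: rpredX.
  by apply: Npow_Aint; move: (del) hj => a ha; lra.
have [_ span _] := basis p p_pr pN.
have [|c [sc cloc zE]] := span (x / p%:R).
  split=> //; exists (p%:R^-1 *: family_poly (i, j, 0%N)).
  by rewrite -/(evalQ theta _) evalQZ fmorphV rmorph_nat mulrC.
pose a := index (i, j, 0%N) idx.
have ai : (a < size idx)%N by rewrite index_mem.
(* [x / p] is also [1/p] times one member of the family. The difference of the two expressions is a
   relation with rational coefficients, so [c_a = 1/p], against [c_a] being integral at [p]. *)
pose c' := set_nth 0 c a (c`_a - p%:R^-1).
have : evalQ theta (lin_poly c') = 0.
  have -> : lin_poly c' = lin_poly c - p%:R^-1 *: family_poly (i, j, 0%N).
    rewrite /lin_poly (bigD1_seq (i, j, 0%N)) ?uniq_index_triples //=.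
    rewrite [in RHS](bigD1_seq (i, j, 0%N)) ?uniq_index_triples //= nth_set_nth /= eqxx scalerBl.
    rewrite addrAC; congr (_ + _ - _).
    rewrite big_seq_cond [RHS]big_seq_cond; apply: eq_bigr => t /andP[ti' ne].
    rewrite nth_set_nth /= ifN //; apply: contra ne => /eqP e.
    by rewrite -(nth_index t ti') e nth_index.
  by rewrite rmorphB /= -lincombE -zE evalQZ fmorphV rmorph_nat mulrC subrr.
move=> /free_lin_poly/(_ _ ti); rewrite -/a nth_set_nth /= eqxx => /eqP.
rewrite subr_eq0 => /eqP ca.
have : Zloc p c`_a.
  by apply: (all_nthP 0 cloc); rewrite sc alpha_familyE size_map.
rewrite ca /Zloc pmulrn denqVz ?ger0_norm ?dvdnn //.
by rewrite eqz_nat -lt0n prime_gt0.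
Qed.
End Family.

Theorem theorem4p1 (f : {poly int}) (theta : algC) (N m : nat)
  (g : 'I_m -> {poly int}) (ell : 'I_m -> nat) :
  f \is monic ->
  irreducible_poly (map_poly (fun z : int => z%:~R) f : {poly rat}) ->
  (1 < (size f).-1)%N ->
  (map_poly (fun z : int => z%:~R) f).[theta] = 0 ->
  (1 < N)%N ->
  (forall p, prime p -> (p %| N)%N -> ((size f).-1 < p)%N) ->
  (forall i, g i \is monic) -> (forall i, (1 < size (g i))%N) ->
  (forall i, (0 < ell i)%N) ->
  (forall k, (N%:Z %| (f - \prod_(i < m) g i ^+ ell i)`_k)%Z) ->
  (forall p, prime p -> (p %| N)%N ->
     (forall i, sqfree (redp p (g i))) /\
     (forall i j, i != j -> coprimep (redp p (g i)) (redp p (g j)))) ->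
  N_regular N f g ->
  N_integral_basis theta N (alpha_family theta N f g ell) <->
  (sqfree_nat N \/
   forall i s len sigma, is_side N f (g i) s len sigma -> denq sigma = 1).
Proof.
move=> f_monic f_irr f_size f_theta N1 p_big g_monic g_size l_gt0 f_mod g_red f_reg.
have f_root : root (ZtoC f) theta by apply/rootP.
split; last exact: integral_basis_of.
exact: basis_condition.
Qed.
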